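(* There exist $2^{\aleph_0}$ pairwise non-quasi-isometric, finitely generated, torsion-free groups $G$, each with a finite generating set $\mathcal S$, such that: - every non-trivial cyclic subgroup of $G$ is strongly contracting in $\mathrm{Cay}(G,\mathcal S)$; - consequently, $G$ has the HEC property.
   Context: Cayley graphs carry the graph metric. A subset $Y$ is strongly contracting if there is a constant $C$ with $d(x,x')\le d(x,Y)\Rightarrow\mathrm{diam}(\pi(x)\cup\pi(x'))\le C$, where $\pi(x)=\{y\in Y:d(x,y)=d(x,Y)\}$. HEC property. The elementary closure $E(g)$ of $g$ is the subgroup generated by all virtually cyclic subgroups containing $g$. A group has the hyperbolically embedded cycles (HEC) property if, for every infinite order element $g$, the subgroup $E(g)$ is virtually cyclic and hyperbolically embedded. A subgroup $H\le G$ is hyperbolically embedded if there is $\mathcal T\subseteq G$ satisfying the following. Let $Z=\mathrm{Cay}(G,H\sqcup\mathcal T)$ (elements of $H\cap\mathcal T$ giving double edges). Let $\hat d$ on $H$ be the length of shortest paths in $Z$ avoiding the edges of $\mathrm{Cay}(H,H)$ ($\infty$ if none). The requirements are: - $H\sqcup\mathcal T$ generates $G$; - $Z$ is Gromov hyperbolic; - $\hat d$-balls in $H$ are finite. *)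

(* Defs.v *)
From Stdlib Require Import List ZArith Arith.
Import ListNotations.
Set Implicit Arguments.

Record Group := {
  carrier :> Type;
  gmul : carrier -> carrier -> carrier;
  gone : carrier;
  ginv : carrier -> carrier;
  gmulA : forall x y z, gmul x (gmul y z) = gmul (gmul x y) z;
  gmul1g : forall x, gmul gone x = x;
  gmulg1 : forall x, gmul x gone = x;
  gmulVg : forall x, gmul (ginv x) x = gone;
  gmulgV : forall x, gmul x (ginv x) = gone
}.

Section GroupDefs.
Variable G : Group.

Fixpoint npow (g : G) (n : nat) : G :=
  match n with O => gone G | S m => gmul G g (npow g m) end.

Definition zpow (g : G) (k : Z) : G :=
  match k with
  | Z0 => gone G
  | Zpos p => npow g (Pos.to_nat p)
  | Zneg p => ginv G (npow g (Pos.to_nat p))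
  end.

Definition cyclic_sub (g : G) : G -> Prop := fun x => exists k : Z, x = zpow g k.

Definition torsion_free : Prop :=
  forall g : G, g <> gone G -> forall n, 0 < n -> npow g n <> gone G.

Definition infinite_order (g : G) : Prop :=
  forall n, 0 < n -> npow g n <> gone G.

Definition subgroup (K : G -> Prop) : Prop :=
  K (gone G) /\ (forall x y, K x -> K y -> K (gmul G x y)) /\
  (forall x, K x -> K (ginv G x)).

Definition gen_sub (A : G -> Prop) : G -> Prop :=
  fun x => forall K, subgroup K -> (forall a, A a -> K a) -> K x.

Definition virtually_cyclic (K : G -> Prop) : Prop :=
  subgroup K /\
  exists (z : G) (reps : list G),
    K z /\ (forall r, In r reps -> K r) /\
    (forall h, K h -> exists r k, In r reps /\ h = gmul G r (zpow z k)).

Definition elem_closure (g : G) : G -> Prop :=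
  gen_sub (fun x => exists K, virtually_cyclic K /\ K g /\ K x).

Definition step (v : G) (p : G * bool) : G :=
  if snd p then gmul G v (fst p) else gmul G v (ginv G (fst p)).

Definition walk (x : G) (w : list (G * bool)) : G := fold_left step w x.

Definition generates (S : list G) : Prop :=
  forall g : G, exists w, Forall (fun p => In (fst p) S) w /\ walk (gone G) w = g.

Definition dist_le (S : list G) (x y : G) (n : nat) : Prop :=
  exists w, Forall (fun p => In (fst p) S) w /\ length w <= n /\ walk x w = y.

Definition dist (S : list G) (x y : G) (n : nat) : Prop :=
  dist_le S x y n /\ forall m, dist_le S x y m -> n <= m.

Definition setdist (S : list G) (x : G) (Y : G -> Prop) (n : nat) : Prop :=
  (exists y, Y y /\ dist S x y n) /\ (forall y m, Y y -> dist S x y m -> n <= m).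

Definition proj (S : list G) (Y : G -> Prop) (x : G) : G -> Prop :=
  fun y => Y y /\ exists n, setdist S x Y n /\ dist S x y n.

Definition strongly_contracting (S : list G) (Y : G -> Prop) : Prop :=
  exists C : nat, forall x x' n,
    setdist S x Y n -> dist_le S x x' n ->
    forall a b, (proj S Y x a \/ proj S Y x' a) ->
                (proj S Y x b \/ proj S Y x' b) -> dist_le S a b C.

(* Z = Cay(G, H ⊔ T): an edge labelled (true,a) with a in H or (false,a) with a in T
   joins v and v a.  A step is (label, a, direction). *)
Definition zstep_ok (H T : G -> Prop) (s : bool * G * bool) : Prop :=
  let '(l, a, _) := s in if l then H a else T a.

Definition zstep (v : G) (s : bool * G * bool) : G :=
  let '(_, a, d) := s in if d then gmul G v a else gmul G v (ginv G a).

Fixpoint zpath (H T : G -> Prop) (x y : G) (w : list (bool * G * bool)) : Prop :=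
  match w with
  | [] => x = y
  | s :: w' => zstep_ok H T s /\ zpath H T (zstep x s) y w'
  end.

(* path avoiding the edges of Cay(H,H): H-labelled edges with both endpoints in H *)
Fixpoint hpath (H T : G -> Prop) (x y : G) (w : list (bool * G * bool)) : Prop :=
  match w with
  | [] => x = y
  | s :: w' =>
      zstep_ok H T s /\
      ~ (fst (fst s) = true /\ H x /\ H (zstep x s)) /\
      hpath H T (zstep x s) y w'
  end.

Definition zdist_le (H T : G -> Prop) (x y : G) (n : nat) : Prop :=
  exists w, length w <= n /\ zpath H T x y w.

Definition zdist (H T : G -> Prop) (x y : G) (n : nat) : Prop :=
  zdist_le H T x y n /\ forall m, zdist_le H T x y m -> n <= m.

(* hat-d(x,y) <= n  (hat-d = infinity if no admissible path) *)
Definition dhat_le (H T : G -> Prop) (x y : G) (n : nat) : Prop :=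
  exists w, length w <= n /\ hpath H T x y w.

(* Gromov hyperbolicity of Z (four-point condition with Gromov products,
   multiplied by 2 to stay in nat):
   (x|y)_w >= min((x|z)_w, (y|z)_w) - delta *)
Definition Z_hyperbolic (H T : G -> Prop) : Prop :=
  exists delta : nat, forall x y z w dxy dxz dyz dxw dyw dzw,
    zdist H T x y dxy -> zdist H T x z dxz -> zdist H T y z dyz ->
    zdist H T x w dxw -> zdist H T y w dyw -> zdist H T z w dzw ->
    (dxw + dzw + dxy <= dxw + dyw + dxz + 2 * delta \/
     dyw + dzw + dxy <= dxw + dyw + dyz + 2 * delta).

Definition hyp_embedded (H : G -> Prop) : Prop :=
  subgroup H /\
  exists T : G -> Prop,
    (forall g : G, exists w, zpath H T (gone G) g w) /\
    Z_hyperbolic H T /\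
    (forall h0 n, H h0 -> exists l : list G,
        forall h, H h -> dhat_le H T h0 h n -> In h l).

Definition HEC : Prop :=
  forall g : G, infinite_order g ->
    virtually_cyclic (elem_closure g) /\ hyp_embedded (elem_closure g).

End GroupDefs.

Arguments dist_le {G}.
Arguments dist {G}.
Arguments generates {G}.
Arguments strongly_contracting {G}.
Arguments cyclic_sub {G}.
Arguments torsion_free : clear implicits.
Arguments HEC : clear implicits.

Definition quasi_isometric {G G' : Group} (S : list G) (S' : list G') : Prop :=
  exists (f : G -> G') (lam c : nat),
    (forall x y n m, dist S x y n -> dist S' (f x) (f y) m ->
        m <= lam * n + c /\ n <= lam * m + c) /\
    (forall z : G', exists x : G, dist_le S' (f x) z c).

(* Main.v *)
(** The groups are doubles [F *_U F] of a free group [F] of rank four along subgroups [U] of infinite rank.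
    [U] is the fundamental group of a labelled ladder: a line, and rungs of rapidly growing lengths
    indexed by a set [I] of natural numbers.  The labels of the line have no long periodic stretches and two
    consecutive rung crossings determine the position in the ladder; hence the hulls of distinct cosets of
    [U] in the tree of [F] have finite overlap, and a long stretch of the axis of [f] in the hull of a
    coset forces [f] to fix that coset.

    The Cayley graph of the double is a tree of trees, in which copies of the tree of [F] (sheets) are glued
    along cosets of [U].  Folding shows that the gluing is isometric, so geodesics from one coset to another
    run straight within a sheet.  Every non-trivial element then has a projection to an axis through which
    geodesics with distant projections must pass, which gives strong contraction.  The elementary closure is
    the commensurator of the axis.  For the hyperbolic embedding the double acts on a tree on which the
    element is loxodromic: the tree of sheets, or, if the element is conjugate into a factor, the tree
    obtained by gluing the sheets along the whole hulls of cosets; coning off the axes of a quasi-tree keeps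
    all bottlenecks.

    Finally, a rung of length [l] yields a loop of length about [4 l] that is not filled at scales below
    [l]; rungs being sparse, the set [I] is determined up to finite sets by the quasi-isometry type.  This is
    made precise with group-valued cocycles defined on pairs of nearby points only, which can be pulled
    back along quasi-isometries. *)

Require Import Defs.
From Stdlib Require Import List ZArith Arith Lia Bool.
From Stdlib Require Import Classical ClassicalEpsilon FunctionalExtensionality
  PropExtensionality ProofIrrelevance.
Import ListNotations.

Local Notation "x ** y" := (gmul _ x y) (at level 40, left associativity).
Local Notation "x ^-" := (ginv _ x) (at level 30, format "x ^-").
Local Notation e1 := (gone _).

Local Arguments gmul : simpl never.
Local Arguments ginv : simpl never.
Local Arguments gone : simpl never.

(** The subgroup [U] must have infinite rank: the double of a free group of finite rank along a
    finitely generated subgroup is finitely presented, and there are only countably many such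
    groups. The amalgam is not built from normal forms. Adjoining an involution [tau] that exchanges
    the factors and commutes with [U] makes the double the even part of a free product of groups of
    order two, one for each coset of [U], extended by the free group. Elements then are pairs of
    reduced words, and normal forms become reduced lists of cosets. Since [tau] costs nothing in the
    metric, its restriction to the even part is the word metric of the double. Fillings of loops are
    never formalised: a cocycle is a test for them, as its holonomy vanishes on every loop that
    bounds at its scale. *)

Definition decide (P : Prop) : {P} + {~ P} := excluded_middle_informative P.

(** * Groups *)

Section GroupLemmas.
Variable G : Group.
Implicit Types x y z g : G.

Lemma mul_assoc x y z : x ** y ** z = x ** (y ** z).
Proof. symmetry; apply gmulA. Qed.

Lemma inv_mul_cancel x y : x^- ** (x ** y) = y.
Proof. rewrite gmulA, gmulVg; apply gmul1g. Qed.

Lemma mul_inv_cancel x y : x ** (x^- ** y) = y.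
Proof. rewrite gmulA, gmulgV; apply gmul1g. Qed.

Lemma inv_unique x y : x ** y = e1 -> y = x^-.
Proof. intro H. rewrite <- (inv_mul_cancel x y), H; apply gmulg1. Qed.

Lemma inv_inv x : x^-^- = x.
Proof. symmetry; apply inv_unique, gmulVg. Qed.

Lemma inv_mul x y : (x ** y)^- = y^- ** x^-.
Proof.
  symmetry; apply inv_unique.
  rewrite mul_assoc, mul_inv_cancel; apply gmulgV.
Qed.

Lemma inv_one : (e1 : G)^- = e1.
Proof. symmetry; apply inv_unique, gmul1g. Qed.

End GroupLemmas.

Global Hint Rewrite mul_assoc inv_mul_cancel mul_inv_cancel inv_inv inv_mul inv_one
  gmul1g gmulg1 gmulVg gmulgV : grp.
Ltac group := autorewrite with grp; try reflexivity.

Section Powers.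
Variable G : Group.
Implicit Types x y z g : G.

Lemma mul_left_inj x y z : x ** y = x ** z -> y = z.
Proof. intro H. rewrite <- (inv_mul_cancel G x y), H. group. Qed.

Lemma mul_right_inj x y z : y ** x = z ** x -> y = z.
Proof. intro H. replace y with (y ** x ** x^-) by group. rewrite H. group. Qed.

Lemma npow_comm g n : npow G g n ** g = g ** npow G g n.
Proof. induction n; simpl; group. rewrite IHn. group. Qed.

Lemma zpow_of_nat g n : zpow G g (Z.of_nat n) = npow G g n.
Proof. destruct n; [reflexivity|]. simpl Z.of_nat; unfold zpow. now rewrite SuccNat2Pos.id_succ. Qed.

Lemma zpow_opp_nat g n : zpow G g (- Z.of_nat n) = (npow G g n)^-.
Proof. destruct n; simpl; group. now rewrite SuccNat2Pos.id_succ; simpl; group. Qed.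

Lemma zpow_succ g k : zpow G g (k + 1) = zpow G g k ** g.
Proof.
  destruct (Z_le_gt_dec 0 k) as [H|H].
  - replace k with (Z.of_nat (Z.to_nat k)) by lia.
    replace (Z.of_nat (Z.to_nat k) + 1)%Z with (Z.of_nat (S (Z.to_nat k))) by lia.
    rewrite !zpow_of_nat, npow_comm. reflexivity.
  - remember (Z.to_nat (- k - 1)) as n.
    replace k with (- Z.of_nat (S n))%Z by lia.
    replace (- Z.of_nat (S n) + 1)%Z with (- Z.of_nat n)%Z by lia.
    rewrite !zpow_opp_nat. simpl. group.
Qed.

Lemma zpow_add g i j : zpow G g (i + j) = zpow G g i ** zpow G g j.
Proof.
  revert j. apply Z.peano_ind.
  - rewrite Z.add_0_r. simpl. group.
  - intros j H. unfold Z.succ. rewrite Z.add_assoc, !zpow_succ, H. group.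
  - intros j H. apply (mul_right_inj g). rewrite mul_assoc, <- !zpow_succ.
    rewrite <- Z.add_assoc. now replace (Z.pred j + 1)%Z with j by lia.
Qed.

Lemma zpow_opp g k : zpow G g (- k) = (zpow G g k)^-.
Proof.
  apply inv_unique. rewrite <- zpow_add. now replace (k + - k)%Z with 0%Z by lia.
Qed.

Lemma zpow_sub g i j : zpow G g (i - j) = zpow G g i ** (zpow G g j)^-.
Proof. unfold Z.sub. now rewrite zpow_add, zpow_opp. Qed.

Lemma zpow_1 g : zpow G g 1 = g.
Proof. simpl. group. Qed.

Lemma zpow_mul g i j : zpow G g (i * j) = zpow G (zpow G g i) j.
Proof.
  revert j. apply Z.peano_ind.
  - now rewrite Z.mul_0_r.
  - intros j H. unfold Z.succ.
    rewrite Z.mul_add_distr_l, Z.mul_1_r, zpow_add, zpow_succ, H. reflexivity.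
  - intros j H. apply (mul_right_inj (zpow G g i)). rewrite <- zpow_succ, <- zpow_add.
    replace (Z.pred j + 1)%Z with j by lia. rewrite <- H. f_equal. lia.
Qed.

Lemma zpow_conj h g k : zpow G (h ** g ** h^-) k = h ** zpow G g k ** h^-.
Proof.
  revert k. apply Z.peano_ind.
  - simpl. group.
  - intros k H. unfold Z.succ. rewrite !zpow_succ, H. group.
  - intros k H. apply (mul_right_inj (h ** g ** h^-)). rewrite <- zpow_succ.
    replace (Z.pred k + 1)%Z with k by lia. rewrite H.
    replace k with (Z.pred k + 1)%Z at 1 by lia. rewrite zpow_succ. group.
Qed.

Lemma zpow_subgroup (K : G -> Prop) g k : subgroup G K -> K g -> K (zpow G g k).
Proof.
  intros (H1 & HM & HV) Hg.
  assert (Hn : forall n, K (npow G g n)) by (induction n; simpl; auto).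
  destruct k; simpl; auto.
Qed.

Lemma zpow_comm g i j : zpow G g i ** zpow G g j = zpow G g j ** zpow G g i.
Proof. rewrite <- !zpow_add. f_equal. lia. Qed.

Lemma zpow_inv_comm g i j : zpow G g i ** (zpow G g j)^- = (zpow G g j)^- ** zpow G g i.
Proof. rewrite <- zpow_opp. apply zpow_comm. Qed.

End Powers.

Definition least (P : nat -> Prop) : nat :=
  epsilon (inhabits 0) (fun n => P n /\ forall m, P m -> n <= m).

Lemma least_spec (P : nat -> Prop) :
  (exists n, P n) -> P (least P) /\ forall m, P m -> least P <= m.
Proof.
  intros [n Hn]. unfold least. apply epsilon_spec.
  induction n as [n IH] using lt_wf_ind.
  destruct (classic (exists m, m < n /\ P m)) as [(m & Hm & HP)|H].
  - eauto.
  - exists n; split; auto. intros m HPm. destruct (le_lt_dec n m); auto.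
    exfalso; eauto.
Qed.

(** * Reduced words over an alphabet with involution *)

Section ReducedWords.
Variable A : Type.
Variable inv : A -> A.
Hypothesis invK : forall a, inv (inv a) = a.

Fixpoint reduced (w : list A) : Prop :=
  match w with
  | x :: w' => match w' with y :: _ => y <> inv x | [] => True end /\ reduced w'
  | [] => True
  end.

Definition push (a : A) (w : list A) : list A :=
  match w with
  | b :: w' => if decide (b = inv a) then w' else a :: w
  | [] => [a]
  end.

Definition wmul (u v : list A) : list A := fold_right push v u.
Definition winv (u : list A) : list A := rev (map inv u).

Lemma wmul_cons a u v : wmul (a :: u) v = push a (wmul u v).
Proof. reflexivity. Qed.

Lemma reduced_tail a w : reduced (a :: w) -> reduced w.
Proof. simpl; tauto. Qed.

Lemma reduced_push a w : reduced w -> reduced (push a w).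
Proof.
  destruct w as [|b w]; simpl; auto.
  destruct (decide (b = inv a)); simpl; tauto.
Qed.

Lemma push_cons a w : reduced (a :: w) -> push a w = a :: w.
Proof.
  destruct w as [|b w]; simpl; auto. intros [H _].
  destruct (decide (b = inv a)); tauto.
Qed.

Lemma push_inv a w : reduced w -> push a (push (inv a) w) = w.
Proof.
  intro H. destruct w as [|b w]; simpl.
  - destruct (decide (inv a = inv a)); tauto.
  - destruct (decide (b = inv (inv a))) as [->|n].
    + rewrite invK in *. now apply push_cons.
    + simpl. destruct (decide (inv a = inv a)); tauto.
Qed.

Lemma push_inv' a w : reduced w -> push (inv a) (push a w) = w.
Proof. intro H. rewrite <- (invK a) at 2. now apply push_inv. Qed.

Lemma reduced_wmul u v : reduced v -> reduced (wmul u v).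
Proof. intro H. induction u; simpl; auto using reduced_push. Qed.

Lemma wmul_push a u v : reduced v -> wmul (push a u) v = push a (wmul u v).
Proof.
  intro H. destruct u as [|b u]; simpl; auto.
  destruct (decide (b = inv a)) as [->|n]; simpl; auto.
  now rewrite push_inv; auto using reduced_wmul.
Qed.

Lemma wmul_assoc u v w : reduced w -> wmul (wmul u v) w = wmul u (wmul v w).
Proof.
  intro H. induction u; simpl; auto. now rewrite wmul_push, IHu.
Qed.

Lemma wmul_app u v w : wmul (u ++ v) w = wmul u (wmul v w).
Proof. apply fold_right_app. Qed.

Lemma wmul_reduced_app u v : reduced (u ++ v) -> wmul u v = u ++ v.
Proof.
  induction u as [|a u IH]; simpl; auto.
  intro H. rewrite IH by tauto. now apply push_cons.
Qed.

Lemma wmul_nil_r u : reduced u -> wmul u [] = u.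
Proof. intro H. rewrite wmul_reduced_app; now rewrite app_nil_r. Qed.

Lemma winv_app u v : winv (u ++ v) = winv v ++ winv u.
Proof. unfold winv. now rewrite map_app, rev_app_distr. Qed.

Lemma winv_winv u : winv (winv u) = u.
Proof.
  unfold winv. rewrite map_rev, rev_involutive, map_map.
  rewrite <- map_id. apply map_ext. auto.
Qed.

Lemma winv_length u : length (winv u) = length u.
Proof. unfold winv. now rewrite length_rev, length_map. Qed.

Lemma wmul_winv_app u v : reduced v -> wmul (winv u) (wmul u v) = v.
Proof.
  intro H. induction u as [|a u IH]; auto.
  change (a :: u) with ([a] ++ u). rewrite winv_app, wmul_app. simpl.
  rewrite push_inv'; auto using reduced_wmul.
Qed.

Lemma wmul_winv_l u : reduced u -> wmul (winv u) u = [].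
Proof.
  intro H. rewrite <- (wmul_nil_r u H) at 2. now apply wmul_winv_app.
Qed.

Lemma reduced_app_l u v : reduced (u ++ v) -> reduced u.
Proof.
  induction u as [|a u IH]; simpl; auto. intros [H1 H2]. split; auto.
  destruct u; simpl in *; auto.
Qed.

Lemma reduced_app_r u v : reduced (u ++ v) -> reduced v.
Proof. induction u; auto. intro H. apply IHu. simpl in H. tauto. Qed.

Lemma reduced_app u v : reduced u -> reduced v ->
  (forall u' a b v', u = u' ++ [a] -> v = b :: v' -> b <> inv a) -> reduced (u ++ v).
Proof.
  induction u as [|a u IH]; auto. intros Hu Hv Hj.
  destruct u as [|c u].
  - destruct v as [|b v]; [now simpl|]. simpl. split; auto.
    now apply (Hj [] a b v).
  - simpl. split; [simpl in Hu; tauto|]. apply IH; auto.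
    + simpl in *; tauto.
    + intros u' x b v' E1 E2. apply (Hj (a :: u') x b v'); auto. now rewrite E1.
Qed.

Lemma reduced_junction u a b v : reduced (u ++ a :: b :: v) -> b <> inv a.
Proof. intro H. apply reduced_app_r in H. simpl in H. tauto. Qed.

Lemma reduced_winv u : reduced u -> reduced (winv u).
Proof.
  induction u as [|a u IH]; auto. intro H.
  change (a :: u) with ([a] ++ u). rewrite winv_app.
  apply reduced_app; simpl; auto.
  - apply IH. simpl in H; tauto.
  - intros u' x b v' E1 E2. injection E2 as <- <-. intro E.
    assert (Ha : a = x) by (rewrite <- (invK a), <- (invK x); congruence). subst x.
    destruct u as [|c u]; [now destruct u'|].
    change (c :: u) with ([c] ++ u) in E1. rewrite winv_app in E1.
    apply app_inj_tail in E1. destruct E1 as [_ E1].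
    destruct H as [H _]. apply H. congruence.
Qed.

Lemma wmul_winv_r u : reduced u -> wmul u (winv u) = [].
Proof.
  intro H. rewrite <- (winv_winv u) at 1. apply wmul_winv_l. now apply reduced_winv.
Qed.

Lemma push_length a w : length (push a w) <= S (length w) /\ length w <= S (length (push a w)).
Proof.
  destruct w as [|b w]; simpl; [lia|]. destruct (decide (b = inv a)); simpl; lia.
Qed.

Lemma wmul_length u v : length (wmul u v) <= length u + length v.
Proof. induction u; simpl; auto. pose proof (push_length a (wmul u v)). lia. Qed.

Lemma wmul_length_ge u v : length v <= length u + length (wmul u v).
Proof. induction u; simpl; auto. pose proof (push_length a (wmul u v)). lia. Qed.

(** Multiplication by [u] cancels at most [length u] letters of [p], so [r] stays out of reach. *)
Lemma wmul_long u p r : length u <= length p -> wmul u (p ++ r) = wmul u p ++ r.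
Proof.
  induction u as [|a u IH]; simpl; auto. intro H. rewrite IH by lia.
  pose proof (wmul_length_ge u p).
  destruct (wmul u p) as [|b q]; [simpl in *; lia|].
  simpl. now destruct (decide (b = inv a)).
Qed.

Lemma push_parity a w : Nat.even (length (push a w)) = negb (Nat.even (length w)).
Proof.
  destruct w as [|b w]; auto.
  unfold push. destruct (decide (b = inv a)).
  - simpl length. rewrite Nat.even_succ, <- Nat.negb_even. now rewrite negb_involutive.
  - simpl length. now rewrite (Nat.even_succ (S (length w))), <- Nat.negb_even.
Qed.

(** Letters cancel in pairs, so the parity of the length is a homomorphism; for words in cosets its
    kernel will cut out the double. *)
Lemma wmul_parity u v :
  Nat.even (length (wmul u v)) = Bool.eqb (Nat.even (length u)) (Nat.even (length v)).
Proof.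
  induction u as [|a u IH].
  - simpl. now destruct (Nat.even (length v)).
  - simpl wmul. rewrite push_parity, IH. simpl length.
    rewrite (Nat.even_succ (length u)), <- Nat.negb_even.
    now destruct (Nat.even (length u)), (Nat.even (length v)).
Qed.

(** What cancels is the longest common prefix [p]. Comparing heads as options lets the last clause
    express maximality also when a remainder is empty. *)
Lemma wmul_winv_prefix u v : reduced u -> reduced v ->
  exists p u' v', u = p ++ u' /\ v = p ++ v' /\ wmul (winv u) v = winv u' ++ v' /\
    (hd_error u' = hd_error v' -> u' = [] /\ v' = []).
Proof.
  revert v. induction u as [|a u IH]; intros v Hu Hv.
  - exists [], [], v. simpl. repeat split; auto. now destruct v.
  - destruct v as [|b v].
    + exists [], (a :: u), []. repeat split; auto; try discriminate.
      rewrite wmul_nil_r, app_nil_r; auto using reduced_winv.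
    + destruct (decide (a = b)) as [<-|n].
      * destruct (IH v) as (p & u' & v' & E1 & E2 & E3 & H).
        { simpl in Hu; tauto. } { simpl in Hv; tauto. }
        exists (a :: p), u', v'. simpl. do 2 (split; [congruence|]). split; [|exact H].
        change (a :: u) with ([a] ++ u). rewrite winv_app, wmul_app. simpl.
        destruct (decide (a = inv (inv a))) as [_|n]; [|now rewrite invK in n].
        exact E3.
      * exists [], (a :: u), (b :: v). do 2 (split; [reflexivity|]).
        split; [|simpl; congruence].
        rewrite wmul_reduced_app; auto. apply reduced_app; auto using reduced_winv.
        intros u' x c v' E1 E2. injection E2 as <- <-. intro E. apply n.
        change (a :: u) with ([a] ++ u) in E1. rewrite winv_app in E1. simpl in E1.
        apply app_inj_tail in E1. destruct E1 as [_ <-]. now rewrite E, invK.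
Qed.

(** At most [length l] letters of [k] cancel, and they are its last ones. *)
Lemma hd_wmul k l : reduced k -> reduced l -> length l < length k ->
  hd_error (wmul k l) = hd_error k.
Proof.
  intros Rk Rl L.
  destruct (wmul_winv_prefix (winv k) l) as (p & u & v & E1 & E2 & E3 & _); auto using reduced_winv.
  rewrite winv_winv in E3.
  assert (Ek : k = winv u ++ winv p) by (rewrite <- (winv_winv k), E1; apply winv_app).
  assert (Lu : length (winv u) <> 0).
  { rewrite Ek, E2, !length_app, !winv_length in L. rewrite winv_length. lia. }
  rewrite E3, Ek. destruct (winv u); [simpl in Lu; lia|reflexivity].
Qed.

Lemma in_push c a w : In c (push a w) -> c = a \/ In c w.
Proof.
  destruct w as [|b w]; simpl; [intuition auto|].
  destruct (decide (b = inv a)); simpl; intuition auto.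
Qed.

Lemma in_wmul c u v : In c (wmul u v) -> In c u \/ In c v.
Proof.
  induction u as [|a u IH]; auto. rewrite wmul_cons. intro H. apply in_push in H.
  simpl. intuition auto.
Qed.

Definition word := {w : list A | reduced w}.

Lemma word_eq (x y : word) : proj1_sig x = proj1_sig y -> x = y.
Proof.
  destruct x as [x Hx], y as [y Hy]; simpl. intros <-. f_equal. apply proof_irrelevance.
Qed.

Definition words : Group.
Proof.
  refine {| carrier := word;
            gmul x y := exist _ (wmul (proj1_sig x) (proj1_sig y)) (reduced_wmul _ _ (proj2_sig y));
            gone := exist _ [] I;
            ginv x := exist _ (winv (proj1_sig x)) (reduced_winv _ (proj2_sig x)) |};
    intros; apply word_eq; simpl.
  - symmetry. apply wmul_assoc, (proj2_sig z).
  - reflexivity.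
  - apply wmul_nil_r, (proj2_sig x).
  - apply wmul_winv_l, (proj2_sig x).
  - apply wmul_winv_r, (proj2_sig x).
Defined.

End ReducedWords.

Arguments reduced {A}.
Arguments push {A}.
Arguments wmul {A}.
Arguments winv {A}.
Arguments words {A}.

(** * The free group of rank four and its Cayley tree *)

Inductive gen := La | Lb | Lc | Ld.
Definition letter : Type := gen * bool.
Definition linv (l : letter) : letter := (fst l, negb (snd l)).

Lemma linvK l : linv (linv l) = l.
Proof. destruct l as [x []]; reflexivity. Qed.

Lemma linv_neq l : l <> linv l.
Proof. destruct l as [x []]; discriminate. Qed.

Definition Fr : Group := words linv linvK.
Definition wd (f : Fr) : list letter := proj1_sig f.
Definition flen (f : Fr) : nat := length (wd f).
Definition fd (x y : Fr) : nat := flen (x^- ** y).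

Lemma wd_eq (x y : Fr) : wd x = wd y -> x = y.
Proof. apply word_eq. Qed.

Lemma wd_reduced (f : Fr) : reduced linv (wd f).
Proof. exact (proj2_sig f). Qed.

Lemma wd_mul (x y : Fr) : wd (x ** y) = wmul linv (wd x) (wd y).
Proof. reflexivity. Qed.

Lemma wd_inv (x : Fr) : wd (x^-) = winv linv (wd x).
Proof. reflexivity. Qed.

Definition of_letter (l : letter) : Fr := exist _ [l] (conj I I).
Definition of_word (w : list letter) (H : reduced linv w) : Fr := exist _ w H.

Lemma of_letter_inv l : (of_letter l)^- = of_letter (linv l).
Proof. now apply wd_eq. Qed.

Lemma flen_mul x y : flen (x ** y) <= flen x + flen y.
Proof. apply wmul_length. Qed.

Lemma flen_inv x : flen (x^-) = flen x.
Proof. apply winv_length. Qed.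

Lemma flen_0 x : flen x = 0 -> x = e1.
Proof. intro H. apply wd_eq. now apply length_zero_iff_nil. Qed.

Lemma fd_sym x y : fd x y = fd y x.
Proof. unfold fd. rewrite <- flen_inv. f_equal. group. Qed.

Lemma fd_tri x y z : fd x z <= fd x y + fd y z.
Proof.
  unfold fd. replace (x^- ** z) with ((x^- ** y) ** (y^- ** z)) by group.
  apply flen_mul.
Qed.

Lemma fd_left g x y : fd (g ** x) (g ** y) = fd x y.
Proof. unfold fd. f_equal. group. Qed.

Lemma fd_one x : fd e1 x = flen x.
Proof. unfold fd. f_equal. group. Qed.

Lemma fd_refl x : fd x x = 0.
Proof. unfold fd. rewrite gmulVg. reflexivity. Qed.

Lemma fd_0 x y : fd x y = 0 -> x = y.
Proof.
  intro H. apply flen_0 in H. apply (mul_left_inj Fr (x^-)). rewrite H. group.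
Qed.

(** The branch at the identity of the Cayley tree that contains [f], with [None] for the identity
    itself; points with different values have the identity on the geodesic between them. *)
Definition fhd (f : Fr) : option letter := hd_error (wd f).

Lemma fhd_None f : fhd f = None -> f = e1.
Proof. intro H. apply wd_eq. unfold fhd in H. now destruct (wd f). Qed.

Lemma wd_inv_mul x y : fhd x <> fhd y -> wd (x^- ** y) = winv linv (wd x) ++ wd y.
Proof.
  intro H. rewrite wd_mul, wd_inv.
  destruct (wmul_winv_prefix _ linv linvK (wd x) (wd y) (wd_reduced x) (wd_reduced y))
    as (p & u & v & E1 & E2 & E3 & _).
  rewrite E3. destruct p as [|a p]; [simpl in *; congruence|].
  exfalso. apply H. unfold fhd. now rewrite E1, E2.
Qed.

Lemma fd_hd x y : fhd x <> fhd y -> fd x y = flen x + flen y.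
Proof.
  intro H. unfold fd, flen. rewrite wd_inv_mul, length_app, winv_length; auto.
Qed.

Lemma wmul_full u v : length (wmul linv u v) = length u + length v -> wmul linv u v = u ++ v.
Proof.
  induction u as [|a u IH]; auto. rewrite wmul_cons. intro H. simpl length in H.
  pose proof (proj1 (push_length _ linv a (wmul linv u v))) as H1.
  pose proof (wmul_length _ linv u v) as H2.
  assert (Hl : length (wmul linv u v) = length u + length v) by lia.
  specialize (IH Hl). rewrite IH in *. simpl app. destruct (u ++ v) as [|b w]; auto.
  simpl in *. destruct (decide (b = linv a)); simpl in *; auto. lia.
Qed.

Definition on_path (x z y : Fr) : Prop := fd x z + fd z y = fd x y.

Lemma on_path_wd x z y : on_path x z y -> wd (x^- ** y) = wd (x^- ** z) ++ wd (z^- ** y).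
Proof.
  unfold on_path, fd, flen. intro H.
  replace (x^- ** y) with ((x^- ** z) ** (z^- ** y)) in * by group.
  rewrite (wd_mul (x^- ** z)) in *. apply wmul_full. lia.
Qed.

Lemma on_path_hd x y : fhd x <> fhd y -> on_path x e1 y.
Proof. intro H. red. rewrite fd_one, fd_sym, fd_one, fd_hd; auto. Qed.

Lemma on_path_left g x z y : on_path (g ** x) (g ** z) (g ** y) <-> on_path x z y.
Proof. unfold on_path. now rewrite !fd_left. Qed.

(** The edge from the identity to [l] cuts the tree in two. Translation by the inverse of [l] moves
    it to the edge labelled [linv l] and exchanges the roles of its sides. *)
Lemma fhd_step_back l g : fhd ((of_letter l)^- ** g) = Some (linv l) <-> fhd g <> Some l.
Proof.
  unfold fhd. rewrite wd_mul, of_letter_inv. simpl.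
  pose proof (wd_reduced g) as R. destruct (wd g) as [|b w]; simpl.
  - split; intros; congruence.
  - destruct (decide (b = linv (linv l))) as [->|n]; simpl; rewrite linvK in *.
    + split; [|congruence]. intro H. exfalso.
      destruct w as [|c w]; simpl in *; [discriminate|]. destruct R. congruence.
    + split; intros; congruence.
Qed.

(** * The ladder *)

Fixpoint val2_odd (p : positive) : bool :=
  match p with xO q => negb (val2_odd q) | _ => false end.

(** The label of the edge [(z, z+1)]: the parity of the 2-adic valuation of [z], with [Lc] at [0].
    It has no long periodic stretches. *)
Definition sigma (z : Z) : gen :=
  match z with
  | Z0 => Lc
  | Zpos p | Zneg p => if val2_odd p then La else Lb
  end.

Definition flip (x : gen) : gen := match x with La => Lb | Lb => La | y => y end.

Lemma sigma_odd k : sigma (2 * k + 1) = Lb.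
Proof. destruct k as [|p|p]; simpl; auto. destruct p; reflexivity. Qed.

Lemma sigma_double k : sigma (2 * k) = flip (sigma k).
Proof. destruct k as [|p|p]; simpl; auto; now destruct (val2_odd p). Qed.

Lemma sigma_Lc z : sigma z = Lc -> z = 0%Z.
Proof. destruct z as [|p|p]; simpl; auto; destruct (val2_odd p); discriminate. Qed.

Lemma sigma_not_Ld z : sigma z <> Ld.
Proof. destruct z as [|p|p]; simpl; try destruct (val2_odd p); discriminate. Qed.

Lemma sigma_mismatch_odd (p v : Z) : Z.odd p = true ->
  exists i, (0 <= i < 4)%Z /\ sigma (v + i) <> sigma (v + i + p).
Proof.
  (* This makes [v + i + p] equal to 2 modulo 4, labelled [La], while [v + i] is odd, labelled
     [Lb]. *)
  intro Hp. exists ((2 - p - v) mod 4)%Z.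
  split; [apply Z.mod_pos_bound; lia|].
  pose proof (Z.div_mod (2 - p - v) 4 ltac:(lia)) as E.
  set (k := ((2 - p - v) / 4)%Z) in *. set (i := ((2 - p - v) mod 4)%Z) in *.
  apply Z.odd_spec in Hp. destruct Hp as [q Hq].
  replace (v + i + p)%Z with (2 * (2 * (- k) + 1))%Z by lia.
  replace (v + i)%Z with (2 * (- 2 * k - q) + 1)%Z by lia.
  rewrite sigma_double, !sigma_odd. discriminate.
Qed.

(** [sigma] is self-similar: on even positions it is [sigma] of the half with [La] and [Lb]
    exchanged. A mismatch for the period [p] among the halves doubles to one for [2 p]; odd periods
    are the base case. *)
Lemma sigma_mismatch_pos (p : positive) (v : Z) :
  exists i, (0 <= i < 4 * Zpos p)%Z /\ sigma (v + i) <> sigma (v + i + Zpos p).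
Proof.
  revert v. induction p as [p _|p IH|]; intro v.
  - destruct (sigma_mismatch_odd (Zpos p~1) v eq_refl) as (i & Hi & H).
    exists i. split; auto. lia.
  - destruct (IH ((v + 1) / 2)%Z) as (j & Hj & H).
    pose proof (Z.div_mod (v + 1) 2 ltac:(lia)) as E.
    pose proof (Z.mod_pos_bound (v + 1) 2 ltac:(lia)) as B.
    set (k := ((v + 1) / 2)%Z) in *. set (r := ((v + 1) mod 2)%Z) in *.
    exists (1 - r + 2 * j)%Z. split; [lia|].
    replace (v + (1 - r + 2 * j))%Z with (2 * (k + j))%Z by lia.
    replace (2 * (k + j) + Zpos p~0)%Z with (2 * (k + j + Zpos p))%Z by lia.
    rewrite !sigma_double. intro E2. apply H.
    now destruct (sigma (k + j)), (sigma (k + j + Zpos p)).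
  - destruct (sigma_mismatch_odd 1 v eq_refl) as (i & Hi & H).
    exists i. split; auto.
Qed.

Lemma sigma_mismatch (v w : Z) : v <> w ->
  exists i, (0 <= i < 4 * Z.abs (v - w))%Z /\ sigma (v + i) <> sigma (w + i).
Proof.
  intro n. destruct (Z_lt_le_dec v w) as [H|H].
  - destruct (sigma_mismatch_pos (Z.to_pos (w - v)) v) as (i & Hi & Hs).
    rewrite Z2Pos.id in * by lia. exists i. split; [lia|].
    now replace (w + i)%Z with (v + i + (w - v))%Z by lia.
  - destruct (sigma_mismatch_pos (Z.to_pos (v - w)) w) as (i & Hi & Hs).
    rewrite Z2Pos.id in * by lia. exists i. split; [lia|].
    replace (v + i)%Z with (w + i + (v - w))%Z by lia. auto.
Qed.

(** This is (n+2)!/2. The ratio of consecutive lengths tends to infinity, so that quasi-isometry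
    constants are eventually negligible, and it is at least 3, so that differences of lengths are
    unambiguous. *)
Fixpoint ell (n : nat) : nat := match n with O => 1 | S m => (m + 3) * ell m end.

Lemma ell_pos n : 1 <= ell n.
Proof. induction n; simpl; nia. Qed.

Lemma ell_lt m n : m < n -> 3 * ell m <= ell n.
Proof.
  induction n as [|n IH]; intro H; [lia|]. simpl. pose proof (ell_pos n).
  destruct (Nat.eq_dec m n) as [->|]; [nia|]. assert (3 * ell m <= ell n) by (apply IH; lia). nia.
Qed.

Lemma ell_inj m n : ell m = ell n -> m = n.
Proof.
  intro H. pose proof (ell_pos m). destruct (lt_eq_lt_dec m n) as [[L| ->]|L]; auto;
  apply ell_lt in L; lia.
Qed.

(** A non-zero difference of two lengths is, in absolute value, less than the larger one and at
    least two thirds of it. This singles out the larger length, and then the smaller one. *)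
Lemma ell_diff n n' m m' : (Z.of_nat (ell n) - Z.of_nat (ell n') =
  Z.of_nat (ell m) - Z.of_nat (ell m'))%Z -> n <> n' -> n = m.
Proof.
  intros E N.
  destruct (lt_eq_lt_dec n n') as [[L|L]|L]; [|lia|];
  destruct (lt_eq_lt_dec m m') as [[L'|L']|L'];
  try (subst; pose proof (ell_lt _ _ L); pose proof (ell_pos n); pose proof (ell_pos n'); lia);
  pose proof (ell_lt _ _ L); pose proof (ell_lt _ _ L');
  pose proof (ell_pos n); pose proof (ell_pos n'); pose proof (ell_pos m); pose proof (ell_pos m');
  try lia.
  - destruct (lt_eq_lt_dec n' m') as [[K|K]|K].
    + apply ell_lt in K. lia.
    + subst. apply ell_inj. lia.
    + apply ell_lt in K. lia.
  - destruct (lt_eq_lt_dec n m) as [[K|K]|K]; auto; apply ell_lt in K; lia.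
Qed.

Section Ladder.
Variable I : nat -> Prop.
Local Open Scope Z_scope.

(** The ladder is the line [Z] labelled by [sigma], together with a rung labelled [Ld] from [ell n] to
    [- ell n] for each [n] in [I]. *)
Definition edge (v : Z) (l : letter) (v' : Z) : Prop :=
  (fst l = Ld /\ v' = - v /\ exists n, I n /\ v = if snd l then Z.of_nat (ell n) else - Z.of_nat (ell n)) \/
  (fst l = sigma (if snd l then v else v') /\ v' = if snd l then v + 1 else v - 1).

Fixpoint rd (v : Z) (w : list letter) (v' : Z) : Prop :=
  match w with
  | [] => v = v'
  | l :: w' => exists u, edge v l u /\ rd u w' v'
  end.

Definition readable v w := exists v', rd v w v'.

Lemma edge_det v l v1 v2 : edge v l v1 -> edge v l v2 -> v1 = v2.
Proof.
  destruct l as [x b]. unfold edge; simpl.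
  intros [(E1 & E2 & _)|(E1 & E2)] [(E3 & E4 & _)|(E3 & E4)]; try congruence; subst x;
  exfalso; eapply sigma_not_Ld; eauto.
Qed.

Lemma edge_inv v l v' : edge v l v' -> edge v' (linv l) v.
Proof.
  destruct l as [x b]. unfold edge; simpl. intros [(E1 & E2 & n & Hn & E3)|(E1 & E2)].
  - left. repeat split; auto; [lia|]. exists n. split; auto. destruct b; simpl; lia.
  - right. destruct b; simpl; split; auto; lia.
Qed.

Lemma edge_inj v1 v2 l v : edge v1 l v -> edge v2 l v -> v1 = v2.
Proof. intros H1 H2. apply edge_inv in H1, H2. eapply edge_det; eauto. Qed.

(** Rungs join opposite vertices, so a crossing keeps the distance to 0: a reading of length [k]
    from 0 sees no rung farther out than [k]. *)
Lemma edge_abs v l v' : edge v l v' -> Z.abs v' <= Z.abs v + 1.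
Proof. intros [(E1 & E2 & _)|(E1 & E2)]; destruct (snd l); lia. Qed.

(** A label acts on the line as one translation or reflection, whatever the vertex, so two
    simultaneous readings keep their distance. *)
Lemma edge_diff v w l v' w' : edge v l v' -> edge w l w' -> Z.abs (v' - w') = Z.abs (v - w).
Proof.
  intros [(E1 & E2 & _)|(E1 & E2)] [(E3 & E4 & _)|(E3 & E4)]; try (destruct (snd l); lia);
  exfalso; eapply sigma_not_Ld; rewrite <- ?E1, <- ?E3; eauto; congruence.
Qed.

Lemma rd_app v w1 w2 v' : rd v (w1 ++ w2) v' <-> exists u, rd v w1 u /\ rd u w2 v'.
Proof.
  revert v. induction w1 as [|l w1 IH]; intro v; simpl.
  - split; [now eauto|]. now intros (u & -> & H).
  - split.
    + intros (u & H1 & H2). apply IH in H2. destruct H2 as (u' & H2 & H3). eauto.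
    + intros (u & (u' & H1 & H2) & H3). exists u'. split; auto. apply IH. eauto.
Qed.

Lemma rd_winv v w v' : rd v w v' -> rd v' (winv linv w) v.
Proof.
  revert v. induction w as [|l w IH]; simpl; intro v; [auto|].
  intros (u & E & H). change (l :: w) with ([l] ++ w). rewrite winv_app.
  apply rd_app. exists u. split; auto. simpl. exists v. split; auto. now apply edge_inv.
Qed.

Lemma rd_push v l u w v' : edge v l u -> rd u w v' -> rd v (push linv l w) v'.
Proof.
  intros E H. destruct w as [|b w]; simpl; [eauto|].
  destruct (decide (b = linv l)) as [->|n]; simpl; [|eauto].
  destruct H as (x & E' & H). apply edge_inv in E'. rewrite linvK in E'.
  now rewrite (edge_inj v x l u).
Qed.

Lemma rd_wmul v w1 u w2 v' : rd v w1 u -> rd u w2 v' -> rd v (wmul linv w1 w2) v'.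
Proof.
  revert v. induction w1 as [|l w1 IH]; simpl; intro v; [now intros ->|].
  intros (x & E & H) H2. eapply rd_push; eauto.
Qed.

Lemma rd_abs v w v' : rd v w v' -> Z.abs v' <= Z.abs v + Z.of_nat (length w).
Proof.
  revert v. induction w as [|l w IH]; simpl length; intro v; [simpl; intros ->; lia|].
  intros (u & E & H). apply IH in H. apply edge_abs in E. lia.
Qed.

Lemma rd_abs_rev v w v' : rd v w v' -> Z.abs v <= Z.abs v' + Z.of_nat (length w).
Proof. intro H. apply rd_winv, rd_abs in H. now rewrite winv_length in H. Qed.

Lemma rd_diff v w z v' w' : rd v z v' -> rd w z w' -> Z.abs (v' - w') = Z.abs (v - w).
Proof.
  revert v w. induction z as [|l z IH]; simpl; intros v w; [now intros -> ->|].
  intros (x & E & H) (y & E' & H'). rewrite (IH _ _ H H'). eapply edge_diff; eauto.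
Qed.

Lemma readable_app_l v w1 w2 : readable v (w1 ++ w2) -> readable v w1.
Proof. intros [v' H]. apply rd_app in H. destruct H as (u & H & _). now exists u. Qed.

Definition no_rung (z : list letter) : Prop := Forall (fun l => fst l <> Ld) z.
Definition sgn (b : bool) : Z := if b then 1 else -1.

(** An edge carries the label of its lower end, hence the shift by -1 when the run goes down. *)
Lemma line_run b z v v' : no_rung z -> Forall (fun l => snd l = b) z -> rd v z v' ->
  v' = v + sgn b * Z.of_nat (length z) /\
  forall i, (i < length z)%nat ->
    fst (nth i z (La, b)) = sigma (v + sgn b * Z.of_nat i + (if b then 0 else -1)).
Proof.
  intro N. revert v. induction N as [|l z Hl N IH]; intros v Hb H.
  - simpl in *. split; [lia|]. intros i Hi. lia.
  - inversion Hb as [|? ? Hbl Hbz]; subst. destruct H as (u & E & H).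
    destruct E as [(E1 & _)|(E1 & E2)]; [contradiction|].
    destruct (IH u Hbz H) as [I1 I2]. split.
    + rewrite I1, E2. simpl length. destruct (snd l); unfold sgn; lia.
    + intros [|i] Hi.
      * simpl nth. rewrite E1, E2. f_equal. destruct (snd l); unfold sgn; lia.
      * simpl nth. rewrite I2 by (simpl in Hi; lia). f_equal. rewrite E2.
        destruct (snd l); unfold sgn; lia.
Qed.

(** A reduced word cannot turn back on the line, since that would read an edge and its inverse in
    succession. *)
Lemma line_sign z v : reduced linv z -> no_rung z -> readable v z ->
  exists b, Forall (fun l => snd l = b) z.
Proof.
  intros R N. revert v. induction N as [|l z Hl N IH]; intros v [v' H]; [exists true; constructor|].
  destruct H as (u & E & H). destruct (IH (reduced_tail _ _ _ _ R) u) as [b Hb]; [now exists v'|].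
  exists (snd l). constructor; auto. destruct z as [|l' z]; [constructor|].
  inversion Hb as [|? ? Hb1 Hb2]; subst. inversion N as [|? ? N1 N2]; subst.
  enough (snd l = snd l') as -> by (constructor; auto).
  destruct E as [(E1 & _)|(E1 & E2)]; [contradiction|].
  destruct H as (u' & [(E3 & _)|(E3 & E4)] & _); [contradiction|].
  destruct (bool_dec (snd l) (snd l')) as [|n]; auto.
  exfalso. destruct R as [R _]. apply R. destruct l as [x s], l' as [x' s']. unfold linv. simpl in *.
  assert (s' = negb s) as -> by (destruct s, s'; simpl; congruence).
  f_equal. rewrite E1, E3. destruct s; simpl in *; f_equal; lia.
Qed.

Lemma line_bound v w z : v <> w -> reduced linv z -> no_rung z -> readable v z -> readable w z ->
  Z.of_nat (length z) < 4 * Z.abs (v - w).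
Proof.
  intros n R N Hv Hw. destruct (line_sign z v R N Hv) as [b Hb].
  destruct Hv as [v' Hv], Hw as [w' Hw].
  destruct (line_run b z v v' N Hb Hv) as [_ Hv2].
  destruct (line_run b z w w' N Hb Hw) as [_ Hw2].
  set (L := Z.of_nat (length z)) in *.
  destruct (Z_lt_le_dec L (4 * Z.abs (v - w))) as [|C]; auto. exfalso.
  destruct b.
  - destruct (sigma_mismatch v w n) as (i & Hi & Hs). apply Hs.
    specialize (Hv2 (Z.to_nat i) ltac:(lia)). specialize (Hw2 (Z.to_nat i) ltac:(lia)).
    rewrite Hv2 in Hw2. unfold sgn in Hw2. rewrite Z2Nat.id in Hw2 by lia.
    replace (v + i) with (v + 1 * i + 0) by lia. now replace (w + i) with (w + 1 * i + 0) by lia.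
  (* A downward run is compared from its lower end; the letter at position [i] from there is read at
     time [L - 1 - i]. *)
  - destruct (sigma_mismatch (v - L) (w - L) ltac:(lia)) as (i & Hi & Hs). apply Hs.
    specialize (Hv2 (Z.to_nat (L - 1 - i)) ltac:(lia)).
    specialize (Hw2 (Z.to_nat (L - 1 - i)) ltac:(lia)).
    rewrite Hv2 in Hw2. unfold sgn in Hw2. rewrite Z2Nat.id in Hw2 by lia.
    replace (v - L + i) with (v + -1 * (L - 1 - i) + -1) by lia.
    now replace (w - L + i) with (w + -1 * (L - 1 - i) + -1) by lia.
Qed.

Lemma edge_rung v l v' : fst l = Ld -> edge v l v' ->
  exists n, I n /\ v = sgn (snd l) * Z.of_nat (ell n) /\ v' = - v.
Proof.
  intros E [(_ & E2 & n & Hn & E3)|(E1 & _)].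
  - exists n. repeat split; auto. destruct (snd l); unfold sgn; lia.
  - exfalso. eapply sigma_not_Ld. rewrite <- E1. exact E.
Qed.

(** Two consecutive rung crossings determine the position in the ladder: the label in between gives
    the difference of the two rung lengths, unless it contains [Lc], which occurs only once. *)
Lemma two_rungs v w l1 z l2 : v <> w -> reduced linv (l1 :: z ++ [l2]) ->
  fst l1 = Ld -> fst l2 = Ld -> no_rung z ->
  readable v (l1 :: z ++ [l2]) -> readable w (l1 :: z ++ [l2]) -> False.
Proof.
  intros n R E1 E2 N [v' Hv] [w' Hw].
  destruct Hv as (v1 & Ev & Hv), Hw as (w1 & Ew & Hw).
  apply rd_app in Hv, Hw. destruct Hv as (v2 & Hv & v3 & Ev2 & _), Hw as (w2 & Hw & w3 & Ew2 & _).
  assert (Rz : reduced linv z). { apply reduced_tail in R. now apply reduced_app_l in R. }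
  destruct (line_sign z v1 Rz N) as [b Hb]; [now exists v2|].
  destruct (line_run b z v1 v2 N Hb Hv) as [Lv Sv].
  destruct (line_run b z w1 w2 N Hb Hw) as [Lw Sw].
  destruct (edge_rung _ _ _ E1 Ev) as (n1 & _ & A1 & A2).
  destruct (edge_rung _ _ _ E2 Ev2) as (n2 & _ & A3 & _).
  destruct (edge_rung _ _ _ E1 Ew) as (m1 & _ & B1 & B2).
  destruct (edge_rung _ _ _ E2 Ew2) as (m2 & _ & B3 & _).
  pose proof (ell_pos n1); pose proof (ell_pos n2).
  destruct (bool_dec (snd l1) (snd l2)) as [Es|Es].
  - (* the segment passes the vertex 0, hence the edge labelled Lc *)
    set (s := sgn (snd l1)) in *. rewrite <- Es in *. fold s in A3, B3.
    assert (Hs : s = sgn b).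
    { subst s. destruct (snd l1), b; unfold sgn in *; auto; lia. }
    clearbody s. subst s.
    set (i := if b then ell n1 else (ell n1 - 1)%nat).
    assert (Hi : (i < length z)%nat) by (subst i; destruct b; unfold sgn in *; lia).
    specialize (Sv i Hi). specialize (Sw i Hi). rewrite Sv in Sw.
    replace (v1 + sgn b * Z.of_nat i + (if b then 0 else -1)) with 0 in Sw
      by (subst i; destruct b; unfold sgn in *; lia).
    symmetry in Sw. apply sigma_Lc in Sw. apply n.
    subst i; destruct b; unfold sgn in *; lia.
  - assert (Hn : n1 <> n2).
    { intros ->. assert (length z = 0)%nat.
      { destruct (snd l1), (snd l2), b; unfold sgn in *; try congruence; lia. }
      destruct z; [|discriminate]. destruct R as [R _]. apply R.
      destruct l1 as [x1 s1], l2 as [x2 s2]; simpl in *; subst. unfold linv; simpl.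
      f_equal. destruct s1, s2; simpl; congruence. }
    apply n. enough (n1 = m1) by congruence.
    apply (ell_diff n1 n2 m1 m2); auto.
    destruct (snd l1), (snd l2), b; unfold sgn in *; try congruence; lia.
Qed.

Lemma first_rung z : no_rung z \/ exists z1 l z2, z = z1 ++ l :: z2 /\ fst l = Ld /\ no_rung z1.
Proof.
  induction z as [|l z IH]; [left; constructor|].
  destruct (classic (fst l = Ld)) as [E|E].
  - right. exists [], l, z. repeat split; auto. constructor.
  - destruct IH as [IH|(z1 & l' & z2 & -> & H1 & H2)].
    + left. now constructor.
    + right. exists (l :: z1), l', z2. repeat split; auto. now constructor.
Qed.

Lemma one_rung v w z1 l z2 : v <> w -> reduced linv (z1 ++ l :: z2) -> fst l = Ld ->
  readable v (z1 ++ l :: z2) -> readable w (z1 ++ l :: z2) -> no_rung z2.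
Proof.
  intros n R E [v' Hv] [w' Hw]. apply rd_app in Hv, Hw.
  destruct Hv as (v1 & Hv1 & Hv), Hw as (w1 & Hw1 & Hw).
  destruct (first_rung z2) as [|(z3 & l' & z4 & -> & E' & N)]; auto. exfalso.
  pose proof (rd_diff _ _ _ _ _ Hv1 Hw1).
  apply reduced_app_r in R.
  replace (l :: z3 ++ l' :: z4) with ((l :: z3 ++ [l']) ++ z4) in * by (simpl; now rewrite <- app_assoc).
  apply (two_rungs v1 w1 l z3 l'); auto; [lia| | |].
  - now apply reduced_app_l in R.
  - apply readable_app_l with z4. now exists v'.
  - apply readable_app_l with z4. now exists w'.
Qed.

(** By [one_rung] the word consists of two runs along the line joined by at most one rung. Each run
    is shorter than [4 |v - w|], and the crossing preserves the difference of the two positions. *)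
Lemma common_reading_bound v w z : v <> w -> reduced linv z -> readable v z -> readable w z ->
  Z.of_nat (length z) <= 8 * Z.abs (v - w).
Proof.
  intros n R Hv Hw. destruct (first_rung z) as [N|(z1 & l & z2 & -> & E & N)].
  - pose proof (line_bound v w z n R N Hv Hw). lia.
  - assert (N2 := one_rung v w z1 l z2 n R E Hv Hw).
    pose proof (line_bound v w z1 n (reduced_app_l _ _ _ _ R) N
      (readable_app_l _ _ _ Hv) (readable_app_l _ _ _ Hw)) as B1.
    destruct Hv as [v' Hv], Hw as [w' Hw]. apply rd_app in Hv, Hw.
    destruct Hv as (v1 & Hv1 & v2 & Ev & Hv), Hw as (w1 & Hw1 & w2 & Ew & Hw).
    pose proof (rd_diff _ _ _ _ _ Hv1 Hw1) as D1. pose proof (edge_diff _ _ _ _ _ Ev Ew) as D2.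
    apply reduced_app_r, reduced_tail in R.
    pose proof (line_bound v2 w2 z2 ltac:(lia) R N2 (ex_intro _ _ Hv) (ex_intro _ _ Hw)) as B2.
    rewrite length_app. simpl length. lia.
Qed.

(** * Periodic words read in the ladder *)

Definition wpow (f : list letter) (n : nat) : list letter := concat (repeat f n).

Lemma wpow_add f m n : wpow f (m + n) = wpow f m ++ wpow f n.
Proof. unfold wpow. now rewrite repeat_app, concat_app. Qed.

Lemma wpow_succ f n : wpow f (S n) = f ++ wpow f n.
Proof. reflexivity. Qed.

Lemma wpow_succ_r f n : wpow f (S n) = wpow f n ++ f.
Proof. replace (S n) with (n + 1)%nat by lia. rewrite wpow_add. f_equal. apply app_nil_r. Qed.

Lemma wpow_length f n : length (wpow f n) = (n * length f)%nat.
Proof. induction n; auto. rewrite wpow_succ, length_app. lia. Qed.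

(** If [f] led from [v] to [u <> v], its fifth power could be read from both. Without rungs [f] is a
    straight run, so that [|u - v| = |f|], and [line_bound] would give [5 |f| < 4 |f|]. With a rung
    in [f], the fifth power contains several, against [one_rung]. *)
Lemma reading_power f v : f <> [] -> reduced linv (wpow f 6) -> readable v (wpow f 6) -> rd v f v.
Proof.
  intros Hf R [v' H].
  rewrite wpow_succ in H. apply rd_app in H. destruct H as (u & H1 & H2).
  destruct (Z.eq_dec u v) as [->|n]; auto. exfalso.
  assert (Hv : readable v (wpow f 5)).
  { apply readable_app_l with f. rewrite <- wpow_succ_r. exists v'. rewrite wpow_succ. apply rd_app. eauto. }
  assert (Hu : readable u (wpow f 5)) by now exists v'.
  assert (R5 : reduced linv (wpow f 5)) by (rewrite wpow_succ in R; now apply reduced_app_r in R).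
  destruct (first_rung f) as [N|(z1 & l & z2 & E & El & N)].
  - assert (N5 : no_rung (wpow f 5)).
    { unfold wpow; simpl. unfold no_rung in *. rewrite !Forall_app. auto 10. }
    pose proof (line_bound u v _ n R5 N5 Hu Hv) as B.
    assert (Rf : reduced linv f) by (rewrite wpow_succ in R; now apply reduced_app_l in R).
    destruct (line_sign f v Rf N) as [b Hb]; [now exists u|].
    destruct (line_run b f v u N Hb H1) as [E _].
    rewrite wpow_length in B. destruct b; unfold sgn in E; lia.
  - assert (E5 : wpow f 5 = z1 ++ l :: (z2 ++ z1 ++ l :: (z2 ++ wpow f 3))).
    { rewrite (wpow_succ f 4), (wpow_succ f 3). generalize (wpow f 3). intro t. rewrite E.
      repeat (rewrite <- app_assoc; simpl). reflexivity. }
    rewrite E5 in *.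
    pose proof (one_rung v u z1 l _ ltac:(auto) R5 El Hv Hu) as N2.
    unfold no_rung in N2. rewrite !Forall_app in N2. destruct N2 as (_ & _ & N2).
    inversion N2; auto.
Qed.

End Ladder.

Definition below (I : nat -> Prop) (n : nat) : nat -> Prop := fun m => I m /\ m < n.

(** A short closed reading never gets far enough to see a long rung. *)
Lemma rd_below I n v w v' : rd I v w v' ->
  (Z.abs v + Z.abs v' + Z.of_nat (length w) <= 2 * Z.of_nat (ell n))%Z -> rd (below I n) v w v'.
Proof.
  revert v. induction w as [|l w IH]; auto. intros v (u & E & H) B. simpl length in B.
  pose proof (edge_abs _ _ _ _ E). exists u. split; [|apply IH; auto; lia].
  destruct E as [(E1 & E2 & m & Hm & E3)|E]; [left|now right].
  repeat split; auto. exists m. repeat split; auto.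
  pose proof (rd_abs_rev _ _ _ _ H).
  destruct (le_lt_dec n m); auto. exfalso.
  assert (ell n <= ell m)%nat.
  { destruct (Nat.eq_dec n m) as [->|]; auto. pose proof (ell_lt n m). lia. }
  destruct (snd l); lia.
Qed.

Lemma rd_mono (I J : nat -> Prop) v w v' : (forall n, I n -> J n) -> rd I v w v' -> rd J v w v'.
Proof.
  intro S. revert v. induction w as [|l w IH]; auto. intros v (u & E & H).
  exists u. split; auto. destruct E as [(E1 & E2 & m & Hm & E3)|E]; [left|now right].
  repeat split; auto. exists m; auto.
Qed.

(** * Ping-pong and axes *)

Lemma least_above (P : Z -> Prop) a : P a -> (exists b, forall m, (b <= m)%Z -> ~ P m) ->
  (forall m, P (m + 1)%Z -> P m) -> exists n, forall m, (m <= n)%Z <-> P m.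
Proof.
  intros Ha [b Hb] Hd.
  assert (Hdown : forall k m, P (m + Z.of_nat k)%Z -> P m).
  { induction k as [|k IH]; intros m H; [now rewrite Z.add_0_r in H|].
    apply IH, Hd. now replace (m + Z.of_nat k + 1)%Z with (m + Z.of_nat (S k))%Z by lia. }
  assert (Hle : forall m m', (m <= m')%Z -> P m' -> P m).
  { intros m m' L H. apply (Hdown (Z.to_nat (m' - m))).
    now replace (m + Z.of_nat (Z.to_nat (m' - m)))%Z with m' by lia. }
  assert (H : forall k, exists n, P n /\ (~ P (n + 1)%Z \/ n = a + Z.of_nat k)%Z).
  { induction k as [|k [n [Hn [H|E]]]]; eauto.
    - exists a. split; auto. right. lia.
    - destruct (classic (P (n + 1)%Z)); eauto. exists (n + 1)%Z. split; auto. right. lia. }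
  destruct (H (Z.to_nat (b - a))) as (n & Hn & [N|E]).
  - exists n. intro m. split; [intro; eapply Hle; eauto|]. intro Hm.
    destruct (Z_le_gt_dec m n); auto. exfalso. apply N. apply Hle with m; auto. lia.
  - destruct (Z_le_gt_dec a b) as [L|L].
    + exfalso. apply (Hb n); auto. lia.
    + exfalso. apply (Hb a); auto. lia.
Qed.

Section PingPong.
Variables (G : Group) (phi : G) (Ap Am : G -> Prop) (mu : G -> nat).
Hypothesis escape : forall x, ~ Am x -> Ap (phi ** x).
Hypothesis disjoint : forall x, Ap x -> Am x -> False.
Hypothesis shrink_m : forall x, Am x -> Am (phi ** x) -> mu (phi ** x) < mu x.
Hypothesis shrink_p : forall x, Ap x -> Ap (phi^- ** x) -> mu (phi^- ** x) < mu x.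

(** [n x] is the last [m] for which translating [x] back by the [m]-th power of [phi] gives a point
    of [Ap]; it exists because [mu] cannot decrease forever in [Am] or in [Ap]. At [m = n x + 1] the
    translate may lie in neither set, hence the gap of 2. *)
Lemma ping_pong : exists n : G -> Z,
  (forall x m, (m <= n x)%Z <-> Ap (zpow G phi (- m) ** x)) /\
  (forall x m, (n x + 2 <= m)%Z -> Am (zpow G phi (- m) ** x)) /\
  (forall x j, n (zpow G phi j ** x) = (n x + j)%Z).
Proof.
  assert (Hs : forall m x, zpow G phi (- m) ** x = phi ** (zpow G phi (- (m + 1)) ** x)).
  { intros m x. rewrite <- mul_assoc. f_equal. replace phi with (zpow G phi 1) at 2 by apply zpow_1.
    rewrite <- zpow_add. f_equal. lia. }
  assert (Hs' : forall m x, zpow G phi (- (m + 1)) ** x = phi^- ** (zpow G phi (- m) ** x)).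
  { intros m x. rewrite (Hs m). group. }
  assert (H : forall x, exists n, forall m, (m <= n)%Z <-> Ap (zpow G phi (- m) ** x)).
  { intro x.
    assert (Hd : forall m, Ap (zpow G phi (- (m + 1)) ** x) -> Ap (zpow G phi (- m) ** x)).
    { intros m Hm. rewrite Hs. apply escape. intro. eapply disjoint; eauto. }
    assert (H1 : exists m, Ap (zpow G phi (- m) ** x)).
    { assert (Hm : forall k m, mu (zpow G phi (- m) ** x) <= k -> exists m, Ap (zpow G phi (- m) ** x)).
      { induction k as [k IH] using lt_wf_ind. intros m Hk.
        destruct (classic (Am (zpow G phi (- m) ** x))) as [A|A];
          [|exists (m - 1)%Z; rewrite Hs; replace (m - 1 + 1)%Z with m by lia; auto].
        destruct (classic (Am (zpow G phi (- (m - 1)) ** x))) as [B|B];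
          [|exists (m - 2)%Z; rewrite Hs; replace (m - 2 + 1)%Z with (m - 1)%Z by lia; auto].
        refine (IH _ _ (m - 1)%Z (le_n _)).
        rewrite (Hs (m - 1)%Z) in *. replace (m - 1 + 1)%Z with m in * by lia.
        pose proof (shrink_m _ A B). lia. }
      eapply (Hm _ 0%Z), le_n. }
    destruct H1 as [a Ha].
    apply least_above with (a := a); auto.
    assert (H2 : exists m, ~ Ap (zpow G phi (- m) ** x)).
    { assert (Hm : forall k m, mu (zpow G phi (- m) ** x) <= k -> exists m, ~ Ap (zpow G phi (- m) ** x)).
      { induction k as [k IH] using lt_wf_ind. intros m Hk.
        destruct (classic (Ap (zpow G phi (- m) ** x))) as [A|A]; [|eauto].
        destruct (classic (Ap (zpow G phi (- (m + 1)) ** x))) as [B|B]; [|eauto].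
        refine (IH _ _ (m + 1)%Z (le_n _)). rewrite Hs' in *.
        pose proof (shrink_p _ A B). lia. }
      eapply (Hm _ 0%Z), le_n. }
    destruct H2 as [b Hb]. exists b. intros m Hm C. apply Hb.
    clear Ha Hb. revert C. replace m with (b + Z.of_nat (Z.to_nat (m - b)))%Z by lia.
    generalize (Z.to_nat (m - b)) as k. induction k as [|k IH]; [now rewrite Z.add_0_r|].
    intro C. apply IH, Hd.
    now replace (b + Z.of_nat k + 1)%Z with (b + Z.of_nat (S k))%Z by lia. }
  apply choice in H. destruct H as [n Hn]. exists n. split; [|split].
  - intros x m. apply Hn.
  - intros x m Hm. apply NNPP. intro A. apply escape in A.
    replace m with ((m - 1) + 1)%Z in A by lia. rewrite <- Hs in A. apply Hn in A. lia.
  - intros x j.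
    assert (E : forall m, (m <= n (zpow G phi j ** x) <-> m - j <= n x)%Z).
    { intro m. rewrite !Hn. rewrite <- mul_assoc, <- zpow_add.
      now replace (- m + j)%Z with (- (m - j))%Z by lia. }
    pose proof (proj1 (E (n (zpow G phi j ** x))) ltac:(lia)).
    pose proof (proj2 (E (n x + j)%Z) ltac:(lia)). lia.
Qed.

End PingPong.

Definition cyc_reduced (f : Fr) : Prop := f <> e1 /\ fhd f <> fhd (f^-).

Lemma wd_mul_full f g : fhd (f^-) <> fhd g -> wd (f ** g) = wd f ++ wd g.
Proof.
  intro H. pose proof (wd_inv_mul (f^-) g H) as E.
  rewrite inv_inv, wd_inv, winv_winv in E; auto using linvK.
Qed.

Lemma fhd_mul f g : f <> e1 -> fhd (f^-) <> fhd g -> fhd (f ** g) = fhd f.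
Proof.
  intros Hf H. unfold fhd. rewrite wd_mul_full by auto.
  destruct (wd f) eqn:E; auto. exfalso. apply Hf, wd_eq. now rewrite E.
Qed.

Lemma flen_pos f : f <> e1 -> 1 <= flen f.
Proof. intro H. destruct (flen f) eqn:E; [|lia]. now apply flen_0 in E. Qed.

Lemma cyc_reduced_pow f n : cyc_reduced f -> wd (npow Fr f n) = wpow (wd f) n.
Proof.
  intros [H1 H2].
  assert (H : forall n, wd (npow Fr f n) = wpow (wd f) n /\ fhd (f^-) <> fhd (npow Fr f n)).
  { clear n. induction n as [|n [IH1 IH2]].
    - split; auto. intro E. apply fhd_None in E. apply H1. rewrite <- (inv_inv _ f), E. apply inv_one.
    - change (npow Fr f (S n)) with (f ** npow Fr f n). split; [|rewrite fhd_mul; auto]. rewrite wd_mul_full by auto. now rewrite IH1. }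
  apply H.
Qed.

(** Ping-pong of the branches at the identity that start like [f] and like its inverse, with word
    length as measure. Once the [m]-th power of [f] is translated to the identity, the two points
    lie in these two branches. *)
Lemma axis_exists f : cyc_reduced f -> exists n : Fr -> Z,
  (forall g j, n (zpow Fr f j ** g) = (n g + j)%Z) /\
  (forall g g' m, (n g + 2 <= m <= n g')%Z -> on_path g (zpow Fr f m) g').
Proof.
  intros [Hf H].
  assert (Hf' : f^- <> e1) by (intro E; apply Hf; rewrite <- (inv_inv _ f), E; apply inv_one).
  destruct (ping_pong Fr f (fun g => fhd g = fhd f) (fun g => fhd g = fhd (f^-)) flen)
    as (n & Hp & Hm & Hj).
  - intros g Hg. cbv beta in *. apply fhd_mul; auto.
  - intros g E1 E2. congruence.
  - intros g _ E. replace g with (f^- ** (f ** g)) at 2 by group.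
    unfold flen. rewrite (wd_inv_mul f) by congruence.
    rewrite length_app, winv_length. pose proof (flen_pos f Hf). unfold flen in *. lia.
  - intros g _ E. replace g with ((f^-)^- ** (f^- ** g)) at 2 by group.
    unfold flen. rewrite (wd_inv_mul (f^-)) by congruence.
    rewrite length_app, winv_length. pose proof (flen_pos (f^-) Hf'). unfold flen in *. lia.
  - exists n. split; auto. intros g g' m Hgg'.
    apply (on_path_left (zpow Fr f (- m))). rewrite zpow_opp at 2. rewrite gmulVg.
    apply on_path_hd. rewrite (Hm g m), (proj1 (Hp g' m)) by lia. congruence.
Qed.

(** * Cosets of the ladder subgroup and their hulls *)

Section Cosets.
Variable I : nat -> Prop.
Local Open Scope Z_scope.
Local Notation rd := (rd I).

Definition ladder_group (f : Fr) : Prop := rd 0 (wd f) 0.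

Lemma rd_mul v u v' f g : rd v (wd f) u -> rd u (wd g) v' -> rd v (wd (f ** g)) v'.
Proof. apply rd_wmul. Qed.

Lemma rd_inv v v' f : rd v (wd f) v' -> rd v' (wd (f^-)) v.
Proof. apply rd_winv. Qed.

(** Cosets are predicates, so that equal cosets are equal terms: they will be the letters of reduced
    words. *)
Definition coset_space : Type :=
  {C : Fr -> Prop | exists g, C = fun h => ladder_group (g^- ** h)}.

Definition mem (C : coset_space) (h : Fr) : Prop := proj1_sig C h.

Definition coset (g : Fr) : coset_space :=
  exist _ (fun h => ladder_group (g^- ** h)) (ex_intro _ g eq_refl).

Lemma act_subproof f (C : coset_space) :
  exists g, (fun h => mem C (f^- ** h)) = fun h => ladder_group (g^- ** h).
Proof.
  destruct C as [C [g E]]. exists (f ** g). apply functional_extensionality. intro h.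
  unfold mem; simpl. rewrite E. now rewrite inv_mul, mul_assoc.
Qed.

Definition act (f : Fr) (C : coset_space) : coset_space :=
  exist _ (fun h => mem C (f^- ** h)) (act_subproof f C).

Lemma coset_ext C D : (forall h, mem C h <-> mem D h) -> C = D.
Proof.
  destruct C as [C HC], D as [D HD]; unfold mem; simpl. intro H.
  assert (C = D) as ->.
  { apply functional_extensionality. intro h. now apply propositional_extensionality. }
  f_equal. apply proof_irrelevance.
Qed.

Lemma mem_act f C h : mem (act f C) h <-> mem C (f^- ** h).
Proof. reflexivity. Qed.

Lemma mem_act_mul f C h : mem (act f C) (f ** h) <-> mem C h.
Proof. rewrite mem_act. now rewrite inv_mul_cancel. Qed.

Lemma act_mul f g C : act (f ** g) C = act f (act g C).
Proof. apply coset_ext. intro h. rewrite !mem_act. now rewrite inv_mul, mul_assoc. Qed.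

Lemma act_one C : act e1 C = C.
Proof. apply coset_ext. intro h. rewrite mem_act. now rewrite inv_one, gmul1g. Qed.

Lemma act_inv_l f C : act (f^-) (act f C) = C.
Proof. rewrite <- act_mul, gmulVg. apply act_one. Qed.

Lemma act_inj f C D : act f C = act f D -> C = D.
Proof. intro H. now rewrite <- (act_inv_l f C), H, act_inv_l. Qed.

Lemma coset_nonempty C : exists g, mem C g.
Proof.
  destruct C as [C [g E]]. exists g. unfold mem; simpl. rewrite E, gmulVg. red. simpl. reflexivity.
Qed.

Lemma mem_coset_self g : mem (coset g) g.
Proof. unfold mem; simpl. rewrite gmulVg. reflexivity. Qed.

Lemma mem_ladder C g h : mem C g -> (mem C h <-> ladder_group (g^- ** h)).
Proof.
  destruct C as [C [k E]]; unfold mem; simpl. rewrite E. intro Hg.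
  assert (E1 : k^- ** h = (k^- ** g) ** (g^- ** h)) by group.
  split; intro H.
  - replace (g^- ** h) with ((k^- ** g)^- ** (k^- ** h)) by group.
    red. eapply rd_mul; eauto. now apply rd_inv.
  - rewrite E1. red. eapply rd_mul; eauto.
Qed.

Lemma mem_coset_eq C g : mem C g -> C = coset g.
Proof.
  intro H. apply coset_ext. intro h. rewrite (mem_ladder C g h H).
  now rewrite (mem_ladder (coset g) g h (mem_coset_self g)).
Qed.

Lemma act_coset f g : act f (coset g) = coset (f ** g).
Proof. apply mem_coset_eq. apply mem_act_mul, mem_coset_self. Qed.

(** [pos C h v]: seen from the coset [C], the vertex [h] of the Cayley tree of [Fr] projects to the vertex [v] of the ladder. *)
Definition pos (C : coset_space) (h : Fr) (v : Z) : Prop :=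
  exists g, mem C g /\ rd 0 (wd (g^- ** h)) v.

Definition hull (C : coset_space) (h : Fr) : Prop := exists v, pos C h v.

Lemma mem_pos C h : mem C h <-> pos C h 0.
Proof.
  split.
  - intro H. exists h. split; auto. rewrite gmulVg. reflexivity.
  - intros (g & Hg & H). now apply (mem_ladder C g h Hg).
Qed.

Lemma mem_hull C h : mem C h -> hull C h.
Proof. intro H. exists 0. now apply mem_pos. Qed.

Lemma pos_move C h v k v' : pos C h v -> rd v (wd (h^- ** k)) v' -> pos C k v'.
Proof.
  intros (g & Hg & H) H'. exists g. split; auto.
  replace (g^- ** k) with ((g^- ** h) ** (h^- ** k)) by group. eapply rd_mul; eauto.
Qed.

Lemma pos_reading C h v k v' : pos C h v -> pos C k v' -> rd v (wd (h^- ** k)) v'.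
Proof.
  intros (g & Hg & H) (g' & Hg' & H').
  apply (mem_ladder C g g' Hg) in Hg'. red in Hg'.
  replace (h^- ** k) with ((g^- ** h)^- ** ((g^- ** g') ** (g'^- ** k))) by group.
  eapply rd_mul; [apply rd_inv; eauto|]. eapply rd_mul; eauto.
Qed.

(** Reading back from [v] to 0 leads from [h] to an element of the coset. Hence distinct cosets see
    a common point of their hulls at different ladder vertices, where [common_reading_bound]
    applies. *)
Lemma pos_inj C D h v : pos C h v -> pos D h v -> C = D.
Proof.
  intros HC HD. destruct (coset_nonempty C) as [g Hg].
  rewrite (mem_coset_eq C g Hg). symmetry. apply mem_coset_eq. apply mem_pos.
  apply (pos_move D h v); auto. apply (pos_reading C); auto. now apply mem_pos.
Qed.

Lemma pos_act f C h v : pos C h v -> pos (act f C) (f ** h) v.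
Proof.
  intros (g & Hg & H). exists (f ** g). split; [now apply mem_act_mul|].
  now replace ((f ** g)^- ** (f ** h)) with (g^- ** h) by group.
Qed.

Lemma hull_act f C h : hull C h -> hull (act f C) (f ** h).
Proof. intros [v H]. exists v. now apply pos_act. Qed.

Lemma hull_act_iff f C h : hull (act f C) (f ** h) <-> hull C h.
Proof.
  split; [|apply hull_act]. intro H. apply (hull_act (f^-)) in H.
  now rewrite act_inv_l, inv_mul_cancel in H.
Qed.

Lemma hull_convex C x z y : hull C x -> hull C y -> on_path x z y -> hull C z.
Proof.
  intros [v Hx] [w Hy] B. pose proof (pos_reading _ _ _ _ _ Hx Hy) as H.
  rewrite (on_path_wd _ _ _ B) in H. apply rd_app in H. destruct H as (u & H & _).
  exists u. now apply (pos_move C x v).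
Qed.

(** The part of a common prefix beyond chosen elements of both cosets is a common reading from two
    different vertices of the ladder. *)
Lemma coset_product_bound C D : C <> D -> exists K : nat, forall c c', mem C c -> mem D c' ->
  (flen c + flen c' <= fd c c' + K)%nat.
Proof.
  intro N. destruct (coset_nonempty C) as [c0 H0], (coset_nonempty D) as [d0 H1].
  set (m := (flen c0 + flen d0)%nat).
  (* The first [m] letters of the common prefix absorb the cancellation with [c0] and [d0]. Behind
     them both ladder positions are at most [2 m] in absolute value, so they differ by at most
     [4 m]. The factor 2 counts the prefix in [c] and in [d]. *)
  exists (2 * (m + 8 * (4 * m)))%nat. intros c d Hc Hd.
  destruct (wmul_winv_prefix _ linv linvK (wd c) (wd d) (wd_reduced c) (wd_reduced d))
    as (p & u & v & E1 & E2 & E3 & _).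
  assert (Ed : fd c d = (length u + length v)%nat).
  { unfold fd, flen. rewrite wd_mul, wd_inv, E3, length_app, winv_length. lia. }
  assert (El : (flen c + flen d = 2 * length p + length u + length v)%nat).
  { unfold flen. rewrite E1, E2, !length_app. lia. }
  enough (length p <= m + 8 * (4 * m))%nat by lia.
  destruct (le_lt_dec (length p) m) as [|L]; [lia|].
  set (p1 := firstn m p). set (p2 := skipn m p).
  assert (Ep : p = p1 ++ p2) by (symmetry; apply firstn_skipn).
  assert (L1 : length p1 = m) by (apply firstn_length_le; lia).
  assert (Rp : reduced linv p).
  { pose proof (wd_reduced c) as R. rewrite E1 in R. now apply reduced_app_l in R. }
  assert (R1 : reduced linv p1) by (rewrite Ep in Rp; now apply reduced_app_l in Rp).
  assert (R2 : reduced linv p2) by (rewrite Ep in Rp; now apply reduced_app_r in Rp).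
  set (h := of_word p1 R1).
  assert (Hp : forall (E : coset_space) e0 e t, mem E e0 -> mem E e -> wd e = p ++ t ->
    (flen e0 <= m)%nat -> exists w, pos E h w /\ readable I w p2 /\ Z.abs w <= 2 * Z.of_nat m).
  { intros E e0 e t M0 M1 Ee Le.
    apply mem_pos in M0, M1.
    pose proof (pos_reading _ _ _ _ _ M0 M1) as H.
    rewrite wd_mul, wd_inv, Ee, Ep, <- app_assoc in H.
    rewrite wmul_long in H by (rewrite winv_length; unfold flen in Le; lia).
    apply rd_app in H. destruct H as (w & Hw & H).
    assert (Hw' : rd 0 (wd (e0^- ** h)) w) by exact Hw.
    exists w. split; [now apply (pos_move E e0 0)|]. split.
    - apply readable_app_l with t. now exists 0.
    - apply rd_abs in Hw'. pose proof (flen_mul (e0^-) h). rewrite flen_inv in *.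
      unfold flen in *. simpl (wd h) in *. lia. }
  destruct (Hp C c0 c u H0 Hc E1 ltac:(lia)) as (x & Hx1 & Hx2 & Hx3).
  destruct (Hp D d0 d v H1 Hd E2 ltac:(lia)) as (y & Hy1 & Hy2 & Hy3).
  assert (Nxy : x <> y) by (intros <-; apply N; eapply pos_inj; eauto).
  pose proof (common_reading_bound I x y p2 Nxy R2 Hx2 Hy2) as B.
  rewrite Ep, length_app. lia.
Qed.

(** * Hulls of cosets along the axis of an element of the free group *)

Section Axis.
Variable f : Fr.
Hypothesis Hf : cyc_reduced f.

(** By [reading_power], a sixth power of [f] in the hull means that [f] reads a loop at the vertex
    [v]. Then [C] and its translate by [f] see the next axis point at the same [v]. *)
Lemma hull_axis_fixed C m : hull C (zpow Fr f m) -> hull C (zpow Fr f (m + 6)) -> act f C = C.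
Proof.
  intros [v Hv] [v' Hv']. pose proof (pos_reading _ _ _ _ _ Hv Hv') as H.
  rewrite zpow_add, inv_mul_cancel in H.
  change 6 with (Z.of_nat 6) in H. rewrite zpow_of_nat, cyc_reduced_pow in H by auto.
  assert (H1 : rd v (wd f) v).
  { apply reading_power.
    - intro E. apply (proj1 Hf), wd_eq. now rewrite E.
    - rewrite <- cyc_reduced_pow by auto. apply wd_reduced.
    - now exists v'. }
  apply (pos_inj _ _ (zpow Fr f (m + 1)) v).
  - replace (m + 1) with (1 + m) by lia. rewrite zpow_add, zpow_1. now apply pos_act.
  - apply (pos_move C (zpow Fr f m) v); auto. now rewrite zpow_succ, inv_mul_cancel.
Qed.

Lemma zpow_act C j : act f C = C -> act (zpow Fr f j) C = C.
Proof.
  intro E. revert j. apply Z.peano_ind.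
  - apply act_one.
  - intros j H. unfold Z.succ. now rewrite zpow_succ, act_mul, E.
  - intros j H. apply (act_inj f). rewrite <- act_mul.
    replace (f ** zpow Fr f (Z.pred j)) with (zpow Fr f j); [congruence|].
    rewrite <- (zpow_1 _ f) at 2. rewrite <- zpow_add. f_equal. lia.
Qed.

Lemma fixed_hull C m : act f C = C -> hull C (zpow Fr f m).
Proof.
  intro E. destruct (axis_exists f Hf) as (n & Hn & Hb).
  destruct (coset_nonempty C) as [c Hc].
  assert (Hj : forall j, hull C (zpow Fr f j ** c)).
  { intro j. rewrite <- (zpow_act C j E). now apply hull_act, mem_hull. }
  apply (hull_convex C (zpow Fr f (m - 2 - n c) ** c) _ (zpow Fr f (m - n c) ** c)); auto.
  apply Hb. rewrite !Hn. lia.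
Qed.

(** Both hulls would contain the whole axis, giving common readings of unbounded length. *)
Lemma fixed_coset_unique C D : act f C = C -> act f D = D -> C = D.
Proof.
  intros HC HD. apply NNPP. intro N.
  destruct (fixed_hull C 0 HC) as [v Hv], (fixed_hull D 0 HD) as [w Hw].
  assert (Nvw : v <> w) by (intros <-; apply N; eapply pos_inj; eauto).
  set (k := S (Z.to_nat (8 * Z.abs (v - w)))).
  destruct (fixed_hull C (Z.of_nat k) HC) as [v' Hv'], (fixed_hull D (Z.of_nat k) HD) as [w' Hw'].
  pose proof (pos_reading _ _ _ _ _ Hv Hv') as R1. pose proof (pos_reading _ _ _ _ _ Hw Hw') as R2.
  simpl (zpow Fr f 0) in R1, R2. rewrite inv_one, gmul1g, zpow_of_nat in R1, R2.
  pose proof (common_reading_bound I v w (wd (npow Fr f k)) Nvw (wd_reduced _)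
    (ex_intro _ _ R1) (ex_intro _ _ R2)) as B.
  rewrite cyc_reduced_pow, wpow_length in B by auto.
  pose proof (flen_pos f (proj1 Hf)). unfold flen in *. nia.
Qed.

Lemma axis_variation n C h h' :
  (forall g g' m, n g + 2 <= m <= n g' -> on_path g (zpow Fr f m) g') ->
  act f C <> C -> hull C h -> hull C h' -> Z.abs (n h - n h') <= 8.
Proof.
  intros Hb N.
  assert (H : forall h h', hull C h -> hull C h' -> n h' - n h <= 8).
  (* 8 is the 6 of [hull_axis_fixed] plus the gap 2 of [ping_pong]. *)
  { clear h h'. intros h h' Hh Hh'. destruct (Z_le_gt_dec (n h' - n h) 8) as [|L]; auto. exfalso.
    apply N. apply (hull_axis_fixed C (n h + 2)); apply (hull_convex C h _ h'); auto; apply Hb; lia. }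
  intros H1 H2. pose proof (H h h' H1 H2). pose proof (H h' h H2 H1). lia.
Qed.

End Axis.
End Cosets.

(** * Word metrics *)

Section WordMetric.
Variable G : Group.
Variable S : list G.
Hypothesis HS : generates S.

Lemma walk_app x w1 w2 : walk G x (w1 ++ w2) = walk G (walk G x w1) w2.
Proof. apply fold_left_app. Qed.

Lemma step_left g x p : step G (g ** x) p = g ** step G x p.
Proof. destruct p as [s []]; unfold step; simpl; group. Qed.

Lemma walk_left g x w : walk G (g ** x) w = g ** walk G x w.
Proof.
  revert x. induction w as [|p w IH]; intro x; auto.
  change (walk G (step G (g ** x) p) w = g ** walk G (step G x p) w).
  now rewrite step_left, IH.
Qed.

Definition wdist (x y : G) : nat := least (dist_le S x y).

Lemma dist_le_left g x y n : dist_le S x y n -> dist_le S (g ** x) (g ** y) n.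
Proof.
  intros (w & H1 & H2 & <-). exists w. repeat split; auto. apply walk_left.
Qed.

Lemma dist_le_ex x y : exists n, dist_le S x y n.
Proof.
  destruct (HS (x^- ** y)) as (w & H1 & H2). exists (length w). exists w. repeat split; auto.
  rewrite <- (gmulg1 G x), walk_left, H2. group.
Qed.

Lemma dist_le_mono x y n m : dist_le S x y n -> n <= m -> dist_le S x y m.
Proof. intros (w & H1 & H2 & H3) L. exists w. repeat split; auto. lia. Qed.

Lemma wdist_le x y n : dist_le S x y n <-> wdist x y <= n.
Proof.
  destruct (least_spec _ (dist_le_ex x y)) as [H1 H2]. split; [apply H2|].
  intro L. eapply dist_le_mono; eauto.
Qed.

Lemma dist_wdist x y n : dist S x y n <-> n = wdist x y.
Proof.
  split.
  - intros [H1 H2]. apply wdist_le in H1.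
    pose proof (H2 _ (proj2 (wdist_le x y _) (le_n _))). lia.
  - intros ->. split; [now apply wdist_le|]. intros m Hm. now apply wdist_le.
Qed.

Lemma wdist_left g x y : wdist (g ** x) (g ** y) = wdist x y.
Proof.
  assert (H : forall g x y, wdist (g ** x) (g ** y) <= wdist x y).
  { intros. apply wdist_le, dist_le_left. now apply wdist_le. }
  apply Nat.le_antisymm; auto.
  pose proof (H (g^-) (g ** x) (g ** y)) as L. autorewrite with grp in L. exact L.
Qed.

Lemma wdist_refl x : wdist x x = 0.
Proof. apply Nat.le_0_r, wdist_le. exists []. simpl. auto. Qed.

Lemma wdist_tri x y z : wdist x z <= wdist x y + wdist y z.
Proof.
  destruct (proj2 (wdist_le x y _) (le_n _)) as (w1 & A1 & A2 & A3).
  destruct (proj2 (wdist_le y z _) (le_n _)) as (w2 & B1 & B2 & B3).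
  apply wdist_le. exists (w1 ++ w2). rewrite Forall_app, length_app, walk_app, A3.
  repeat split; auto. lia.
Qed.

Lemma step_back x p : step G (step G x p) (fst p, negb (snd p)) = x.
Proof. destruct p as [s []]; unfold step; simpl; group. Qed.

Lemma wdist_sym x y : wdist x y = wdist y x.
Proof.
  assert (H : forall x y, wdist y x <= wdist x y); [|apply Nat.le_antisymm; auto].
  clear x y. intros x y. apply wdist_le.
  destruct (proj2 (wdist_le x y _) (le_n _)) as (w & A1 & A2 & A3).
  exists (rev (map (fun p => (fst p, negb (snd p))) w)).
  rewrite length_rev, length_map. split; [|split; auto].
  - apply Forall_rev, Forall_map. eapply Forall_impl; [|exact A1]. auto.
  - clear A1 A2. revert x y A3. induction w as [|p w IH]; intros x y A3; simpl in *; auto.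
    rewrite walk_app, (IH (step G x p) y A3). apply step_back.
Qed.

Lemma wdist_zero x y : wdist x y = 0 -> x = y.
Proof.
  intro H. assert (L : wdist x y <= 0) by lia. apply wdist_le in L.
  destruct L as (w & _ & L & E). destruct w; [exact E|simpl in L; lia].
Qed.

Lemma ball_finite n : exists L : list G, forall x, wdist e1 x <= n -> In x L.
Proof.
  induction n as [|n [L HL]].
  - exists [e1]. intros x H. left. apply wdist_zero. lia.
  - exists (e1 :: flat_map (fun s => flat_map (fun y => [s ** y; s^- ** y]) L) S).
    intros x H. apply wdist_le in H. destruct H as (w & A1 & A2 & A3).
    destruct w as [|p w]; [now left|right]. inversion A1 as [|? ? B1 B2]; subst.
    apply in_flat_map. exists (fst p). split; auto.
    apply in_flat_map. exists (walk G e1 w). split.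
    + apply HL, wdist_le. exists w. simpl in A2. repeat split; auto. lia.
    + destruct p as [s b]. simpl.
      replace (step G e1 (s, b)) with ((if b then s else s^-) ** e1)
        by (unfold step; destruct b; simpl; group).
      rewrite walk_left. destruct b; auto.
Qed.

End WordMetric.

Lemma NoDup_map_on (A B : Type) (f : A -> B) (l : list A) :
  (forall x y, In x l -> In y l -> f x = f y -> x = y) -> NoDup l -> NoDup (map f l).
Proof.
  intros Hf N. induction N as [|a l Ha N IH]; constructor.
  - intro H. apply in_map_iff in H. destruct H as (b & E & Hb).
    rewrite (Hf b a) in Hb; simpl; auto.
  - apply IH. intros; apply Hf; simpl; auto.
Qed.

Lemma pigeonhole (A : Type) (f : nat -> A) (L : list A) (m : nat) :
  (forall t, t < m -> In (f t) L) -> length L < m -> exists t t', t < t' < m /\ f t = f t'.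
Proof.
  intros H Hm. apply NNPP. intro N.
  assert (ND : NoDup (map f (seq 0 m))).
  { apply NoDup_map_on; [|apply seq_NoDup]. intros x y Hx Hy E. apply in_seq in Hx, Hy.
    destruct (lt_eq_lt_dec x y) as [[K|K]|K]; auto; exfalso; apply N; [exists x, y|exists y, x]; split; auto; lia. }
  apply NoDup_incl_length with (l' := L) in ND.
  - rewrite length_map, length_seq in ND. lia.
  - intros a Ha. apply in_map_iff in Ha. destruct Ha as (t & <- & Ht). apply in_seq in Ht. apply H. lia.
Qed.

Lemma discrete_ivt (phi : nat -> Z) (N : nat) (y J : Z) :
  (forall k, phi (S k) <= phi k + J)%Z -> (phi 0%nat < y + J)%Z -> (y <= phi N)%Z ->
  exists k, k <= N /\ (y <= phi k < y + J)%Z.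
Proof.
  intros HJ H0. induction N as [|N IH]; intro HN; [exists 0; lia|].
  destruct (Z_le_gt_dec y (phi N)) as [L|L].
  - destruct (IH L) as (k & Hk & B). exists k. lia.
  - exists (S N). specialize (HJ N). lia.
Qed.

(** * Chains and the four-point condition *)

Inductive chain {A : Type} (adj : A -> A -> Prop) (P : A -> Prop) : A -> A -> Prop :=
| chain_nil x : P x -> chain adj P x x
| chain_cons x z y : P x -> adj x z -> chain adj P z y -> chain adj P x y.

Section Chains.
Variable A : Type.
Variable adj : A -> A -> Prop.

Lemma chain_app (P : A -> Prop) x y z : chain adj P x y -> chain adj P y z -> chain adj P x z.
Proof. intro H. induction H; auto. intro. econstructor; eauto. Qed.

Lemma chain_mono (B : Type) (adj' : B -> B -> Prop) (f : A -> B) (P : A -> Prop) (Q : B -> Prop) x y :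
  (forall u, P u -> Q (f u)) -> (forall u v, adj u v -> adj' (f u) (f v)) ->
  chain adj P x y -> chain adj' Q (f x) (f y).
Proof. intros HP Ha H. induction H; [constructor|econstructor]; eauto. Qed.

Lemma chain_switch (P B C : A -> Prop) x y : chain adj P x y -> B x -> C y ->
  (forall u, P u -> B u \/ C u) ->
  exists u v, P u /\ P v /\ B u /\ C v /\ (u = v \/ adj u v).
Proof.
  intros H. induction H as [x Hx|x z y Hx Ha H IH]; intros HB HC HP.
  - exists x, x. auto 8.
  - assert (Hz : P z) by (inversion H; auto).
    destruct (HP z Hz) as [Bz|Cz]; [auto|].
    exists x, z. auto 8.
Qed.

End Chains.

Section FourPoint.
Variable X : Type.
Variable d : X -> X -> nat.
Hypothesis d_sym : forall x y, d x y = d y x.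
Hypothesis d_tri : forall x y z, d x z <= d x y + d y z.
Variable D : nat.

(** Each point of the chain lies near one fixed geodesic from [x] to [y] and near one side of any
    triangle over it. *)
Hypothesis bottleneck : forall x y, exists geo : nat -> X,
  geo 0 = x /\ geo (d x y) = y /\ (forall i j, i <= j <= d x y -> d (geo i) (geo j) = j - i) /\
  chain (fun p q => d p q <= 1)
    (fun p => (exists i, i <= d x y /\ d (geo i) p <= D) /\
       forall z, d x p + d p z <= d x z + 2 * D \/ d z p + d p y <= d z y + 2 * D) x y.

(** Along the chain from [x] to [y], nearness to the side [x z] gives way to nearness to [z y]; at
    the switch there is a coarse centre [p] of the triangle, close to the geodesic. With [q] for [w]
    likewise, the order of [p] and [q] along the geodesic decides between the alternatives. *)
Lemma four_point x y z w :
  d x y + d z w <= d y w + d x z + 2 * (4 * D + 2) \/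
  d x y + d z w <= d x w + d y z + 2 * (4 * D + 2).
Proof.
  destruct (bottleneck x y) as (geo & G0 & G1 & HG & HC).
  assert (Hc : forall z, exists p i, i <= d x y /\ d (geo i) p <= D /\
     d x p + d p z <= d x z + 2 * D /\ d z p + d p y <= d z y + 2 * D + 2).
  { clear z w. intro z.
    destruct (chain_switch _ _ _ (fun p => d x p + d p z <= d x z + 2 * D)
      (fun p => d z p + d p y <= d z y + 2 * D) x y HC) as (p & q & Hp & _ & Bp & Cq & E).
    - assert (d x x = 0); [|lia].
      pose proof (HG 0 0 ltac:(lia)) as H. now rewrite G0 in H.
    - assert (d y y = 0); [|lia].
      pose proof (HG (d x y) (d x y) ltac:(lia)) as H. rewrite G1 in H. lia.
    - intros u Hu. apply Hu.
    - destruct Hp as [(i & Hi & Hpi) _]. exists p, i. repeat split; auto.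
      destruct E as [->|E]; [lia|].
      pose proof (d_tri z q p). pose proof (d_tri p q y). rewrite (d_sym q p) in *. lia. }
  destruct (Hc z) as (p & i & Hi & Hpi & P1 & P2).
  destruct (Hc w) as (q & j & Hj & Hqj & Q1 & Q2).
  pose proof (d_tri z p w). pose proof (d_tri p q w).
  pose proof (d_tri p (geo i) q). pose proof (d_tri (geo i) (geo j) q).
  pose proof (HG 0 i ltac:(lia)) as X1. pose proof (HG 0 j ltac:(lia)) as X2.
  pose proof (HG i (d x y) ltac:(lia)) as Y1. pose proof (HG j (d x y) ltac:(lia)) as Y2.
  rewrite G0 in *. rewrite G1 in *.
  pose proof (d_tri x p (geo i)). pose proof (d_tri x q (geo j)).
  pose proof (d_tri (geo i) p y). pose proof (d_tri (geo j) q y).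
  rewrite (d_sym p (geo i)), (d_sym q (geo j)), (d_sym z p), (d_sym w q), (d_sym z y), (d_sym w y) in *.
  destruct (le_lt_dec i j) as [L|L].
  - right. pose proof (HG i j ltac:(lia)). lia.
  - left. pose proof (HG j i ltac:(lia)) as E. rewrite d_sym in E. lia.
Qed.

End FourPoint.

(** * Contracting axes *)

Section Axes.
Variable G : Group.
Variable S : list G.
Hypothesis HS : generates S.
Variable g : G.
Variable n : G -> Z.
Variables R J : Z.
Variable T : G -> Prop.
Local Open Scope Z_scope.
Local Notation pw := (zpow G g).

Definition dz (x y : G) : Z := Z.of_nat (wdist G S x y).

(** [n] is a coarse projection to the axis, measured in powers of [g]. The bound on its change is
    required for all of [T], which may be infinite and is to be the relative generating set in the
    hyperbolic embedding. *)
Hypothesis n_pow : forall x j, Z.abs (n (pw j ** x) - n x - j) <= R.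
Hypothesis n_path : forall x x' m, n x + R <= m <= n x' - R ->
  dz x (pw m) + dz (pw m) x' <= dz x x' + R.
Hypothesis n_step : forall x t, T t -> Z.abs (n (x ** t) - n x) <= J.
Hypothesis T_gens : forall s, In s S -> T s.
Hypothesis T_inv : forall t, T t -> T (t^-).

Lemma dz_nonneg x y : 0 <= dz x y.
Proof. unfold dz. lia. Qed.
Lemma dz_refl x : dz x x = 0.
Proof. unfold dz. now rewrite wdist_refl. Qed.
Lemma dz_sym x y : dz x y = dz y x.
Proof. unfold dz. now rewrite wdist_sym. Qed.
Lemma dz_tri x y z : dz x z <= dz x y + dz y z.
Proof. unfold dz. pose proof (wdist_tri G S HS x y z). lia. Qed.
Lemma dz_left h x y : dz (h ** x) (h ** y) = dz x y.
Proof. unfold dz. now rewrite wdist_left. Qed.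

Lemma R_nonneg : 0 <= R.
Proof. pose proof (n_pow e1 0). lia. Qed.

Let L := Z.abs J.

Lemma n_walk x w : Forall (fun p => In (fst p) S) w ->
  Z.abs (n (walk G x w) - n x) <= L * Z.of_nat (length w).
Proof.
  revert x. induction w as [|p w IH]; intros x H; [simpl; lia|].
  inversion H as [|? ? Hp Hw]; subst. specialize (IH (step G x p) Hw).
  assert (Z.abs (n (step G x p) - n x) <= L).
  { destruct p as [s b]. unfold step; simpl in *. destruct b.
    - pose proof (n_step x s (T_gens s Hp)). lia.
    - pose proof (n_step x _ (T_inv _ (T_gens s Hp))). lia. }
  change (walk G x (p :: w)) with (walk G (step G x p) w). simpl length. nia.
Qed.

Lemma n_lip x y : Z.abs (n x - n y) <= L * dz x y.
Proof.
  destruct (proj2 (wdist_le G S HS x y _) (le_n _)) as (w & A1 & A2 & <-).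
  pose proof (n_walk x w A1). unfold dz in *. nia.
Qed.

Let n1 := Z.abs (n e1).
Let Delta := dz e1 g.

Lemma n_axis j : Z.abs (n (pw j) - j) <= n1 + R.
Proof. pose proof (n_pow e1 j) as H. rewrite gmulg1 in H. lia. Qed.

Lemma axis_infinite j : pw j = e1 -> j = 0.
Proof.
  intro H.
  assert (Hk : forall k, pw (j * k) = e1).
  { intro k. rewrite zpow_mul, H. apply zpow_subgroup with (K := fun x => x = e1); auto.
    repeat split; intros; subst; group. }
  (* The exponent [j (R + 1)] makes a non-zero shift exceed the error [R]. *)
  pose proof (n_pow e1 (j * (R + 1))) as E. rewrite Hk, gmulg1 in E.
  pose proof R_nonneg. nia.
Qed.

Lemma axis_step i j : dz (pw i) (pw j) <= Delta * Z.abs (i - j).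
Proof.
  assert (H : forall k, dz e1 (pw (Z.of_nat k)) <= Delta * Z.of_nat k).
  { induction k as [|k IH]; [simpl; rewrite dz_refl; lia|].
    replace (Z.of_nat (Datatypes.S k)) with (Z.of_nat k + 1) by lia. rewrite zpow_succ.
    pose proof (dz_tri e1 (pw (Z.of_nat k)) (pw (Z.of_nat k) ** g)) as E.
    replace (dz (pw (Z.of_nat k)) (pw (Z.of_nat k) ** g)) with Delta in E
      by (unfold Delta; rewrite <- (dz_left (pw (Z.of_nat k)) e1 g), gmulg1; reflexivity).
    lia. }
  assert (H' : forall i j, i <= j -> dz (pw i) (pw j) <= Delta * (j - i)).
  { clear i j. intros i j Lij. specialize (H (Z.to_nat (j - i))). rewrite Z2Nat.id in H by lia.
    rewrite <- (dz_left (pw i)) in H. rewrite gmulg1, <- zpow_add in H.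
    now replace (i + (j - i)) with j in H by lia. }
  destruct (Z_le_gt_dec i j).
  - rewrite Z.abs_neq by lia. replace (- (i - j)) with (j - i) by lia. auto.
  - rewrite Z.abs_eq, dz_sym by lia. apply H'. lia.
Qed.

(** If [j] were far from [n x], the way from [x] to [pw j] would pass an axis point of index near
    [n x]. As [pw j] is nearest to [x], it would be within [R] of that point, and [n] is
    Lipschitz. *)
Lemma nearest_index x j : (forall m, dz x (pw j) <= dz x (pw m)) ->
  Z.abs (j - n x) <= 3 * R + n1 + n1 + L * R.
Proof.
  intro H. pose proof R_nonneg. pose proof (n_axis j).
  assert (Hm : forall m, dz (pw m) (pw j) <= R -> Z.abs (m - j) <= L * R + 2 * n1 + 2 * R).
  { intros m Hm. pose proof (n_lip (pw m) (pw j)). pose proof (n_axis m).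
    assert (L * dz (pw m) (pw j) <= L * R) by (apply Z.mul_le_mono_nonneg_l; lia). lia. }
  assert (0 <= L * R) by (apply Z.mul_nonneg_nonneg; lia).
  destruct (Z_le_gt_dec (n x + 3 * R + n1) j) as [A|A].
  - pose proof (n_path x (pw j) (n x + R) ltac:(lia)) as P.
    specialize (H (n x + R)). specialize (Hm (n x + R)). lia.
  - destruct (Z_le_gt_dec j (n x - 3 * R - n1)) as [B|B]; [|lia].
    pose proof (n_path (pw j) x (n x - R) ltac:(lia)) as P.
    rewrite (dz_sym (pw j) x), (dz_sym (pw (n x - R)) x) in P.
    specialize (H (n x - R)). specialize (Hm (n x - R)). rewrite dz_sym in Hm. lia.
Qed.

(** If the indices were far apart, the way from [x] to [x'] would pass an axis point of index near
    [n x]. That point is at least as far from [x] as [x'] is, so [x'] would be within [R] of it. *)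
Lemma ball_index x x' : (forall m, dz x x' <= dz x (pw m)) ->
  Z.abs (n x - n x') <= n1 + 3 * R + L * R.
Proof.
  intro H. pose proof R_nonneg.
  assert (Hm : forall m, dz (pw m) x' <= R -> Z.abs (m - n x') <= L * R + n1 + R).
  { intros m Hm. pose proof (n_lip (pw m) x'). pose proof (n_axis m).
    assert (L * dz (pw m) x' <= L * R) by (apply Z.mul_le_mono_nonneg_l; lia). lia. }
  assert (0 <= L * R) by (apply Z.mul_nonneg_nonneg; lia).
  destruct (Z_le_gt_dec (n x + 2 * R) (n x')) as [A|A].
  - pose proof (n_path x x' (n x + R) ltac:(lia)) as P.
    specialize (H (n x + R)). specialize (Hm (n x + R)). lia.
  - destruct (Z_le_gt_dec (n x' + 2 * R) (n x)) as [B|B]; [|lia].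
    pose proof (n_path x' x (n x - R) ltac:(lia)) as P.
    rewrite (dz_sym x' x), (dz_sym (pw (n x - R)) x), dz_sym in P.
    specialize (H (n x - R)). specialize (Hm (n x - R)). lia.
Qed.

Lemma proj_index x a : proj G S (cyclic_sub g) x a ->
  exists j, a = pw j /\ forall m, dz x (pw j) <= dz x (pw m).
Proof.
  intros [[j ->] (N & [_ HN] & HD)]. exists j. split; auto. intro m.
  apply (dist_wdist G S HS) in HD. unfold dz. rewrite <- HD.
  apply inj_le. apply (HN (pw m)); [now exists m|]. now apply (dist_wdist G S HS).
Qed.

Theorem axis_contracting : strongly_contracting S (cyclic_sub g).
Proof.
  (* The sum of the bounds of [nearest_index] and [ball_index], the latter to pass from [x'] to
     [x]. *)
  set (M := 6 * R + 3 * n1 + 2 * (L * R)).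
  exists (Z.to_nat (Delta * (2 * M))). intros x x' N [_ HN] Hx' a b Ha Hb.
  pose proof R_nonneg.
  assert (0 <= L * R) by (apply Z.mul_nonneg_nonneg; lia).
  assert (HX : Z.abs (n x - n x') <= n1 + 3 * R + L * R).
  { apply ball_index. intro m. apply (wdist_le G S HS) in Hx'.
    assert (N <= wdist G S x (pw m))%nat; [|unfold dz; lia].
    apply (HN (pw m)); [now exists m|]. now apply (dist_wdist G S HS). }
  assert (HI : forall c, proj G S (cyclic_sub g) x c \/ proj G S (cyclic_sub g) x' c ->
    exists j, c = pw j /\ Z.abs (j - n x) <= M).
  { intros c [Hc|Hc]; destruct (proj_index _ _ Hc) as (j & -> & Hj);
      apply nearest_index in Hj; exists j; split; auto; lia. }
  destruct (HI a Ha) as (i & -> & Hi), (HI b Hb) as (j & -> & Hj).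
  apply (wdist_le G S HS). pose proof (axis_step i j) as B. pose proof (dz_nonneg e1 g) as D.
  fold Delta in D. assert (Delta * Z.abs (i - j) <= Delta * (2 * M))
    by (apply Z.mul_le_mono_nonneg_l; lia).
  unfold dz in B. lia.
Qed.

(** ** The commensurator of the axis *)

(** The clearance [R] asked for by [n_path], plus the error [n1 + R] of [n_axis]. *)
Let Rb := 2 * R + n1.
Let R3 := R + 2 * (Delta * Rb).

Lemma Delta_nonneg : 0 <= Delta.
Proof. apply dz_nonneg. Qed.

Lemma axis_line i j k : i <= j <= k ->
  dz (pw i) (pw j) + dz (pw j) (pw k) <= dz (pw i) (pw k) + R3.
Proof.
  intro H. pose proof R_nonneg. pose proof Delta_nonneg.
  assert (0 <= Delta * Rb) by (apply Z.mul_nonneg_nonneg; lia).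
  assert (Hs : forall i j, Z.abs (i - j) <= Rb -> dz (pw i) (pw j) <= Delta * Rb).
  { intros a b Hab. pose proof (axis_step a b).
    assert (Delta * Z.abs (a - b) <= Delta * Rb) by (apply Z.mul_le_mono_nonneg_l; lia). lia. }
  pose proof (n_axis i). pose proof (n_axis k).
  destruct (Z_le_gt_dec (j - i) Rb) as [A|A].
  - pose proof (Hs i j ltac:(lia)). pose proof (dz_tri (pw j) (pw i) (pw k)).
    rewrite (dz_sym (pw j) (pw i)) in *. lia.
  - destruct (Z_le_gt_dec (k - j) Rb) as [B|B].
    + pose proof (Hs j k ltac:(lia)). pose proof (dz_tri (pw i) (pw k) (pw j)).
      rewrite (dz_sym (pw k) (pw j)) in *. lia.
    + pose proof (n_path (pw i) (pw k) j ltac:(lia)). lia.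
Qed.

Lemma axis_line' i j k : i <= j <= k \/ k <= j <= i ->
  dz (pw i) (pw j) + dz (pw j) (pw k) <= dz (pw i) (pw k) + R3.
Proof.
  intros [H|H]; [now apply axis_line|].
  rewrite (dz_sym (pw i) (pw j)), (dz_sym (pw j) (pw k)), (dz_sym (pw i) (pw k)).
  pose proof (axis_line k j i H). lia.
Qed.

Let R4 := R3 + 4 * (Delta * R) + 2 * R.

Lemma R4_nonneg : 0 <= R4.
Proof.
  pose proof R_nonneg. pose proof Delta_nonneg.
  assert (0 <= Delta * Rb) by (apply Z.mul_nonneg_nonneg; lia).
  assert (0 <= Delta * R) by (apply Z.mul_nonneg_nonneg; lia). lia.
Qed.

(** A point between [u] and [v] and of intermediate index is close to the axis: both halves of the
    path may be rerouted through the axis. *)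
Lemma fellow_travel u w v : n u + 2 * R <= n w <= n v - 2 * R ->
  dz u w + dz w v <= dz u v + R3 -> dz w (pw (n w)) <= R4.
Proof.
  intros H C. pose proof R_nonneg. pose proof Delta_nonneg.
  pose proof (n_path u w (n w - R) ltac:(lia)). pose proof (n_path w v (n w + R) ltac:(lia)).
  pose proof (axis_step (n w - R) (n w)) as A1. pose proof (axis_step (n w) (n w + R)) as A2.
  replace (Z.abs (n w - R - n w)) with R in A1 by lia.
  replace (Z.abs (n w - (n w + R))) with R in A2 by lia.
  set (c := pw (n w)) in *. set (p := pw (n w - R)) in *. set (q := pw (n w + R)) in *.
  assert (0 <= Delta * R) by (apply Z.mul_nonneg_nonneg; lia).
  pose proof (dz_tri u p c). pose proof (dz_tri c p w). pose proof (dz_tri w q c).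
  pose proof (dz_tri c q v). pose proof (dz_tri u c v).
  rewrite (dz_sym c w), (dz_sym c p), (dz_sym q c) in *. pose proof (dz_nonneg w c). lia.
Qed.

Definition commensurator (x : G) : Prop :=
  exists a b, a <> 0 /\ b <> 0 /\ x ** pw a ** x^- = pw b.

Lemma commensurator_pow a b x k : x ** pw a ** x^- = pw b -> x ** pw (a * k) ** x^- = pw (b * k).
Proof. intro H. rewrite !zpow_mul, <- zpow_conj. now rewrite H. Qed.

Lemma commensurator_subgroup : subgroup G commensurator.
Proof.
  split; [|split].
  - exists 1, 1. repeat split; try lia. group.
  - intros x y (a & b & Ha & Hb & E) (a' & b' & Ha' & Hb' & E').
    exists (a' * a), (b * b'). repeat split; try nia.
    replace (x ** y ** pw (a' * a) ** (x ** y)^-) with (x ** (y ** pw (a' * a) ** y^-) ** x^-) by group.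
    rewrite (commensurator_pow _ _ _ a E'). rewrite (Z.mul_comm b' a).
    now apply commensurator_pow.
  - intros x (a & b & Ha & Hb & E). exists b, a. repeat split; auto. rewrite <- E. group.
Qed.

Lemma commensurator_axis j : commensurator (pw j).
Proof.
  apply zpow_subgroup; [apply commensurator_subgroup|].
  exists 1, 1. repeat split; try lia. rewrite zpow_1. group.
Qed.

(** Since [x] intertwines powers of [g], the translate of the axis by [x] contains points of index
    well below and well above [n x]; [x] lies between them on this translate, so [fellow_travel]
    applies. *)
Lemma commensurator_near x : commensurator x -> dz x (pw (n x)) <= R4.
Proof.
  assert (H : forall a b, a <> 0 -> 0 < b -> x ** pw a ** x^- = pw b -> dz x (pw (n x)) <= R4).
  { intros a b Ha Hb E. pose proof R_nonneg.
    assert (Ex : forall k, x ** pw (a * k) = pw (b * k) ** x).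
    { intro k. rewrite <- (commensurator_pow a b x k E). group. }
    assert (Hn : forall k, Z.abs (n (x ** pw (a * k)) - n x - b * k) <= R).
    { intro k. rewrite Ex. apply n_pow. }
    (* [3 R] is the clearance [2 R] of [fellow_travel] plus the error [R] of [n_pow]. *)
    pose proof (Hn (3 * R)) as H1. pose proof (Hn (- (3 * R))) as H2.
    assert (3 * R <= b * (3 * R)) by nia.
    apply (fellow_travel (x ** pw (a * - (3 * R))) x (x ** pw (a * (3 * R)))); [lia|].
    rewrite <- (gmulg1 G x) at 2 3. rewrite !dz_left.
    change e1 with (pw 0). apply axis_line'. nia. }
  intros (a & b & Ha & Hb & E). destruct (Z_lt_le_dec 0 b) as [Lb|Lb]; [now apply (H a b)|].
  apply (H (a * -1) (b * -1)); try lia. now apply commensurator_pow.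
Qed.

Lemma ball_finite_z r : exists B : list G, forall x, dz e1 x <= r -> In x B.
Proof.
  destruct (ball_finite G S HS (Z.to_nat r)) as [B HB]. exists B. intros x H.
  apply HB. unfold dz in H. lia.
Qed.

Lemma commensurator_decomp x : commensurator x -> dz e1 (pw (- n x) ** x) <= R4.
Proof.
  intro H. apply commensurator_near in H. rewrite dz_sym in H.
  rewrite <- (dz_left (pw (- n x))) in H. now rewrite zpow_opp, gmulVg in H; rewrite zpow_opp.
Qed.

Lemma commensurator_virtually_cyclic : virtually_cyclic G commensurator.
Proof.
  split; [apply commensurator_subgroup|].
  destruct (ball_finite_z R4) as [B HB].
  exists g, (filter (fun r => if decide (commensurator r) then true else false) (map (ginv G) B)).
  split; [|split].
  - rewrite <- zpow_1. apply commensurator_axis.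
  - intros r Hr. apply filter_In in Hr. destruct Hr as [_ Hr].
    now destruct (decide (commensurator r)).
  - intros h Hh. destruct commensurator_subgroup as (_ & CM & CI).
    (* [commensurator_decomp] strips a power on the left, while representatives need it on the
       right; hence it is applied to the inverse of [h]. *)
    set (k := n (h^-)). exists (h ** pw k), (- k).
    split; [|rewrite mul_assoc, <- zpow_add; replace (k + - k) with 0 by lia; group].
    apply filter_In. split.
    + apply in_map_iff. exists (pw (- k) ** h^-). split; [rewrite zpow_opp; group|].
      apply HB. now apply commensurator_decomp, CI.
    + destruct (decide (commensurator (h ** pw k))) as [|N]; auto.
      exfalso. apply N, CM; auto. apply commensurator_axis.
Qed.

Lemma virtually_cyclic_pigeonhole (K : G -> Prop) : virtually_cyclic G K ->
  exists z, K z /\ forall h : nat -> G, (forall i, K (h i)) ->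
    exists i j q, (i < j)%nat /\ (h i)^- ** h j = zpow G z q.
Proof.
  intros (HK & z & reps & Hz & _ & Hr). exists z. split; auto. intros h Hh.
  assert (H : forall i, exists r, In r reps /\ exists k, h i = r ** zpow G z k).
  { intro i. destruct (Hr (h i) (Hh i)) as (r & k & Hrr & E). eauto. }
  apply choice in H. destruct H as [f Hf].
  destruct (pigeonhole G f reps (Datatypes.S (length reps))) as (i & j & Hij & E).
  - intros t _. apply Hf.
  - lia.
  - destruct (Hf i) as (_ & a & Ea), (Hf j) as (_ & b & Eb).
    exists i, j, (- a + b). split; [lia|].
    rewrite Ea, Eb, E, zpow_add, zpow_opp. group.
Qed.

(** By the pigeonhole principle [g^p = z^q], and conjugation by [x] takes [z^p'] to [z^q'].
    Combining the two, it takes [g^(p p')] to [g^(p q')]. *)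
Lemma virtually_cyclic_commensurator K x : virtually_cyclic G K -> K g -> K x -> commensurator x.
Proof.
  intros HK Hg Hx. pose proof (proj1 HK) as SK.
  destruct (virtually_cyclic_pigeonhole K HK) as (z & Hz & HP).
  destruct (HP (fun i => pw (Z.of_nat i))) as (i & j & q & Hij & E1).
  { intro i. now apply zpow_subgroup. }
  destruct (HP (fun i => x ** zpow G z (Z.of_nat i) ** x^-)) as (i' & j' & q' & Hij' & E2).
  { intro k. destruct SK as (_ & KM & KV). apply KM; auto. apply KM; auto.
    apply zpow_subgroup; auto. repeat split; auto. apply HK. }
  set (p := Z.of_nat j - Z.of_nat i). set (p' := Z.of_nat j' - Z.of_nat i').
  assert (F1 : pw p = zpow G z q).
  { rewrite <- E1. unfold p. rewrite zpow_sub, zpow_inv_comm. group. }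
  assert (F2 : x ** zpow G z p' ** x^- = zpow G z q').
  { rewrite <- E2. unfold p'. rewrite zpow_sub, zpow_inv_comm. group. }
  assert (Hq' : q' <> 0).
  { intros ->. simpl in F2. assert (Hz1 : zpow G z p' = e1).
    { apply (mul_left_inj G x), (mul_right_inj G (x^-)). rewrite F2. group. }
    assert (H : pw (p * p') = e1).
    { rewrite zpow_mul, F1, <- zpow_mul, Z.mul_comm, zpow_mul, Hz1.
      apply zpow_subgroup with (K := fun y => y = e1); auto. repeat split; intros; subst; group. }
    apply axis_infinite in H. unfold p, p' in H. nia. }
  exists (p * p'), (p * q'). repeat split; try (unfold p, p'; nia).
  rewrite !zpow_mul, F1, <- !zpow_mul. rewrite (Z.mul_comm q p'), (Z.mul_comm q q').
  rewrite !zpow_mul, <- F2. now rewrite zpow_conj.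
Qed.

Lemma elem_closure_commensurator : elem_closure G g = commensurator.
Proof.
  apply functional_extensionality. intro x. apply propositional_extensionality. split.
  - intro H. apply H; [apply commensurator_subgroup|].
    intros a (K & HK & Hg & Ha). now apply (virtually_cyclic_commensurator K).
  - intros H K HK HA. apply HA. exists commensurator.
    split; [apply commensurator_virtually_cyclic|]. split; auto.
    rewrite <- zpow_1. apply commensurator_axis.
Qed.

Lemma axis_decomp x : dz x (pw (n x)) <= R4 -> dz e1 (pw (- n x) ** x) <= R4.
Proof.
  intro H. rewrite dz_sym in H. rewrite <- (dz_left (pw (- n x))) in H.
  rewrite zpow_opp, gmulVg in H. now rewrite zpow_opp.
Qed.

(** If a translate [z <g>] has long projection to [<g>], it fellow-travels, and by the pigeonhole
    principle two translates of the same short element occur, so that [z] commensurates [<g>]. *)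
Lemma translate_bound : exists M, 0 <= M /\ forall z i, ~ commensurator z ->
  Z.abs (n (z ** pw i) - n z) <= M.
Proof.
  destruct (ball_finite_z R4) as [B HB].
  pose proof R_nonneg. pose proof Delta_nonneg.
  assert (HLD : 0 <= L * Delta) by (apply Z.mul_nonneg_nonneg; lia).
  set (J' := L * Delta + 1). set (P := length B).
  (* Room for one point more than [B] has entries, in consecutive windows of width [J'], with [2 R]
     left free at each end for [fellow_travel]. *)
  set (M := 4 * R + J' * (Z.of_nat P + 1)).
  exists M. split; [nia|].
  assert (H1 : forall z s (N : nat), ~ commensurator z -> Z.abs s = 1 ->
    n (z ** pw (s * Z.of_nat N)) <= n z + M).
  { intros z s N Hz Hs. apply Z.nlt_ge. intro C.
    set (phi := fun k : nat => n (z ** pw (s * Z.of_nat k))).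
    assert (HJ' : forall k, phi (Datatypes.S k) <= phi k + J').
    { intro k. unfold phi.
      pose proof (n_lip (z ** pw (s * Z.of_nat (Datatypes.S k))) (z ** pw (s * Z.of_nat k))) as E.
      rewrite dz_left in E.
      pose proof (axis_step (s * Z.of_nat (Datatypes.S k)) (s * Z.of_nat k)) as E'.
      replace (Z.abs (s * Z.of_nat (Datatypes.S k) - s * Z.of_nat k)) with 1 in E' by lia.
      assert (L * dz (pw (s * Z.of_nat (Datatypes.S k))) (pw (s * Z.of_nat k)) <= L * Delta)
        by (apply Z.mul_le_mono_nonneg_l; lia). lia. }
    assert (Hphi0 : phi 0%nat = n z).
    { unfold phi. replace (s * Z.of_nat 0) with 0 by lia. simpl. now rewrite gmulg1. }
    assert (HK : forall t : nat, exists k, (t <= P)%nat ->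
      (k <= N)%nat /\ n z + 2 * R + J' * Z.of_nat t <= phi k < n z + 2 * R + J' * Z.of_nat t + J').
    { intro t. destruct (le_lt_dec t P) as [Lt|Lt]; [|exists 0%nat; lia].
      destruct (discrete_ivt phi N (n z + 2 * R + J' * Z.of_nat t) J' HJ') as (k & Hk).
      - rewrite Hphi0. nia.
      - fold (phi N) in C. assert (J' * Z.of_nat t <= J' * Z.of_nat P) by nia. nia.
      - exists k. auto. }
    apply choice in HK. destruct HK as [kk Hkk].
    set (w := fun t => z ** pw (s * Z.of_nat (kk t))).
    destruct (pigeonhole G (fun t => pw (- n (w t)) ** w t) B (Datatypes.S P)) as (t & t' & Htt & E).
    - intros t Ht. destruct (Hkk t ltac:(lia)) as [K1 K2]. apply HB, axis_decomp.
      fold (phi N) in C. assert (J' * Z.of_nat t <= J' * Z.of_nat P) by nia.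
      apply (fellow_travel z (w t) (z ** pw (s * Z.of_nat N))); unfold w.
      + change (n (z ** pw (s * Z.of_nat (kk t)))) with (phi (kk t)).
        change (n (z ** pw (s * Z.of_nat N))) with (phi N). lia.
      + assert (Hz0 : forall y, dz z (z ** y) = dz (pw 0) y).
        { intro y. rewrite <- (dz_left z (pw 0) y). simpl. now rewrite gmulg1. }
        rewrite !Hz0, dz_left. apply axis_line'. nia.
    - unfold P. lia.
    - destruct (Hkk t ltac:(lia)) as [K1 K2]. destruct (Hkk t' ltac:(lia)) as [K1' K2'].
      change (phi (kk t)) with (n (w t)) in K2. change (phi (kk t')) with (n (w t')) in K2'.
      assert (J' * (Z.of_nat t + 1) <= J' * Z.of_nat t') by nia.
      set (p := n (w t)) in *. set (p' := n (w t')) in *.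
      set (i := s * Z.of_nat (kk t)) in *. set (i' := s * Z.of_nat (kk t')) in *.
      assert (E2 : z ** pw (i' - i) ** z^- = pw (p' - p)).
      { rewrite !zpow_sub, zpow_inv_comm. apply (mul_left_inj G (pw (- p'))).
        rewrite zpow_opp. transitivity ((pw p)^-); [|group].
        assert (E3 : w t' = pw p' ** ((pw p)^- ** w t)).
        { rewrite <- zpow_opp, E, zpow_opp. group. }
        unfold w in E3. fold i i' in E3.
        assert (E4 : pw i' = z^- ** (pw p' ** ((pw p)^- ** (z ** pw i)))) by (rewrite <- E3; group).
        rewrite <- zpow_inv_comm, E4. group. }
      assert (Hpp : p' - p <> 0) by lia.
      apply Hz. exists (i' - i), (p' - p). repeat split; auto.
      intro Ei. rewrite Ei in E2. simpl in E2. apply Hpp, axis_infinite. rewrite <- E2. group. }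
  assert (H2 : forall z i, ~ commensurator z -> n (z ** pw i) <= n z + M).
  { intros z i Hz. destruct (Z_le_gt_dec 0 i) as [Li|Li].
    - specialize (H1 z 1 (Z.to_nat i) Hz eq_refl). now replace (1 * Z.of_nat (Z.to_nat i)) with i in H1 by lia.
    - specialize (H1 z (-1) (Z.to_nat (- i)) Hz eq_refl).
      now replace (-1 * Z.of_nat (Z.to_nat (- i))) with i in H1 by lia. }
  intros z i Hz. pose proof (H2 z i Hz) as A1.
  assert (Hz' : ~ commensurator (z ** pw i)).
  { intro C. apply Hz. destruct commensurator_subgroup as (_ & CM & _).
    replace z with (z ** pw i ** pw (- i)) by (rewrite zpow_opp; group).
    apply CM; auto. apply commensurator_axis. }
  pose proof (H2 (z ** pw i) (- i) Hz') as A2.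
  rewrite mul_assoc, <- zpow_add in A2. replace (i + - i) with 0 in A2 by lia.
  simpl in A2. rewrite gmulg1 in A2. lia.
Qed.

Lemma coset_bound : exists M, 0 <= M /\ forall z e, ~ commensurator z -> commensurator e ->
  Z.abs (n (z ** e) - n z) <= M.
Proof.
  destruct translate_bound as (M & HM & H). exists (M + L * R4). pose proof R4_nonneg.
  assert (0 <= L * R4) by (apply Z.mul_nonneg_nonneg; lia).
  split; [lia|]. intros z e Hz He. apply commensurator_near in He.
  specialize (H z (n e) Hz). pose proof (n_lip (z ** e) (z ** pw (n e))) as E.
  rewrite dz_left in E.
  assert (L * dz e (pw (n e)) <= L * R4) by (apply Z.mul_le_mono_nonneg_l; lia). lia.
Qed.

(** ** Hyperbolic embedding *)

Local Notation Cm := commensurator.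

(** An admissible edge of the commensurator starts outside it, because an edge starting inside the
    subgroup would stay there; so [coset_bound] controls the change of index. *)
Lemma hpath_index : exists M, 0 <= M /\ forall w x y, hpath G Cm T x y w ->
  Z.abs (n y - n x) <= M * Z.of_nat (length w).
Proof.
  destruct coset_bound as (M & HM & HB). exists (M + L). split; [lia|].
  induction w as [|[[l a] d] w IH]; intros x y Hw; simpl in Hw.
  - subst. simpl. lia.
  - destruct Hw as (Hok & Hn & Hw). apply IH in Hw. simpl length.
    assert (Hstep : Z.abs (n (if d then x ** a else x ** a^-) - n x) <= M + L).
    { destruct commensurator_subgroup as (C1 & CM & CV).
      destruct l.
      - assert (Hx : ~ Cm x).
        { intro Hx. apply Hn. repeat split; auto. destruct d; auto. }
        destruct d; [pose proof (HB x a Hx Hok)|pose proof (HB x (a^-) Hx (CV _ Hok))]; lia.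
      - destruct d; [pose proof (n_step x a Hok)|pose proof (n_step x (a^-) (T_inv _ Hok))]; lia. }
    nia.
Qed.

Lemma dhat_finite h0 k : exists l : list G, forall h, Cm h -> dhat_le G Cm T h0 h k -> In h l.
Proof.
  destruct hpath_index as (M & HM & HP). destruct (ball_finite_z R4) as [B HB].
  set (K := M * Z.of_nat k).
  exists (flat_map (fun i => map (gmul G (pw (n h0 - K + Z.of_nat i))) B) (seq 0 (Z.to_nat (2 * K + 1)))).
  intros h Hh (w & Hw & Hp). apply HP in Hp.
  assert (M * Z.of_nat (length w) <= K) by (apply Z.mul_le_mono_nonneg_l; lia).
  apply in_flat_map. exists (Z.to_nat (n h - n h0 + K)). split; [apply in_seq; lia|].
  apply in_map_iff. exists (pw (- n h) ** h). split.
  - replace (n h0 - K + Z.of_nat (Z.to_nat (n h - n h0 + K))) with (n h) by lia.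
    rewrite zpow_opp. group.
  - apply HB. now apply commensurator_decomp.
Qed.

Local Close Scope Z_scope.

(** * The metric of the coned-off Cayley graph *)

Definition zwalk (x : G) (w : list (bool * G * bool)) : G := fold_left (zstep G) w x.

Lemma zpath_zwalk x y w : zpath G Cm T x y w <-> Forall (zstep_ok G Cm T) w /\ zwalk x w = y.
Proof.
  revert x. induction w as [|s w IH]; intro x; simpl.
  - split; [intros ->; auto|tauto].
  - rewrite IH. split.
    + intros (A & B & C). auto.
    + intros (A & B). inversion A; auto.
Qed.

Lemma zwalk_app x w1 w2 : zwalk x (w1 ++ w2) = zwalk (zwalk x w1) w2.
Proof. apply fold_left_app. Qed.

Lemma zwalk_left h x w : zwalk (h ** x) w = h ** zwalk x w.
Proof.
  revert x. induction w as [|[[l a] d] w IH]; intro x; auto.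
  change (zwalk (zstep G (h ** x) (l, a, d)) w = h ** zwalk (zstep G x (l, a, d)) w).
  rewrite <- IH. f_equal. simpl. destruct d; group.
Qed.

Lemma zdist_le_ex x y : exists k, zdist_le G Cm T x y k.
Proof.
  destruct (dist_le_ex G S HS x y) as (k & w & A1 & A2 & A3). exists (length w).
  exists (map (fun p => (false, fst p, snd p)) w). rewrite length_map. split; auto.
  apply zpath_zwalk. split.
  - apply Forall_map. eapply Forall_impl; [|exact A1]. intros [s b]. apply T_gens.
  - rewrite <- A3. clear. revert x. induction w as [|[s b] w IH]; intro x; auto.
    simpl. rewrite <- IH. now destruct b.
Qed.

Definition zd (x y : G) : nat := least (zdist_le G Cm T x y).

Lemma zd_le x y k : zdist_le G Cm T x y k <-> zd x y <= k.
Proof.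
  destruct (least_spec _ (zdist_le_ex x y)) as [H1 H2]. split; [apply H2|].
  intro Lk. destruct H1 as (w & A & B). exists w. split; auto. unfold zd in Lk. lia.
Qed.

Lemma zdist_zd x y k : zdist G Cm T x y k -> k = zd x y.
Proof.
  intros [H1 H2]. apply zd_le in H1.
  pose proof (H2 _ (proj2 (zd_le x y _) (le_n _))). lia.
Qed.

Lemma zd_walk x w : Forall (zstep_ok G Cm T) w -> zd x (zwalk x w) <= length w.
Proof. intro Hw. apply zd_le. exists w. split; auto. now apply zpath_zwalk. Qed.

Lemma zd_geodesic x y : exists w, Forall (zstep_ok G Cm T) w /\ zwalk x w = y /\ length w = zd x y.
Proof.
  destruct (proj2 (zd_le x y _) (le_n _)) as (w & A & B). apply zpath_zwalk in B.
  destruct B as [B C]. exists w. repeat split; auto.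
  pose proof (zd_walk x w B) as E. rewrite C in E. lia.
Qed.

Lemma zd_tri x y z : zd x z <= zd x y + zd y z.
Proof.
  destruct (zd_geodesic x y) as (w & A1 & A2 & A3), (zd_geodesic y z) as (w' & B1 & B2 & B3).
  rewrite <- A3, <- B3, <- length_app, <- B2, <- A2, <- zwalk_app.
  apply zd_walk, Forall_app. auto.
Qed.

Lemma zd_left h x y : zd (h ** x) (h ** y) = zd x y.
Proof.
  assert (E : forall h x y, zd (h ** x) (h ** y) <= zd x y).
  { clear h x y. intros h x y. destruct (zd_geodesic x y) as (w & A1 & A2 & A3).
    rewrite <- A2 at 1. rewrite <- A3, <- zwalk_left. now apply zd_walk. }
  apply Nat.le_antisymm; auto.
  pose proof (E (h^-) (h ** x) (h ** y)) as K. autorewrite with grp in K. exact K.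
Qed.

Lemma zstep_back x l a d : zstep G (zstep G x (l, a, d)) (l, a, negb d) = x.
Proof. destruct d; simpl; group. Qed.

Lemma zd_sym x y : zd x y = zd y x.
Proof.
  assert (E : forall x y, zd y x <= zd x y); [|apply Nat.le_antisymm; auto].
  clear x y. intros x y. destruct (zd_geodesic x y) as (w & A1 & A2 & A3).
  rewrite <- A3. clear A3. revert x A2. induction A1 as [|[[l a] d] w Hs A1 IH]; intros x A2.
  - simpl in *. subst. apply (zd_walk y []). constructor.
  - simpl in A2. specialize (IH (zstep G x (l, a, d)) A2).
    pose proof (zd_tri y (zstep G x (l, a, d)) x).
    pose proof (zd_walk (zstep G x (l, a, d)) [(l, a, negb d)]
      (Forall_cons (l, a, negb d) Hs (Forall_nil _))) as K.
    change (zwalk (zstep G x (l, a, d)) [(l, a, negb d)])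
      with (zstep G (zstep G x (l, a, d)) (l, a, negb d)) in K.
    rewrite (zstep_back x l a d) in K. simpl length in *. lia.
Qed.

Lemma zd_refl x : zd x x = 0.
Proof. apply Nat.le_0_r. apply (zd_walk x []). constructor. Qed.

Lemma zd_T x y : T (x^- ** y) -> zd x y <= 1.
Proof.
  intro Ht. pose proof (zd_walk x [(false, x^- ** y, true)] (Forall_cons (false, x^- ** y, true) Ht (Forall_nil _))) as E.
  simpl in E. now rewrite mul_inv_cancel in E.
Qed.

Lemma zd_H x y : Cm (x^- ** y) -> zd x y <= 1.
Proof.
  intro Ht. pose proof (zd_walk x [(true, x^- ** y, true)] (Forall_cons (true, x^- ** y, true) Ht (Forall_nil _))) as E.
  simpl in E. now rewrite mul_inv_cancel in E.
Qed.

Local Notation Tadj := (fun x y : G => T (x^- ** y)).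

Lemma T_step x p : In (fst p) S -> T (x^- ** step G x p).
Proof. destruct p as [s []]; unfold step; simpl; intro Hs; rewrite inv_mul_cancel; auto. Qed.

Lemma zd_wdist x y : zd x y <= wdist G S x y.
Proof.
  destruct (proj2 (wdist_le G S HS x y _) (le_n _)) as (w & A1 & A2 & <-).
  etransitivity; [|exact A2]. clear A2. revert x. induction A1 as [|p w Hp A1 IH]; intro x.
  - simpl. now rewrite zd_refl.
  - change (walk G x (p :: w)) with (walk G (step G x p) w).
    pose proof (zd_tri x (step G x p) (walk G (step G x p) w)).
    pose proof (zd_T _ _ (T_step x p Hp)). specialize (IH (step G x p)). simpl length. lia.
Qed.

Lemma geodesic_chain x y : chain Tadj (fun v => wdist G S x v <= wdist G S x y) x y.
Proof.
  destruct (proj2 (wdist_le G S HS x y _) (le_n _)) as (w & A1 & A2 & A3).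
  assert (E : forall u w, Forall (fun p => In (fst p) S) w ->
    wdist G S x u + length w <= wdist G S x y ->
    chain Tadj (fun v => wdist G S x v <= wdist G S x y) u (walk G u w)).
  { clear w A1 A2 A3. intros u w A. revert u. induction A as [|p w Hp A IH]; intros u Hu.
    - simpl. constructor. simpl in Hu. lia.
    - simpl length in Hu. apply chain_cons with (step G u p); [lia|now apply T_step|].
      apply IH. pose proof (wdist_tri G S HS x u (step G u p)).
      assert (wdist G S u (step G u p) <= 1); [|lia].
      apply (wdist_le G S HS). exists [p]. simpl. auto. }
  specialize (E x w A1). rewrite A3 in E. apply E. rewrite wdist_refl by auto. lia.
Qed.

(** An edge of the commensurator can be replaced by steps in [T] that remain near its start in the
    coned-off metric, where axis points are at distance at most 1 from each other. Thus a set that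
    [T]-steps enter only near one point can be entered by these edges only near that point as
    well. *)
Lemma commensurator_chain : exists D, forall e, Cm e -> chain Tadj (fun v => zd e1 v <= D) e1 e.
Proof.
  set (D := 1 + Z.to_nat Delta + Z.to_nat R4). exists D.
  assert (Hp : forall i r y, wdist G S (pw i) y <= r -> r <= Z.to_nat Delta + Z.to_nat R4 ->
    chain Tadj (fun v => zd e1 v <= D) (pw i) y).
  { intros i r y Hy Hr.
    apply (chain_mono _ Tadj _ Tadj (fun v => v) (fun v => wdist G S (pw i) v <= wdist G S (pw i) y));
      auto using geodesic_chain.
    intros u Hu. pose proof (zd_tri e1 (pw i) u). pose proof (zd_wdist (pw i) u).
    assert (zd e1 (pw i) <= 1); [|unfold D; lia].
    apply zd_H. rewrite inv_one, gmul1g. apply commensurator_axis. }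
  assert (Hs : forall i j, Z.abs (i - j) = 1%Z -> wdist G S (pw i) (pw j) <= Z.to_nat Delta).
  { intros i j Hij. pose proof (axis_step i j) as A. rewrite Hij in A. unfold dz in A. lia. }
  assert (Hc : forall s (k : nat), Z.abs s = 1%Z -> chain Tadj (fun v => zd e1 v <= D) e1 (pw (s * Z.of_nat k))).
  { intros s k Es. induction k as [|k IH].
    - replace (s * Z.of_nat 0)%Z with 0%Z by lia. constructor. rewrite zd_refl. lia.
    - eapply chain_app; [exact IH|]. apply (Hp _ (Z.to_nat Delta)); [|lia]. apply Hs. lia. }
  intros e He. apply chain_app with (pw (n e)).
  - destruct (Z_le_gt_dec 0 (n e)).
    + replace (n e) with (1 * Z.of_nat (Z.to_nat (n e)))%Z by lia. now apply Hc.
    + replace (n e) with (-1 * Z.of_nat (Z.to_nat (- n e)))%Z by lia. now apply Hc.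
  - apply (Hp _ (Z.to_nat R4)); [|lia]. apply commensurator_near in He.
    rewrite dz_sym in He. unfold dz in He. lia.
Qed.

(** In the last case every [T]-step entering [V] starts next to [p], so each [T]-path from [x] to
    [y] passes next to [p]. *)
Definition bottleneck_point (x y p : G) : Prop :=
  p = x \/ p = y \/ exists V : G -> Prop, ~ V x /\ V y /\
    forall z z', T (z^- ** z') -> ~ V z -> V z' -> T (z^- ** p).

Hypothesis T_bottleneck : forall y, chain Tadj (bottleneck_point e1 y) e1 y.

Lemma bottleneck_left h x y p : bottleneck_point x y p -> bottleneck_point (h ** x) (h ** y) (h ** p).
Proof.
  intros [->|[->|(V & V1 & V2 & V3)]]; [now left|right; now left|right; right].
  exists (fun v => V (h^- ** v)). rewrite !inv_mul_cancel. repeat split; auto.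
  intros z z' Ht Hz Hz'. replace (z^- ** (h ** p)) with ((h^- ** z)^- ** p) by group.
  apply (V3 _ (h^- ** z')); auto. now replace ((h^- ** z)^- ** (h^- ** z')) with (z^- ** z') by group.
Qed.

Section Crossing.
Variable D : nat.
Hypothesis HD : forall e, Cm e -> chain Tadj (fun v => zd e1 v <= D) e1 e.

(** If the edge that enters [V] belongs to the commensurator, the chain [HD] put in its place has a
    [T]-step entering [V], at distance at most [D] from the start. *)
Lemma crossing (V : G -> Prop) p x w :
  (forall z z', T (z^- ** z') -> ~ V z -> V z' -> T (z^- ** p)) ->
  Forall (zstep_ok G Cm T) w -> ~ V x -> V (zwalk x w) ->
  exists i, i <= length w /\ zd (zwalk x (firstn i w)) p <= D + 1.
Proof.
  intros HV A. revert x. induction A as [|[[l a] d] w Hs A IH]; intros x Hx Hw; [contradiction|].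
  set (x1 := zstep G x (l, a, d)).
  destruct (classic (V x1)) as [Hx1|Hx1].
  - exists 0. split; [lia|]. simpl.
    assert (E : exists b, x1 = x ** b /\ if l then Cm b else T b).
    { exists (if d then a else a^-). split; [unfold x1; simpl; now destruct d|].
      destruct commensurator_subgroup as (_ & _ & CV). destruct l, d; simpl in Hs; auto. }
    destruct E as (b & E & Hb). destruct l.
    + pose proof (HD b Hb) as C.
      destruct (chain_switch _ _ _ (fun v => ~ V (x ** v)) (fun v => V (x ** v)) e1 b C)
        as (u & v & Hu & Hv & Bu & Bv & Huv).
      * now rewrite gmulg1.
      * now rewrite <- E.
      * intros u _. tauto.
      * destruct Huv as [->|Huv]; [contradiction|].
        assert (Ht : T ((x ** u)^- ** p)).
        { apply (HV _ (x ** v)); auto. now replace ((x ** u)^- ** (x ** v)) with (u^- ** v) by group. }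
        apply zd_T in Ht. pose proof (zd_tri x (x ** u) p) as K.
        replace (zd x (x ** u)) with (zd e1 u) in K; [lia|].
        rewrite <- (zd_left x e1 u). now rewrite gmulg1.
    + assert (Ht : T (x^- ** p)).
      { apply (HV _ x1); auto. now rewrite E, inv_mul_cancel. }
      apply zd_T in Ht. lia.
  - destruct (IH x1 Hx1 Hw) as (i & Hi & Hd). exists (Datatypes.S i). simpl length. split; [lia|]. exact Hd.
Qed.

Lemma firstn_geodesic x w i : Forall (zstep_ok G Cm T) w -> i <= length w ->
  length w = zd x (zwalk x w) ->
  zd x (zwalk x (firstn i w)) + zd (zwalk x (firstn i w)) (zwalk x w) <= zd x (zwalk x w).
Proof.
  intros A Hi Hw. rewrite <- Hw. rewrite <- (firstn_skipn i w) at 3 4.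
  rewrite zwalk_app, length_app.
  rewrite <- (firstn_skipn i w) in A. apply Forall_app in A. destruct A as [A1 A2].
  pose proof (zd_walk x _ A1). pose proof (zd_walk (zwalk x (firstn i w)) _ A2). lia.
Qed.

(** The vertex [z] lies in [V] or outside, so one of the sides [x z] and [z y] has to enter [V] and
    passes near [p]. *)
Lemma bottleneck_side x y z p : bottleneck_point x y p ->
  zd x p + zd p z <= zd x z + 2 * (D + 1) \/ zd z p + zd p y <= zd z y + 2 * (D + 1).
Proof.
  intros [->|[->|(V & V1 & V2 & V3)]]; [left; rewrite zd_refl; lia|right; rewrite zd_refl; lia|].
  assert (K : forall a b, ~ V a -> V b -> zd a p + zd p b <= zd a b + 2 * (D + 1)).
  { intros a b Ha Hb. destruct (zd_geodesic a b) as (w & A1 & A2 & A3). subst b.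
    destruct (crossing V p a w V3 A1 Ha Hb) as (i & Hi & Hd).
    pose proof (firstn_geodesic a w i A1 Hi A3) as F.
    set (v := zwalk a (firstn i w)) in *.
    pose proof (zd_tri a v p). pose proof (zd_tri p v (zwalk a w)). rewrite (zd_sym p v) in *. lia. }
  destruct (classic (V z)) as [Hz|Hz]; [left|right]; auto.
Qed.

Lemma bottleneck_geodesic x y p w : bottleneck_point x y p ->
  Forall (zstep_ok G Cm T) w -> zwalk x w = y ->
  exists i, i <= length w /\ zd (zwalk x (firstn i w)) p <= D + 1.
Proof.
  intros [->|[->|(V & V1 & V2 & V3)]] A E.
  - exists 0. simpl. rewrite zd_refl. lia.
  - exists (length w). rewrite firstn_all, E, zd_refl. lia.
  - subst y. eauto using crossing.
Qed.

End Crossing.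

Lemma coned_off_hyperbolic : Z_hyperbolic G Cm T.
Proof.
  destruct commensurator_chain as [D HD].
  exists (4 * (D + 1) + 2). intros x y z w dxy dxz dyz dxw dyw dzw E1 E2 E3 E4 E5 E6.
  apply zdist_zd in E1, E2, E3, E4, E5, E6. subst.
  destruct (four_point G zd zd_sym zd_tri (D + 1)) with (x := x) (y := y) (z := z) (w := w) as [K|K];
    [|left; lia|right; lia].
  clear x y z w. intros x y. destruct (zd_geodesic x y) as (w & A1 & A2 & A3).
  exists (fun i => zwalk x (firstn i w)). simpl firstn. repeat split; auto.
  - now rewrite <- A3, firstn_all.
  - intros i j Hij. apply Nat.le_antisymm.
    + replace (zwalk x (firstn j w)) with (zwalk (zwalk x (firstn i w)) (skipn i (firstn j w))).
      * etransitivity; [apply zd_walk|rewrite length_skipn, length_firstn; lia].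
        rewrite <- (firstn_skipn j w) in A1. apply Forall_app in A1. destruct A1 as [A1 _].
        rewrite <- (firstn_skipn i (firstn j w)) in A1. now apply Forall_app in A1.
      * rewrite <- zwalk_app. f_equal. rewrite <- (firstn_skipn i (firstn j w)) at 2. f_equal.
        rewrite firstn_firstn. f_equal. lia.
    + rewrite <- A2 in *. pose proof (firstn_geodesic x w i A1 ltac:(lia) A3).
      pose proof (firstn_geodesic x w j A1 ltac:(lia) A3).
      pose proof (zd_tri (zwalk x (firstn i w)) (zwalk x (firstn j w)) (zwalk x w)).
      assert (B : forall k, k <= length w -> zd x (zwalk x (firstn k w)) <= k /\
        zd (zwalk x (firstn k w)) (zwalk x w) <= length w - k).
      { intros k Hk. rewrite <- (firstn_skipn k w) in A1. apply Forall_app in A1. destruct A1 as [B1 B2].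
        split.
        - etransitivity; [now apply zd_walk|]. rewrite length_firstn. lia.
        - rewrite <- (firstn_skipn k w) at 2. rewrite zwalk_app.
          etransitivity; [now apply zd_walk|]. rewrite length_skipn. lia. }
      pose proof (B i ltac:(lia)). pose proof (B j ltac:(lia)).
      pose proof (zd_tri x (zwalk x (firstn i w)) (zwalk x w)). lia.
  - pose proof (T_bottleneck (x^- ** y)) as C.
    apply (chain_mono _ Tadj _ (fun p q => zd p q <= 1) (gmul G x) _ (fun p =>
      (exists i, i <= zd x y /\ zd (zwalk x (firstn i w)) p <= D + 1) /\
      forall z, zd x p + zd p z <= zd x z + 2 * (D + 1) \/ zd z p + zd p y <= zd z y + 2 * (D + 1))) in C.
    { now rewrite gmulg1, mul_inv_cancel in C. }
    + intros p Hp. apply (bottleneck_left x) in Hp. rewrite gmulg1, mul_inv_cancel in Hp. split.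
      * rewrite <- A3. now apply (bottleneck_geodesic D HD x y).
      * intro z. now apply (bottleneck_side D HD).
    + intros u v Huv. rewrite zd_left. now apply zd_T.
Qed.

Theorem commensurator_hyp_embedded : hyp_embedded G Cm.
Proof.
  split; [apply commensurator_subgroup|]. exists T. split; [|split].
  - intro h. destruct (zdist_le_ex e1 h) as (k & w & _ & Hw). eauto.
  - apply coned_off_hyperbolic.
  - intros h0 k _. apply dhat_finite.
Qed.

End Axes.

(** * The double of the free group along the ladder subgroup *)

Section Extended.
Variable I : nat -> Prop.
Local Notation Q := (coset_space I).
Local Notation act := (act I).
Local Notation mem := (mem I).
Local Notation hull := (hull I).
Local Notation coset := (coset I).

(** With the identity as involution, reduced means that neighbouring letters differ, and [words] is
    a free product of groups of order two. *)
Definition same (C : Q) : Q := C.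
Lemma sameK C : same (same C) = C.
Proof. reflexivity. Qed.

Definition W : Group := words same sameK.
Definition letters (k : W) : list Q := proj1_sig k.

Lemma letters_eq (k l : W) : letters k = letters l -> k = l.
Proof. apply word_eq. Qed.

Lemma letters_mul (k l : W) : letters (k ** l) = wmul same (letters k) (letters l).
Proof. reflexivity. Qed.

Lemma letters_inv (k : W) : letters (k^-) = rev (letters k).
Proof. change (rev (map same (letters k)) = rev (letters k)). f_equal. apply map_id. Qed.

Lemma winv_same (k : list Q) : winv same k = rev k.
Proof. unfold winv. f_equal. apply map_id. Qed.

Lemma reduced_map_act f (k : list Q) : reduced same k -> reduced same (map (act f) k).
Proof.
  induction k as [|C k IH]; simpl; auto. intros [H1 H2]. split; auto.
  destruct k as [|E k]; simpl; auto. unfold same in *. intro X. apply H1. now apply act_inj in X.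
Qed.

Lemma push_map_act f C (k : list Q) : push same (act f C) (map (act f) k) = map (act f) (push same C k).
Proof.
  destruct k as [|E k]; auto. simpl. unfold same.
  destruct (decide (E = C)) as [->|N], (decide (act f _ = act f _)) as [X|X]; try tauto.
  - now apply act_inj in X.
Qed.

Lemma wmul_map_act f (k l : list Q) :
  wmul same (map (act f) k) (map (act f) l) = map (act f) (wmul same k l).
Proof. induction k as [|C k IH]; auto. simpl map at 1. rewrite wmul_cons, IH. apply push_map_act. Qed.

Definition wact (f : Fr) (k : W) : W :=
  exist _ (map (act f) (letters k)) (reduced_map_act f _ (proj2_sig k)).

Lemma wact_mul f k l : wact f (k ** l) = wact f k ** wact f l.
Proof. apply letters_eq. rewrite letters_mul. simpl. symmetry. apply wmul_map_act. Qed.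

Lemma wact_comp f h k : wact (f ** h) k = wact f (wact h k).
Proof. apply letters_eq. simpl. rewrite map_map. apply map_ext. intro. apply act_mul. Qed.

Lemma wact_one k : wact e1 k = k.
Proof.
  apply letters_eq. simpl. rewrite <- (map_id (letters k)) at 2. apply map_ext. intro. apply act_one.
Qed.

Lemma wact_e f : wact f e1 = e1.
Proof. now apply letters_eq. Qed.

(** The free product of copies of [Z/2] indexed by the cosets, extended by the free group permuting
    them.  A pair [(k, f)] is the point [f] on the sheet [k] of the tree of trees. *)
Definition GG : Group.
Proof.
  refine {| carrier := (W * Fr)%type;
            gmul x y := (fst x ** wact (snd x) (fst y), snd x ** snd y);
            gone := (e1, e1);
            ginv x := (wact ((snd x)^-) ((fst x)^-), (snd x)^-) |}.
  - intros [k f] [l h] [m j]; simpl. now rewrite wact_mul, wact_comp, !gmulA.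
  - intros [k f]; simpl. now rewrite wact_one, !gmul1g.
  - intros [k f]; simpl. now rewrite wact_e, !gmulg1.
  - intros [k f]; simpl. now rewrite <- wact_mul, !gmulVg, wact_e.
  - intros [k f]; simpl. now rewrite <- wact_comp, !gmulgV, wact_one, gmulgV.
Defined.

Definition ks (x : GG) : list Q := letters (fst x).
Definition pt (x : GG) : Fr := snd x.

Lemma gg_eq (x y : GG) : ks x = ks y -> pt x = pt y -> x = y.
Proof. destruct x, y. unfold ks, pt; simpl. intros E ->. f_equal. now apply letters_eq. Qed.

Lemma ks_mul x y : ks (x ** y) = wmul same (ks x) (map (act (pt x)) (ks y)).
Proof. reflexivity. Qed.
Lemma pt_mul x y : pt (x ** y) = pt x ** pt y.
Proof. reflexivity. Qed.
Lemma pt_inv x : pt (x^-) = (pt x)^-.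
Proof. reflexivity. Qed.
Lemma ks_inv x : ks (x^-) = map (act ((pt x)^-)) (rev (ks x)).
Proof.
  change (map (act ((pt x)^-)) (letters ((fst x)^-)) = map (act ((pt x)^-)) (rev (ks x))).
  now rewrite letters_inv.
Qed.
Lemma ks_one : ks e1 = [].
Proof. reflexivity. Qed.
Lemma ks_reduced x : reduced same (ks x).
Proof. exact (proj2_sig (fst x)). Qed.

Definition fr (f : Fr) : GG := (e1, f).
Definition tg (C : Q) : GG := (exist _ [C] (conj Logic.I Logic.I), e1).
(** Right multiplication by [tau] passes to the adjacent sheet across the coset of the current
    point. It commutes with the ladder group, and conjugation by it exchanges the two factors of the
    double. *)
Definition tau : GG := tg (coset e1).

Lemma fr_mul f h : fr (f ** h) = fr f ** fr h.
Proof. apply gg_eq; reflexivity. Qed.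

Lemma fr_inv f : fr (f^-) = (fr f)^-.
Proof. now apply gg_eq. Qed.

Lemma fr_one : fr e1 = e1.
Proof. reflexivity. Qed.

Lemma fr_pow f j : fr (zpow Fr f j) = zpow GG (fr f) j.
Proof.
  assert (H : forall n, fr (npow Fr f n) = npow GG (fr f) n).
  { induction n; auto. simpl. now rewrite fr_mul, IHn. }
  destruct j; simpl; auto. now rewrite fr_inv, H.
Qed.

Lemma tg_tg C : tg C ** tg C = e1.
Proof.
  apply gg_eq; [|apply gmul1g]. rewrite ks_mul. simpl. rewrite act_one. unfold same.
  destruct (decide (C = C)); tauto.
Qed.

Lemma tg_inv C : (tg C)^- = tg C.
Proof. symmetry. apply inv_unique, tg_tg. Qed.

Lemma fr_tg f C : fr f ** tg C = tg (act f C) ** fr f.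
Proof.
  apply gg_eq; [reflexivity|]. rewrite !pt_mul. unfold pt; simpl. group.
Qed.

Lemma ks_fr_mul f x : ks (fr f ** x) = map (act f) (ks x).
Proof. reflexivity. Qed.

Lemma ks_mul_fr x f : ks (x ** fr f) = ks x.
Proof. rewrite ks_mul. apply wmul_nil_r, ks_reduced. Qed.

Lemma ks_tg_mul C x : ks (tg C ** x) = push same C (ks x).
Proof.
  rewrite ks_mul. simpl. f_equal. rewrite <- (map_id (ks x)) at 2. apply map_ext. intro; apply act_one.
Qed.

Lemma pt_tg_mul C x : pt (tg C ** x) = pt x.
Proof. rewrite pt_mul. apply gmul1g. Qed.

Lemma ks_mul_tg x C : ks (x ** tg C) = wmul same (ks x) [act (pt x) C].
Proof. reflexivity. Qed.

Lemma pt_mul_tg x C : pt (x ** tg C) = pt x.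
Proof. rewrite pt_mul. apply gmulg1. Qed.

Lemma ks_mul_tau x : ks (x ** tau) = wmul same (ks x) [coset (pt x)].
Proof. unfold tau. rewrite ks_mul_tg, act_coset, gmulg1. reflexivity. Qed.

Lemma tg_tau C c : mem C c -> tg C ** fr c = fr c ** tau.
Proof. intro H. unfold tau. rewrite fr_tg, act_coset, gmulg1. now rewrite (mem_coset_eq I C c H). Qed.

Lemma wmul_snoc (k : list Q) C : reduced same k ->
  (exists k', k = k' ++ [C] /\ wmul same k [C] = k') \/ wmul same k [C] = k ++ [C].
Proof.
  induction k as [|a k IH]; intro R; [now right|].
  rewrite wmul_cons. destruct (IH (reduced_tail _ _ _ _ R)) as [(k' & -> & E)|E]; rewrite E.
  - left. exists (a :: k'). split; auto. apply push_cons.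
    apply (reduced_app_l _ _ _ [C]). exact R.
  - destruct k as [|b k].
    + simpl. unfold same. destruct (decide (C = a)) as [->|N]; auto. left. now exists [].
    + right. simpl. destruct R as [R _]. now destruct (decide (b = same a)).
Qed.

Lemma ks_inv_mul x y : hd_error (ks x) <> hd_error (ks y) ->
  ks (x^- ** y) = map (act ((pt x)^-)) (rev (ks x) ++ ks y).
Proof.
  intro H. rewrite ks_mul, ks_inv, pt_inv, wmul_map_act. f_equal. rewrite <- winv_same.
  destruct (wmul_winv_prefix _ same sameK (ks x) (ks y) (ks_reduced x) (ks_reduced y))
    as (p & u & v & E1 & E2 & E3 & _).
  rewrite E3. destruct p as [|a p]; [simpl in *; congruence|].
  exfalso. apply H. now rewrite E1, E2.
Qed.

(** ** The metric on points of sheets; toggling the sheet at a gluing point is free *)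

Inductive reach (x : GG) : GG -> nat -> Prop :=
| reach_refl : reach x x 0
| reach_letter y n l : reach x y n -> reach x (y ** fr (of_letter l)) (S n)
| reach_tau y n : reach x y n -> reach x (y ** tau) n
| reach_weaken y n : reach x y n -> reach x y (S n).

Lemma reach_mono x y n m : reach x y n -> n <= m -> reach x y m.
Proof. intros H L. induction L; auto using reach_weaken. Qed.

Lemma reach_left g x y n : reach x y n -> reach (g ** x) (g ** y) n.
Proof.
  intro H. induction H; rewrite ?gmulA; auto using reach_refl, reach_letter, reach_tau, reach_weaken.
Qed.

Lemma reach_trans x y z n m : reach x y n -> reach y z m -> reach x z (n + m).
Proof.
  intros H1 H2. induction H2; rewrite ?Nat.add_0_r, ?Nat.add_succ_r;
    auto using reach_letter, reach_tau, reach_weaken.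
Qed.

Lemma reach_sym x y n : reach x y n -> reach y x n.
Proof.
  intro H. induction H as [|y n l H IH|y n H IH|y n H IH]; auto using reach_refl, reach_weaken.
  - change (S n) with (1 + n). apply reach_trans with y; auto.
    replace y with (y ** fr (of_letter l) ** fr (of_letter (linv l))) at 2.
    + apply reach_letter, reach_refl.
    + rewrite <- of_letter_inv, fr_inv. group.
  - change n with (0 + n). apply reach_trans with y; auto.
    replace y with (y ** tau ** tau) at 2.
    + apply reach_tau, reach_refl.
    + unfold tau. rewrite mul_assoc, tg_tg. group.
Qed.

Lemma of_word_cons l w H H' : of_word (l :: w) H = of_letter l ** of_word w H'.
Proof. apply wd_eq. rewrite wd_mul. symmetry. exact (push_cons _ linv l w H). Qed.

Lemma reach_fr x f : reach x (x ** fr f) (flen f).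
Proof.
  assert (H : forall w R x, reach x (x ** fr (of_word w R)) (length w)).
  { clear x f. induction w as [|l w IH]; intros R x.
    - assert (E : x ** fr (of_word [] R) = x); [|rewrite E; apply reach_refl].
      assert (E : of_word [] R = e1) by now apply wd_eq. rewrite E, fr_one. group.
    - rewrite (of_word_cons l w R (reduced_tail _ _ _ _ R)), fr_mul, gmulA.
      change (length (l :: w)) with (1 + length w).
      apply reach_trans with (x ** fr (of_letter l)); auto. apply reach_letter, reach_refl. }
  destruct f as [w R]. exact (H w R x).
Qed.

Lemma reach_tg x C : exists n, reach x (x ** tg C) n.
Proof.
  destruct (coset_nonempty I C) as [c Hc].
  replace (tg C) with (fr c ** tau ** fr (c^-)) by (rewrite <- (tg_tau C c Hc), fr_inv; group).
  exists (flen c + flen (c^-)). rewrite !gmulA.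
  apply reach_trans with (x ** fr c ** tau); [|apply reach_fr]. apply reach_tau, reach_fr.
Qed.

Definition sheet_point (k : list Q) (R : reduced same k) (f : Fr) : GG := (exist _ k R, f).

Lemma reach_ex x y : exists n, reach x y n.
Proof.
  assert (H : forall k R (f : Fr) x, exists n, reach x (x ** sheet_point k R f) n).
  { clear x y. induction k as [|C k IH]; intros R f x.
    - exists (flen f). assert (E : sheet_point [] R f = fr f) by now apply gg_eq.
      rewrite E. apply reach_fr.
    - destruct (reach_tg x C) as [n Hn].
      destruct (IH (reduced_tail _ _ _ _ R) f (x ** tg C)) as [m Hm]. exists (n + m).
      eapply reach_trans; [exact Hn|].
      assert (E : sheet_point (C :: k) R f = tg C ** sheet_point k (reduced_tail _ _ _ _ R) f).
      { apply gg_eq; [|now rewrite pt_tg_mul]. symmetry. rewrite ks_tg_mul. apply push_cons, R. }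
      now rewrite E, gmulA. }
  assert (E : x^- ** y = sheet_point (ks (x^- ** y)) (ks_reduced _) (pt (x^- ** y))) by now apply gg_eq.
  destruct (H _ (ks_reduced (x^- ** y)) (pt (x^- ** y)) x) as [n Hn]. exists n.
  now rewrite <- E, mul_inv_cancel in Hn.
Qed.

Definition D (x y : GG) : nat := least (reach x y).

Lemma D_le x y n : reach x y n <-> D x y <= n.
Proof.
  destruct (least_spec _ (reach_ex x y)) as [H1 H2]. split; [apply H2|].
  intro L. eapply reach_mono; eauto.
Qed.

Lemma D_reach x y : reach x y (D x y).
Proof. apply D_le. lia. Qed.

Lemma D_refl x : D x x = 0.
Proof. apply Nat.le_0_r, D_le, reach_refl. Qed.

Lemma D_tri x y z : D x z <= D x y + D y z.
Proof. apply D_le. eapply reach_trans; apply D_reach. Qed.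

Lemma D_sym x y : D x y = D y x.
Proof. apply Nat.le_antisymm; apply D_le, reach_sym, D_reach. Qed.

Lemma D_left g x y : D (g ** x) (g ** y) = D x y.
Proof.
  assert (H : forall g x y, D (g ** x) (g ** y) <= D x y) by (intros; apply D_le, reach_left, D_reach).
  apply Nat.le_antisymm; auto.
  pose proof (H (g^-) (g ** x) (g ** y)) as L. autorewrite with grp in L. exact L.
Qed.

Lemma D_tau x : D x (x ** tau) = 0.
Proof. apply Nat.le_0_r, D_le, reach_tau, reach_refl. Qed.

(** Forgetting the sheet folds the tree of trees onto the tree of [Fr] without increasing distances;
    so sheets are isometrically embedded. *)
Lemma D_ge_fd x y : fd (pt x) (pt y) <= D x y.
Proof.
  assert (H : forall n, reach x y n -> fd (pt x) (pt y) <= n); [|apply H, D_reach].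
  intros n H. induction H.
  - rewrite fd_refl. lia.
  - rewrite pt_mul. pose proof (fd_tri (pt x) (pt y) (pt y ** of_letter l)) as T.
    rewrite <- (gmulg1 Fr (pt y)) in T at 3. rewrite fd_left, fd_one in T. simpl in T.
    change (flen (of_letter l)) with 1 in T. change (pt (fr (of_letter l))) with (of_letter l). lia.
  - unfold tau. now rewrite pt_mul_tg.
  - lia.
Qed.

Lemma D_fr x c c' : D (x ** fr c) (x ** fr c') = fd c c'.
Proof.
  apply Nat.le_antisymm.
  - replace (x ** fr c') with (x ** fr c ** fr (c^- ** c')).
    + apply D_le, reach_fr.
    + rewrite mul_assoc, <- fr_mul, mul_inv_cancel. reflexivity.
  - rewrite D_left. apply (D_ge_fd (fr c) (fr c')).
Qed.

Lemma D_fr_one c c' : D (fr c) (fr c') = fd c c'.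
Proof. rewrite <- (D_fr e1 c c'). now rewrite !gmul1g. Qed.

(** A path that leaves the part of the space beyond the coset [C] passes through [C]. *)
Lemma gate C x y : hd_error (ks x) = Some C -> hd_error (ks y) <> Some C ->
  exists c, mem C c /\ D x (fr c) + D (fr c) y <= D x y.
Proof.
  intros Hx. assert (H : forall n, reach x y n -> hd_error (ks y) <> Some C ->
    exists c, mem C c /\ D x (fr c) + D (fr c) y <= n); [|apply H, D_reach].
  intros n H. induction H as [|y n l H IH|y n H IH|y n H IH]; intro Hy; [contradiction| | |].
  - rewrite ks_mul_fr in Hy. destruct (IH Hy) as (c & Hc & L). exists c. split; auto.
    pose proof (D_tri (fr c) y (y ** fr (of_letter l))).
    assert (D y (y ** fr (of_letter l)) <= 1); [|lia]. apply D_le, reach_letter, reach_refl.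
  - destruct (classic (hd_error (ks y) = Some C)) as [E|E].
    + assert (E' : ks (y ** tau) = [] /\ coset (pt y) = C).
      { rewrite ks_mul_tau in *.
        destruct (wmul_snoc (ks y) (coset (pt y)) (ks_reduced y)) as [(k & E1 & E2)|E2].
        - rewrite E2 in *. rewrite E1 in E. destruct k as [|B k]; simpl in *; [|contradiction].
          split; congruence.
        - rewrite E2 in Hy. exfalso. apply Hy. destruct (ks y); simpl in *; auto. discriminate. }
      destruct E' as [E1 E2]. assert (E3 : y ** tau = fr (pt y)).
      { apply gg_eq; auto. unfold tau. now rewrite pt_mul_tg. }
      exists (pt y). split; [rewrite <- E2; apply mem_coset_self|].
      rewrite <- E3, D_refl. apply reach_tau, D_le in H. lia.
    + destruct (IH E) as (c & Hc & L). exists c. split; auto.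
      pose proof (D_tri (fr c) y (y ** tau)). rewrite D_tau in *. lia.
  - destruct (IH Hy) as (c & Hc & L). exists c. split; auto.
Qed.

Lemma gate_at p C x y : hd_error (ks (p^- ** x)) = Some C -> hd_error (ks (p^- ** y)) <> Some C ->
  exists c, mem C c /\ D x (p ** fr c) + D (p ** fr c) y <= D x y.
Proof.
  intros Hx Hy. destruct (gate C _ _ Hx Hy) as (c & Hc & L). exists c. split; auto.
  rewrite <- (D_left p (p^- ** x) (fr c)), <- (D_left p (fr c)), <- (D_left p (p^- ** x)) in L.
  now rewrite !mul_inv_cancel in L.
Qed.

Lemma gate_at' p C x y : hd_error (ks (p^- ** x)) <> Some C -> hd_error (ks (p^- ** y)) = Some C ->
  exists c, mem C c /\ D x (p ** fr c) + D (p ** fr c) y <= D x y.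
Proof.
  intros Hx Hy. destruct (gate_at p C y x Hy Hx) as (c & Hc & L). exists c. split; auto.
  rewrite (D_sym x (p ** fr c)), (D_sym x y), (D_sym _ y). lia.
Qed.

(** ** Axes *)

Definition axis_data (T : GG -> Prop) (phi : GG) (n : GG -> Z) (R J : Z) : Prop :=
  (forall x j, Z.abs (n (zpow GG phi j ** x) - n x - j) <= R)%Z /\
  (forall x x' m, n x + R <= m <= n x' - R ->
     Z.of_nat (D x (zpow GG phi m)) + Z.of_nat (D (zpow GG phi m) x') <= Z.of_nat (D x x') + R)%Z /\
  (forall x t, T t -> Z.abs (n (x ** t) - n x) <= J)%Z.

(** Points of a sheet are not distinguished, so the resulting graph looks like the tree of sheets.
    The bound is 2 because elements of the double cross an even number of cosets. *)
Definition near_sheet (t : GG) : Prop := length (ks t) <= 2.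

Lemma ks_inv_length x : length (ks (x^-)) = length (ks x).
Proof. now rewrite ks_inv, length_map, length_rev. Qed.

(** * Elements that translate along the tree of sheets *)

Section Loxodromic.
Variable phi : GG.
Hypothesis phi_moves : ks phi <> [].
Hypothesis phi_cyc : hd_error (ks phi) <> hd_error (ks (phi^-)).

Lemma ks_phi_mul x : hd_error (ks x) <> hd_error (ks (phi^-)) ->
  exists k, ks (phi ** x) = ks phi ++ k /\ length k = length (ks x).
Proof.
  clear phi_cyc. intro H. pose proof (ks_inv_mul (phi^-) x) as E. rewrite inv_inv in E.
  rewrite E by congruence. rewrite map_app. exists (map (act ((pt (phi^-))^-)) (ks x)).
  split; [|apply length_map]. f_equal.
  pose proof (ks_inv (phi^-)) as E2. now rewrite inv_inv in E2.
Qed.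

Lemma ks_phi_mul_hd x : hd_error (ks x) <> hd_error (ks (phi^-)) ->
  hd_error (ks (phi ** x)) = hd_error (ks phi).
Proof.
  clear phi_cyc. intro H. destruct (ks_phi_mul x H) as (k & -> & _). now destruct (ks phi).
Qed.

Lemma ks_phi_pos : 1 <= length (ks phi).
Proof. destruct (ks phi); [contradiction|simpl; lia]. Qed.

(** Ping-pong by the first coset crossed. With the axis point moved to the identity, a path between
    the two sides leaves through [C0] and enters through [C1], both seen from one sheet, and
    [coset_product_bound] forces it close to the identity. *)
Lemma loxodromic_axis : exists n R, axis_data near_sheet phi n R 2.
Proof.
  pose proof ks_phi_pos as Lp.
  destruct (ping_pong GG phi (fun x => hd_error (ks x) = hd_error (ks phi))
    (fun x => hd_error (ks x) = hd_error (ks (phi^-))) (fun x => length (ks x))) as (n & Hp & Hm & Hj).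
  { intros x Hx. now apply ks_phi_mul_hd. }
  { intros x E1 E2. congruence. }
  { intros x _ E. replace x with (phi^- ** (phi ** x)) at 2 by group.
    rewrite (ks_inv_mul phi) by congruence. rewrite length_map, length_app, length_rev. lia. }
  { intros x _ E. replace x with ((phi^-)^- ** (phi^- ** x)) at 2 by group.
    rewrite (ks_inv_mul (phi^-)) by congruence.
    rewrite length_map, length_app, length_rev, ks_inv_length. lia. }
  destruct (hd_error (ks phi)) as [C1|] eqn:E1; [|destruct (ks phi); easy].
  destruct (hd_error (ks (phi^-))) as [C0|] eqn:E0.
  2:{ pose proof (ks_inv_length phi). destruct (ks (phi^-)); simpl in *; [lia|discriminate]. }
  destruct (coset_product_bound I C0 C1) as [K HK]; [congruence|].
  exists n, (Z.of_nat (K + 2)). split; [|split].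
  - intros x j. rewrite Hj. lia.
  - intros x x' m Hxm. specialize (Hm x m ltac:(lia)).
    assert (Hx' : hd_error (ks (zpow GG phi (- m) ** x')) = Some C1) by (apply Hp; lia).
    rewrite <- (D_left (zpow GG phi (- m)) x), <- (D_left (zpow GG phi (- m)) _ x'), <- (D_left (zpow GG phi (- m)) x x').
    rewrite zpow_opp, gmulVg, <- zpow_opp.
    set (y := zpow GG phi (- m) ** x) in *. set (y' := zpow GG phi (- m) ** x') in *.
    destruct (gate C0 y y' Hm) as (c & Hc & L1); [congruence|].
    destruct (gate_at' e1 C1 (fr c) y') as (c' & Hc' & L2).
    { rewrite inv_one, gmul1g. discriminate. }
    { now rewrite inv_one, gmul1g. }
    rewrite gmul1g, D_fr_one in L2. specialize (HK c c' Hc Hc').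
    pose proof (D_tri y (fr c) e1). pose proof (D_tri e1 (fr c') y').
    rewrite (D_sym (fr c) e1) in *.
    rewrite <- fr_one, !D_fr_one, !fd_one in *. lia.
  (* Two powers of [phi] in front give a list of at least three cosets, whose head survives
     multiplication by an element with at most two. *)
  - assert (H : forall x t, near_sheet t -> (n x - 2 <= n (x ** t))%Z).
    { intros x t Ht. apply Hp.
      set (y := zpow GG phi (- n x) ** x).
      assert (Hy : hd_error (ks y) = Some C1) by (apply Hp; lia).
      destruct (ks_phi_mul y) as (k & Ek & Lk); [congruence|].
      assert (Hy1 : hd_error (ks (phi ** y)) = Some C1) by (rewrite ks_phi_mul_hd; congruence).
      destruct (ks_phi_mul (phi ** y)) as (k' & Ek' & Lk'); [congruence|].
      assert (E : zpow GG phi (- (n x - 2)) ** (x ** t) = phi ** (phi ** y) ** t).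
      { replace (- (n x - 2))%Z with (1 + (1 + - n x))%Z by lia. rewrite !zpow_add, zpow_1.
        unfold y. group. }
      rewrite E, ks_mul, hd_wmul; try apply sameK.
      - rewrite ks_phi_mul_hd; congruence.
      - apply ks_reduced.
      - apply reduced_map_act, ks_reduced.
      - rewrite length_map, Ek', length_app, Lk', Ek, length_app, Lk. unfold near_sheet in Ht.
        destruct (ks y); simpl in *; [discriminate|lia]. }
    intros x t Ht. pose proof (H x t Ht). pose proof (H (x ** t) (t^-)) as H2.
    rewrite mul_assoc, gmulgV, gmulg1 in H2. unfold near_sheet in *. rewrite ks_inv_length in H2. lia.
Qed.

End Loxodromic.

(** [sheet_stab] fixes the sheet up to passing through cosets whose hulls contain the base point. *)
Definition sheet_stab (b : GG) : Prop := pt b = e1 /\ forall C, In C (ks b) -> hull C e1.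

(** With sheets glued along whole hulls, [sheet_stab] fixes the base vertex, so these elements move
    it by at most one edge. *)
Definition hull_step (t : GG) : Prop :=
  exists a s b, sheet_stab a /\ flen s <= 1 /\ sheet_stab b /\ t = a ** fr s ** b.

(** * Elements conjugate into a factor *)

Section Elliptic.
Variable f : Fr.
Hypothesis Hf : cyc_reduced f.

Definition rep (C : Q) : Fr := epsilon (inhabits e1) (mem C).

Lemma rep_mem C : mem C (rep C).
Proof. unfold rep. apply epsilon_spec, coset_nonempty. Qed.

(** The first coset on the way that is not fixed by [f] has bounded projection to the axis of [f],
    and determines the projection up to bounded error. *)
Fixpoint anchor (k : list Q) (g : Fr) : Fr :=
  match k with
  | [] => g
  | C :: k' => if decide (act f C = C) then anchor k' g else rep C
  end.

Variable n : Fr -> Z.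
Hypothesis n_pow : forall g j, n (zpow Fr f j ** g) = (n g + j)%Z.
Hypothesis n_path : forall g g' m, (n g + 2 <= m <= n g')%Z -> on_path g (zpow Fr f m) g'.

Definition index (x : GG) : Z := n (anchor (ks x) (pt x)).

Lemma n_hull C h h' : act f C <> C -> hull C h -> hull C h' -> (Z.abs (n h - n h') <= 8)%Z.
Proof. intro N. now apply (axis_variation I f Hf n C h h' n_path N). Qed.

Lemma anchor_pow j k g :
  (Z.abs (n (anchor (map (act (zpow Fr f j)) k) (zpow Fr f j ** g)) - n (anchor k g) - j) <= 8)%Z.
Proof.
  induction k as [|C k IH]; simpl.
  - rewrite n_pow. lia.
  - assert (E : act f (act (zpow Fr f j) C) = act (zpow Fr f j) (act f C)).
    { rewrite <- !act_mul. f_equal. rewrite <- (zpow_1 Fr f) at 1 4. apply zpow_comm. }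
    destruct (decide (act f C = C)) as [F|F], (decide (act f (act (zpow Fr f j) C) = _)) as [F'|F']; auto.
    + rewrite E, F in F'. contradiction.
    + rewrite E in F'. now apply act_inj in F'.
    + pose proof (n_pow (rep C) j).
      pose proof (n_hull _ (rep (act (zpow Fr f j) C)) (zpow Fr f j ** rep C) F') as B.
      specialize (B ltac:(apply mem_hull, rep_mem) ltac:(apply hull_act, mem_hull, rep_mem)). lia.
Qed.

Lemma zpow_inj i j : zpow Fr f i = zpow Fr f j -> i = j.
Proof. intro E. pose proof (n_pow e1 i). pose proof (n_pow e1 j). rewrite E in *. lia. Qed.

(** Otherwise three distinct powers of [f] would lie on a segment with at most two vertices. *)
Lemma n_letter g s : flen s <= 1 -> (n (g ** s) <= n g + 4)%Z.
Proof.
  intro Hs. apply Z.nlt_ge. intro L.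
  assert (H : forall m, (n g + 2 <= m <= n (g ** s))%Z -> zpow Fr f m = g \/ zpow Fr f m = g ** s).
  { intros m Hm. apply n_path in Hm. red in Hm.
    pose proof (fd_left g e1 s) as E. rewrite gmulg1, fd_one in E. rewrite E in Hm.
    destruct (fd g (zpow Fr f m)) eqn:E1; [left; symmetry; now apply fd_0|].
    right. apply fd_0. lia. }
  destruct (H (n g + 2)%Z ltac:(lia)) as [A|A], (H (n g + 3)%Z ltac:(lia)) as [B|B],
    (H (n g + 4)%Z ltac:(lia)) as [C|C];
  first [pose proof (zpow_inj _ _ (eq_trans A (eq_sym B))); lia
        |pose proof (zpow_inj _ _ (eq_trans B (eq_sym C))); lia
        |pose proof (zpow_inj _ _ (eq_trans A (eq_sym C))); lia].
Qed.

Lemma n_letter_abs g s : flen s <= 1 -> (Z.abs (n (g ** s) - n g) <= 4)%Z.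
Proof.
  intro Hs. pose proof (n_letter g s Hs). pose proof (n_letter (g ** s) (s^-)) as H2.
  rewrite flen_inv, mul_assoc, gmulgV, gmulg1 in H2. specialize (H2 Hs). lia.
Qed.

(** Toggling between sheets at [g] changes the index only if it is that of [g], up to bounded error. *)
Definition index_close (g : Fr) (k k' : list Q) : Prop :=
  n (anchor k g) = n (anchor k' g) \/
  (Z.abs (n (anchor k g) - n g) <= 8 /\ Z.abs (n (anchor k' g) - n g) <= 8)%Z.

Lemma anchor_snoc k C g : hull C g -> index_close g k (k ++ [C]).
Proof.
  intro H. induction k as [|B k IH]; simpl.
  - right. simpl. split; [lia|]. destruct (decide (act f C = C)) as [F|F]; [lia|].
    apply (n_hull C); auto. apply mem_hull, rep_mem.
  - unfold index_close in *. simpl. destruct (decide (act f B = B)); auto.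
Qed.

Lemma anchor_toggle k C g : reduced same k -> hull C g -> index_close g k (wmul same k [C]).
Proof.
  intros Rk H. destruct (wmul_snoc k C Rk) as [(k' & -> & E)|E]; rewrite E.
  - pose proof (anchor_snoc k' C g H) as [A|[A B]]; [left|right]; auto.
  - now apply anchor_snoc.
Qed.

Lemma anchor_toggles l k g : reduced same k -> reduced same l -> (forall C, In C l -> hull C g) ->
  index_close g k (wmul same k l).
Proof.
  revert k. induction l as [|C l IH]; intros k Rk Rl Hl.
  - rewrite wmul_nil_r by auto. now left.
  - assert (E : wmul same k (C :: l) = wmul same (wmul same k [C]) l).
    { rewrite wmul_assoc; [|apply sameK|now apply reduced_tail in Rl].
      f_equal. symmetry. now apply push_cons. }
    rewrite E.
    assert (K1 : index_close g k (wmul same k [C])) by (apply anchor_toggle, Hl; [auto|now left]).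
    assert (K2 : index_close g (wmul same k [C]) (wmul same (wmul same k [C]) l)).
    { apply IH; [now apply reduced_wmul|now apply reduced_tail in Rl|]. intros; apply Hl; now right. }
    unfold index_close in *. lia.
Qed.

Lemma sheet_stab_toggles x b : sheet_stab b ->
  pt (x ** b) = pt x /\ ks (x ** b) = wmul same (ks x) (map (act (pt x)) (ks b)) /\
  reduced same (map (act (pt x)) (ks b)) /\ (forall C, In C (map (act (pt x)) (ks b)) -> hull C (pt x)).
Proof.
  intros [B1 B2]. rewrite pt_mul, B1, gmulg1. repeat split; auto.
  - apply reduced_map_act, ks_reduced.
  - intros C HC. apply in_map_iff in HC. destruct HC as (B & <- & HB).
    rewrite <- (gmulg1 Fr (pt x)) at 2. apply hull_act. auto.
Qed.

Lemma index_stab x b : sheet_stab b -> (Z.abs (index (x ** b) - index x) <= 16)%Z.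
Proof.
  intro Hb. destruct (sheet_stab_toggles x b Hb) as (E1 & E2 & R & H). unfold index.
  rewrite E1, E2. pose proof (anchor_toggles _ (ks x) (pt x) (ks_reduced x) R H) as A.
  unfold index_close in A. lia.
Qed.

Lemma index_letter x s : flen s <= 1 -> (Z.abs (index (x ** fr s) - index x) <= 4)%Z.
Proof.
  intro Hs. unfold index. rewrite ks_mul_fr, pt_mul.
  induction (ks x) as [|C k IH]; simpl.
  - now apply n_letter_abs.
  - destruct (decide (act f C = C)); auto. lia.
Qed.

Lemma index_step x t : hull_step t -> (Z.abs (index (x ** t) - index x) <= 36)%Z.
Proof.
  intros (a & s & b & Ha & Hs & Hb & ->). rewrite !gmulA.
  pose proof (index_stab x a Ha). pose proof (index_letter (x ** a) s Hs).
  pose proof (index_stab (x ** a ** fr s) b Hb). lia.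
Qed.

(** [p] is the identity or toggles the coset fixed by [f]; on the sheet of [p], the point [x] lies on
    or beyond the point where the anchor is taken. *)
Definition base (p : GG) (o : option Q) (x : GG) : Prop :=
  (p = e1 \/ exists C0, act f C0 = C0 /\ p = tg C0) /\
  match o with
  | None => x = p ** fr (pt x)
  | Some C => act f C <> C /\ hd_error (ks (p^- ** x)) = Some C
  end.

Lemma fixed_eq C B : act f C = C -> act f B = B -> C = B.
Proof. apply (fixed_coset_unique I f Hf). Qed.

Lemma base_ex x : exists p o, base p o x.
Proof.
  destruct (ks x) as [|C k] eqn:E.
  - exists e1, None. split; [now left|]. rewrite gmul1g. now apply gg_eq.
  - destruct (classic (act f C = C)) as [F|F].
    + assert (E2 : ks ((tg C)^- ** x) = k).
      { rewrite tg_inv, ks_tg_mul, E. simpl. unfold same. destruct (decide (C = C)); tauto. }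
      destruct k as [|B k].
      * exists (tg C), None. split; [right; eauto|].
        apply (mul_left_inj GG ((tg C)^-)). rewrite inv_mul_cancel. apply gg_eq; auto.
        rewrite tg_inv. now rewrite pt_tg_mul.
      * exists (tg C), (Some B). split; [right; eauto|]. split; [|now rewrite E2].
        intro F'. pose proof (fixed_eq _ _ F F'). subst B.
        pose proof (ks_reduced x) as R. rewrite E in R. destruct R as [R _]. now apply R.
    + exists e1, (Some C). split; [now left|]. split; auto. rewrite inv_one, gmul1g, E. reflexivity.
Qed.

Lemma base_anchor p C x : base p (Some C) x -> index x = n (rep C).
Proof.
  intros [Hp [F E]]. unfold index.
  destruct Hp as [->|(C0 & F0 & ->)].
  - rewrite inv_one, gmul1g in E. destruct (ks x) as [|B k]; simpl in E; [discriminate|].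
    injection E as ->. simpl. destruct (decide (act f C = C)); tauto.
  - rewrite tg_inv, ks_tg_mul in E.
    destruct (ks x) as [|B k]; simpl in E; [congruence|]. unfold same in E.
    destruct (decide (B = C0)) as [->|N]; simpl in E; [|congruence].
    destruct k as [|B k]; simpl in E; [discriminate|]. injection E as ->.
    simpl. destruct (decide (act f C0 = C0)); [|tauto]. destruct (decide (act f C = C)); tauto.
Qed.

Lemma base_None p x : base p None x -> index x = n (pt x).
Proof.
  intros [[->|(C0 & F0 & ->)] E]; unfold index; rewrite E at 1.
  - now rewrite ks_mul_fr, ks_one.
  - rewrite ks_mul_fr. simpl. destruct (decide (act f C0 = C0)); tauto.
Qed.

Lemma base_gate p o x y : base p o x ->
  (forall C, o = Some C -> hd_error (ks (p^- ** y)) <> Some C) ->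
  exists c, (Z.abs (n c - index x) <= 8)%Z /\ D x (p ** fr c) + D (p ** fr c) y <= D x y.
Proof.
  intros Hb Ho. destruct o as [C|].
  - rewrite (base_anchor _ _ _ Hb). destruct Hb as [_ [F E]].
    destruct (gate_at p C x y E (Ho C eq_refl)) as (c & Hc & L). exists c. split; auto.
    apply (n_hull C); auto using mem_hull, rep_mem.
  - rewrite (base_None _ _ Hb). destruct Hb as [_ E]. exists (pt x). split; [lia|].
    rewrite <- E, D_refl. lia.
Qed.

(** If [f] fixes [C0], then [tg C0] commutes with the powers of [f], so the axes of [f] in the two
    sheets run at constant distance. As [C0] is unique, one bound serves for all [p]. *)
Lemma base_axis_dist : exists K, forall p o x m, base p o x ->
  D (p ** fr (zpow Fr f m)) (fr (zpow Fr f m)) <= K.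
Proof.
  destruct (classic (exists C0, act f C0 = C0)) as [[C0 F0]|N].
  - exists (D (tg C0) e1). intros p o x m [[->|(C & F & ->)] _].
    + rewrite gmul1g, D_refl. lia.
    + rewrite (fixed_eq C C0 F F0).
      rewrite <- (zpow_act I f C0 m F0) at 1. rewrite <- fr_tg.
      rewrite <- (gmulg1 GG (fr (zpow Fr f m))) at 2. rewrite D_left. lia.
  - exists 0. intros p o x m [[->|(C & F & _)] _].
    + rewrite gmul1g, D_refl. lia.
    + exfalso. eauto.
Qed.

Lemma base_head_fixed p o x p' o' x' c C : base p o x -> base p' o' x' -> act f C <> C ->
  hd_error (ks (p'^- ** (p ** fr c))) <> Some C.
Proof.
  intros [Hp _] [Hp' _] F E. rewrite gmulA, ks_mul_fr in E.
  assert (H : forall B, In B (ks (p'^- ** p)) -> act f B = B).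
  { destruct Hp as [->|(B1 & F1 & ->)], Hp' as [->|(B2 & F2 & ->)]; rewrite ?tg_inv, ?inv_one, ?gmul1g, ?gmulg1.
    - rewrite ks_one. easy.
    - intros B [<-|[]]; auto.
    - intros B [<-|[]]; auto.
    - rewrite (fixed_eq B1 B2 F1 F2), tg_tg, ks_one. easy. }
  destruct (ks (p'^- ** p)) as [|B k]; [discriminate|]. simpl in E. injection E as ->.
  apply F, H. now left.
Qed.

(** A path leaves near the anchor of [x] and arrives near that of [x'], at points over [c] and [c'].
    Folded to the tree of [Fr], the part between is at least as long as the way from [c] to [c'],
    which runs through the axis; [K] pays for changing to the sheet of the identity. *)
Lemma elliptic_axis : exists R J, axis_data hull_step (fr f) index R J.
Proof.
  destruct base_axis_dist as [K HK].
  exists (Z.of_nat (20 + 2 * K)), 36%Z. split; [|split].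
  - intros x j. rewrite <- fr_pow. unfold index. rewrite ks_fr_mul, pt_mul.
    pose proof (anchor_pow j (ks x) (pt x)). change (pt (fr (zpow Fr f j))) with (zpow Fr f j). lia.
  - intros x x' m Hm. rewrite <- fr_pow.
    destruct (base_ex x) as (p & o & Hb), (base_ex x') as (p' & o' & Hb').
    destruct (base_gate p o x x' Hb) as (c & Hc & L1).
    { intros C -> E.
      assert (Hb2 : base p (Some C) x') by (destruct Hb as [Hp [F _]]; repeat split; auto).
      apply base_anchor in Hb, Hb2. lia. }
    destruct (base_gate p' o' x' (p ** fr c) Hb') as (c' & Hc' & L2).
    { intros C ->. apply (base_head_fixed p o x p' (Some C) x'); auto. apply Hb'. }
    rewrite (D_sym x' (p ** fr c)), (D_sym (p' ** fr c') (p ** fr c)) in L2.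
    pose proof (n_path c c' m ltac:(lia)) as P. red in P.
    pose proof (HK p o x m Hb). pose proof (HK p' o' x' m Hb').
    set (am := zpow Fr f m) in *.
    pose proof (D_tri x (p ** fr c) (fr am)). pose proof (D_tri (p ** fr c) (p ** fr am) (fr am)).
    rewrite D_fr in *.
    pose proof (D_tri (fr am) (p' ** fr c') x'). pose proof (D_tri (fr am) (p' ** fr am) (p' ** fr c')).
    rewrite D_fr in *.
    rewrite (D_sym (p' ** fr am) (fr am)) in *.
    pose proof (D_ge_fd (p ** fr c) (p' ** fr c')) as DD.
    assert (E1 : pt (p ** fr c) = c).
    { destruct Hb as [[->|(C & _ & ->)] _]; [now rewrite gmul1g|now rewrite pt_tg_mul]. }
    assert (E2 : pt (p' ** fr c') = c').
    { destruct Hb' as [[->|(C & _ & ->)] _]; [now rewrite gmul1g|now rewrite pt_tg_mul]. }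
    rewrite E1, E2 in DD. rewrite (D_sym x' (p' ** fr c')) in L2. lia.
  - intros x t Ht. now apply index_step.
Qed.

End Elliptic.
(** ** Quasi-trees *)

Definition separating (T : GG -> Prop) (x y p : GG) : Prop :=
  p = x \/ p = y \/ exists V : GG -> Prop, ~ V x /\ V y /\
    forall z z', T (z^- ** z') -> ~ V z -> V z' -> T (z^- ** p).

(** The chain crosses the cosets of [y] one at a time. The separating set at [p] consists of the
    points beyond the next coset: a step across at most two cosets changes the first coset seen from
    [p] only if it starts at most two cosets away from [p]. *)
Lemma sheet_chain y :
  chain (fun p q => length (ks (p^- ** q)) <= 1) (separating near_sheet e1 y) e1 y.
Proof.
  assert (H : forall k C p, ks (p^- ** y) = C :: k -> hd_error (ks (p^-)) <> Some C ->
    chain (fun p q => length (ks (p^- ** q)) <= 1) (separating near_sheet e1 y) p y).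
  { induction k as [|B k IH]; intros C p E Hp;
    (assert (Sp : separating near_sheet e1 y p);
     [right; right; exists (fun z => hd_error (ks (p^- ** z)) = Some C);
      rewrite gmulg1, E; split; [auto|split; [reflexivity|]];
      intros z z' Ht Hz Hz'; unfold near_sheet in *;
      rewrite <- ks_inv_length; replace ((z^- ** p)^-) with (p^- ** z) by group;
      apply Nat.nlt_ge; intro L; apply Hz; rewrite <- Hz';
      replace (p^- ** z') with ((p^- ** z) ** (z^- ** z')) by group;
      rewrite (ks_mul (p^- ** z)); symmetry; apply hd_wmul; try apply sameK; try apply reduced_map_act;
      try apply ks_reduced; rewrite length_map; lia|]).
    - apply chain_cons with y; auto; [rewrite E; simpl; lia|]. constructor. right. now left.
    - apply chain_cons with (p ** tg C); auto.
      + rewrite inv_mul_cancel. simpl. lia.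
      + pose proof (ks_reduced (p^- ** y)) as R. rewrite E in R. destruct R as [R _]. unfold same in R.
        apply IH with B.
        * rewrite inv_mul, tg_inv, mul_assoc, ks_tg_mul, E. simpl. unfold same.
          destruct (decide (C = C)); tauto.
        * rewrite inv_mul, tg_inv, ks_tg_mul. destruct (ks (p^-)) as [|C' k']; simpl in *; [congruence|].
          unfold same. destruct (decide (C' = C)); simpl; congruence. }
  assert (S0 : separating near_sheet e1 y e1) by now left.
  destruct (ks y) as [|C k] eqn:E.
  - apply chain_cons with y; auto.
    + rewrite inv_one, gmul1g, E. simpl. lia.
    + constructor. right. now left.
  - apply H with k C; [now rewrite inv_one, gmul1g|]. rewrite inv_one. discriminate.
Qed.

Lemma sheet_stab_mul a b : sheet_stab a -> sheet_stab b -> sheet_stab (a ** b).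
Proof.
  intros [A1 A2] [B1 B2]. split; [rewrite pt_mul, A1, B1; group|].
  intros C H. rewrite ks_mul in H. apply in_wmul in H. destruct H as [H|H]; auto.
  apply in_map_iff in H. destruct H as (B & <- & H). rewrite A1, act_one. auto.
Qed.

Lemma sheet_stab_inv a : sheet_stab a -> sheet_stab (a^-).
Proof.
  intros [A1 A2]. split; [rewrite pt_inv, A1; group|].
  intros C H. rewrite ks_inv in H. apply in_map_iff in H. destruct H as (B & <- & H).
  apply in_rev in H. rewrite A1, inv_one, act_one. auto.
Qed.

Lemma sheet_stab_one : sheet_stab e1.
Proof. split; [reflexivity|]. intros C H. now rewrite ks_one in H. Qed.

Lemma sheet_stab_tg C : hull C e1 -> sheet_stab (tg C).
Proof. intro H. split; [reflexivity|]. now intros B [<-|[]]. Qed.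

Lemma sheet_stab_tau : sheet_stab tau.
Proof. apply sheet_stab_tg, mem_hull, mem_coset_self. Qed.

Lemma hull_step_inv t : hull_step t -> hull_step (t^-).
Proof.
  intros (a & s & b & Ha & Hs & Hb & ->). exists (b^-), (s^-), (a^-).
  repeat split; try (apply sheet_stab_inv; assumption).
  - now rewrite flen_inv.
  - rewrite fr_inv. group.
Qed.

Lemma hull_step_stab_l a t : sheet_stab a -> hull_step t -> hull_step (a ** t).
Proof.
  intros Ha (a' & s & b & Ha' & Hs & Hb & ->). exists (a ** a'), s, b.
  split; [now apply sheet_stab_mul|]. repeat split; auto; try apply Hb. group.
Qed.

Lemma hull_step_stab_r a t : sheet_stab a -> hull_step t -> hull_step (t ** a).
Proof.
  intros Ha (a' & s & b & Ha' & Hs & Hb & ->). exists a', s, (b ** a).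
  split; [auto|]. split; [auto|]. split; [now apply sheet_stab_mul|]. group.
Qed.

Lemma hull_step_fr s : flen s <= 1 -> hull_step (fr s).
Proof.
  intro H. exists e1, s, e1. split; [apply sheet_stab_one|]. split; auto.
  split; [apply sheet_stab_one|]. group.
Qed.

Lemma hull_step_stab a : sheet_stab a -> hull_step a.
Proof.
  intro H. rewrite <- (gmulg1 GG a). apply hull_step_stab_l; auto.
  rewrite <- fr_one. apply hull_step_fr. unfold flen. simpl. lia.
Qed.

Definition hull_edge (C : Q) (a : letter) : Prop := hull C e1 /\ hull C (of_letter a).

(** The side of the edge [a] at the base point on which the point [g] of the sheet [k] lies, when
    adjacent sheets are glued along the whole hulls of cosets: the first coset whose hull misses the edge
    decides. *)
Fixpoint side (a : letter) (k : list Q) (g : Fr) : Prop :=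
  match k with
  | [] => fhd g = Some a
  | C :: k' => if decide (hull_edge C a) then side a k' g else exists c, mem C c /\ fhd c = Some a
  end.

Lemma on_path_letter x y a : fhd x <> Some a -> fhd y = Some a -> on_path x (of_letter a) y.
Proof.
  intros Hx Hy. apply (on_path_left ((of_letter a)^-)). rewrite gmulVg. apply on_path_hd.
  apply fhd_step_back in Hx. rewrite Hx. intro E. symmetry in E. now apply fhd_step_back in E.
Qed.

(** Hulls are convex, so a hull with points on both sides of the edge would contain it. *)
Lemma side_hull C a h h' : ~ hull_edge C a -> hull C h -> hull C h' -> fhd h = Some a -> fhd h' = Some a.
Proof.
  intros N H H' E. apply NNPP. intro E'. apply N. split.
  - apply (hull_convex I C h' _ h); auto. apply on_path_hd. congruence.
  - apply (hull_convex I C h' _ h); auto. now apply on_path_letter.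
Qed.

Lemma side_snoc a k C g : hull C g -> (side a (k ++ [C]) g <-> side a k g).
Proof.
  intro H. induction k as [|B k IH]; simpl.
  - destruct (decide (hull_edge C a)) as [|N]; [tauto|]. split.
    + intros (c & Hc & E). apply (side_hull C a c g N); auto. now apply mem_hull.
    + intro E. destruct (coset_nonempty I C) as [c Hc]. exists c. split; auto.
      apply (side_hull C a g c N); auto. now apply mem_hull.
  - destruct (decide (hull_edge B a)); [auto|tauto].
Qed.

Lemma side_toggles a l k g : reduced same k -> reduced same l -> (forall C, In C l -> hull C g) ->
  (side a (wmul same k l) g <-> side a k g).
Proof.
  revert k. induction l as [|C l IH]; intros k Rk Rl Hl.
  - rewrite wmul_nil_r by auto. tauto.
  - assert (E : wmul same k (C :: l) = wmul same (wmul same k [C]) l).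
    { rewrite wmul_assoc; [|apply sameK|now apply reduced_tail in Rl].
      f_equal. symmetry. now apply push_cons. }
    rewrite E, IH; [|now apply reduced_wmul|now apply reduced_tail in Rl|intros; apply Hl; now right].
    assert (HC : hull C g) by (apply Hl; now left).
    destruct (wmul_snoc k C Rk) as [(k' & -> & E')|E']; rewrite E'; [symmetry|]; now apply side_snoc.
Qed.

Definition gside (a : letter) (x : GG) : Prop := side a (ks x) (pt x).

Lemma gside_stab a x b : sheet_stab b -> (gside a (x ** b) <-> gside a x).
Proof.
  intro Hb. destruct (sheet_stab_toggles x b Hb) as (E1 & E2 & R & H). unfold gside.
  rewrite E1, E2. apply side_toggles; auto. apply ks_reduced.
Qed.

(** The half-spaces of an edge seen from its two ends are complementary; in [hull_walk] this
    excludes turning back. *)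
Lemma side_flip a k g : side (linv a) (map (act ((of_letter a)^-)) k) ((of_letter a)^- ** g) <-> ~ side a k g.
Proof.
  induction k as [|C k IH]; simpl.
  - apply fhd_step_back.
  - assert (E : hull_edge (act ((of_letter a)^-) C) (linv a) <-> hull_edge C a).
    { unfold hull_edge. rewrite <- (of_letter_inv a). rewrite <- (gmulg1 Fr ((of_letter a)^-)) at 3.
      rewrite <- (gmulVg Fr (of_letter a)). rewrite !hull_act_iff. tauto. }
    destruct (decide (hull_edge (act _ C) (linv a))) as [F|F], (decide (hull_edge C a)) as [F'|F'];
      try tauto.
    split.
    + intros (c & Hc & Ec) (c' & Hc' & Ec').
      assert (Hc2 : mem C (of_letter a ** c)) by (rewrite <- (inv_inv Fr (of_letter a)); exact Hc).
      assert (Ec2 : fhd (of_letter a ** c) = Some a).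
      { apply (side_hull C a c'); auto using mem_hull. }
      rewrite <- (inv_mul_cancel Fr (of_letter a) c) in Ec. now apply fhd_step_back in Ec.
    + intro N. destruct (coset_nonempty I C) as [c Hc]. exists ((of_letter a)^- ** c).
      split; [now apply mem_act_mul|]. apply fhd_step_back. intro Ec. eauto.
Qed.

Lemma side_unique a b k g : side a k g -> side b k g -> a = b.
Proof.
  induction k as [|C k IH]; simpl; [congruence|].
  destruct (decide (hull_edge C a)) as [A|A], (decide (hull_edge C b)) as [B|B]; auto.
  - intros _ (c & Hc & E). apply (side_hull C b c e1 B) in E; [|now apply mem_hull|apply A]. discriminate.
  - intros (c & Hc & E) _. apply (side_hull C a c e1 A) in E; [|now apply mem_hull|apply B]. discriminate.
  - intros (c & Hc & E) (c' & Hc' & E'). apply (side_hull C a c c') in E; auto using mem_hull. congruence.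
Qed.

Lemma side_letter a k g s : flen s <= 1 -> ~ side a k g -> side a k (g ** s) ->
  g = e1 /\ forall C, In C k -> hull C e1.
Proof.
  intros Hs. induction k as [|C k IH]; simpl.
  - intros N E. split; [|easy].
    assert (L : fd g (g ** s) = flen g + flen (g ** s)) by (apply fd_hd; congruence).
    rewrite <- (gmulg1 Fr g) in L at 1. rewrite fd_left, fd_one in L.
    assert (1 <= flen (g ** s)).
    { apply flen_pos. intro X. rewrite X in E. discriminate. }
    apply flen_0. lia.
  - destruct (decide (hull_edge C a)) as [A|A]; [|tauto].
    intros N E. destruct (IH N E) as [Eg H]. split; auto. intros B [<-|HB]; auto. apply A.
Qed.

(** Only the letter of the step can change the side, and by [side_letter] only if it starts at the
    base vertex of the glued tree; so [z] stabilises that vertex. *)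
Lemma hull_crossing a z z' : hull_step (z^- ** z') -> ~ gside a z -> gside a z' -> hull_step (z^-).
Proof.
  intros (b1 & s & b2 & H1 & Hs & H2 & E) N Y.
  assert (Ez : z' = z ** b1 ** fr s ** b2).
  { rewrite !mul_assoc in *. rewrite <- E. group. }
  rewrite Ez, gside_stab in Y by auto. rewrite <- (gside_stab a z b1) in N by auto.
  unfold gside in N, Y. rewrite ks_mul_fr, pt_mul in Y.
  destruct (side_letter a _ _ s Hs N Y) as [E1 E2].
  apply hull_step_inv.
  replace z with ((z ** b1) ** b1^-) by group. apply hull_step_stab.
  apply sheet_stab_mul; [split; auto|now apply sheet_stab_inv].
Qed.

Definition target (k : list Q) (g x : Fr) : Prop :=
  match k with [] => x = g | C :: _ => hull C x end.

Lemma target_side k g a x : ~ target k g e1 -> target k g x -> fhd x = Some a ->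
  side a k g /\ forall x', target k g x' -> fhd x' = Some a.
Proof.
  destruct k as [|C k]; simpl; intros N H E; [subst; split; congruence|].
  assert (F : ~ hull_edge C a) by (intro F; apply N, F).
  destruct (decide (hull_edge C a)); [tauto|]. destruct (coset_nonempty I C) as [c Hc]. split.
  - exists c. split; auto. apply (side_hull C a x c F); auto. now apply mem_hull.
  - intros x' H'. apply (side_hull C a x x' F); auto.
Qed.

(** The geodesic in the tree obtained by gluing sheets along hulls, followed from [p] on:
    walk towards the next coset, and switch sheets as soon as its hull is reached.  The starting point
    is never ahead. *)
Lemma hull_walk y : forall N r p p0 k, separating hull_step e1 y p0 ->
  (exists s b, flen s <= 1 /\ sheet_stab b /\ p = p0 ** fr s ** b) ->
  ks (p^- ** y) = k -> length k = N ->
  (exists x, target k (pt (p^- ** y)) x /\ flen x <= r) ->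
  (forall C, hd_error k = Some C -> hd_error (ks (p^-)) <> Some C) ->
  (forall a x, target k (pt (p^- ** y)) x -> fhd x = Some a -> ~ gside a (p^-)) ->
  chain (fun p q => hull_step (p^- ** q)) (separating hull_step e1 y) p0 y.
Proof.
  (* Sheet switches at a vertex are collected in [b] while [p0] stays, since a point reached by a
     switch need not be separating; [p] joins the chain when a letter leads on or the end is
     reached. *)
  induction N as [N IHN] using lt_wf_ind.
  induction r as [r IHr] using lt_wf_ind.
  intros p p0 k Sp0 (s & b & Hs & Hb & Ep) Ek EN (x & Hx & Lx) Hk HJ.
  assert (Hp0 : hull_step (p0^- ** p)).
  { rewrite Ep, mul_assoc, inv_mul_cancel. apply hull_step_stab_r; auto. now apply hull_step_fr. }
  set (g := pt (p^- ** y)) in *.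
  (* At the target the sheet is switched and [N] drops. Otherwise the walk follows the first letter
     [a] towards the target, [r] drops, and the side of [a] separates. *)
  destruct (classic (target k g e1)) as [T1|T1].
  - destruct k as [|C k]; simpl in T1.
    + assert (E : p = y).
      { apply (mul_left_inj GG (p^-)). rewrite gmulVg. symmetry. now apply gg_eq. }
      subst y. apply chain_cons with p; auto. constructor. right. now left.
    + destruct (coset_nonempty I C) as [c Hc].
      assert (Ek' : ks ((p ** tg C)^- ** y) = k).
      { rewrite inv_mul, tg_inv, mul_assoc, ks_tg_mul, Ek. simpl. unfold same.
        destruct (decide (C = C)); tauto. }
      assert (Ei : ks ((p ** tg C)^-) = C :: ks (p^-)).
      { rewrite inv_mul, tg_inv, ks_tg_mul. specialize (Hk C eq_refl).
        destruct (ks (p^-)) as [|C' k']; auto. simpl in *. unfold same.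
        destruct (decide (C' = C)); congruence. }
      assert (exists x, target k (pt ((p ** tg C)^- ** y)) x) as [x' Hx'].
      { destruct k as [|B k]; [eexists; reflexivity|]. destruct (coset_nonempty I B) as [c' Hc'].
        exists c'. now apply mem_hull. }
      apply (IHN (length k)) with (r := flen x') (p := p ** tg C) (k := k); auto.
      * simpl in EN. lia.
      * exists s, (b ** tg C). split; [auto|]. split.
        -- apply sheet_stab_mul; auto. now apply sheet_stab_tg.
        -- rewrite Ep. group.
      * eauto.
      * intros B HB E. rewrite Ei in E. simpl in E. injection E as <-.
        pose proof (ks_reduced (p^- ** y)) as R. rewrite Ek in R.
        destruct k as [|B' k]; [discriminate|]. simpl in HB. injection HB as ->. destruct R as [R _]. now apply R.
      * intros a z _ _ X. unfold gside in X. rewrite Ei in X.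
        assert (Ept : pt ((p ** tg C)^-) = pt (p^-)) by (rewrite inv_mul, tg_inv, pt_tg_mul; reflexivity).
        rewrite Ept in X. simpl in X.
        destruct (decide (hull_edge C a)) as [F|F].
        -- apply (HJ a (of_letter a)); [apply F|reflexivity|exact X].
        -- destruct X as (c' & Hc' & E). apply (side_hull C a c' e1 F) in E; auto; [discriminate|].
           now apply mem_hull.
  - destruct (fhd x) as [a|] eqn:Ea.
    2:{ apply fhd_None in Ea. subst. contradiction. }
    destruct (target_side k g a x T1 Hx Ea) as [Sa Ta].
    assert (Na : ~ gside a (p^-)) by eauto.
    assert (Sp : separating hull_step e1 y p).
    { right; right. exists (fun z => gside a (p^- ** z)). rewrite gmulg1. split; [auto|]. split.
      - unfold gside. now rewrite Ek.
      - intros z z' Ht Hz Hz'. replace (z^- ** p) with ((p^- ** z)^-) by group.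
        apply (hull_crossing a _ (p^- ** z')); auto.
        now replace ((p^- ** z)^- ** (p^- ** z')) with (z^- ** z') by group. }
    apply chain_cons with p; auto.
    assert (Ey : (p ** fr (of_letter a))^- ** y = fr ((of_letter a)^-) ** (p^- ** y)).
    { rewrite fr_inv. group. }
    assert (Ei : (p ** fr (of_letter a))^- = fr ((of_letter a)^-) ** p^-).
    { rewrite fr_inv. group. }
    assert (Tg : forall z, target (map (act ((of_letter a)^-)) k) ((of_letter a)^- ** g) ((of_letter a)^- ** z) <-> target k g z).
    { intro z. destruct k as [|C k]; simpl; [|apply hull_act_iff]. split; [apply (mul_left_inj Fr)|congruence]. }
    assert (Lx' : flen ((of_letter a)^- ** x) < r).
    { unfold flen in *. rewrite wd_mul, of_letter_inv. unfold fhd in Ea. destruct (wd x) as [|a' w]; [discriminate|].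
      injection Ea as ->. simpl. destruct (decide (a = linv (linv a))) as [_|Na']; [simpl in Lx; lia|].
      now rewrite linvK in Na'. }
    remember (map (act ((of_letter a)^-)) k) as k' eqn:Ek'.
    assert (Main : (exists s b, flen s <= 1 /\ sheet_stab b /\ p ** fr (of_letter a) = p ** fr s ** b) /\
      ks ((p ** fr (of_letter a))^- ** y) = k' /\
      (exists z, target k' (pt ((p ** fr (of_letter a))^- ** y)) z /\ flen z <= flen ((of_letter a)^- ** x)) /\
      (forall C, hd_error k' = Some C -> hd_error (ks ((p ** fr (of_letter a))^-)) <> Some C) /\
      (forall a' z, target k' (pt ((p ** fr (of_letter a))^- ** y)) z -> fhd z = Some a' ->
         ~ gside a' ((p ** fr (of_letter a))^-))).
    { rewrite Ey, Ei, ks_fr_mul, ks_fr_mul, Ek, pt_mul. fold g.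
      change (pt (fr ((of_letter a)^-))) with ((of_letter a)^-).
      split; [|split; [|split; [|split]]].
      - exists (of_letter a), e1. split; [unfold flen; simpl; lia|]. split; [apply sheet_stab_one|]. group.
      - auto.
      - exists ((of_letter a)^- ** x). split; auto. now apply Tg.
      - intros C HC E. subst k'. destruct k as [|B k]; [discriminate|]. simpl in HC. injection HC as <-.
        apply (Hk B); auto. destruct (ks (p^-)) as [|B' l]; simpl in *; [discriminate|].
        assert (E' : act ((of_letter a)^-) B' = act ((of_letter a)^-) B) by congruence.
        apply act_inj in E'. congruence.
      - intros a' z Hz Ez X.
        assert (Hz' : target k g (of_letter a ** z)) by (apply Tg; now rewrite inv_mul_cancel).
        assert (F : gside (linv a) (fr ((of_letter a)^-) ** p^-)).
        { unfold gside. rewrite ks_fr_mul, pt_mul. apply side_flip. exact Na. }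
        pose proof (side_unique _ _ _ _ X F). subst a'.
        apply Ta in Hz'. rewrite <- (inv_mul_cancel Fr (of_letter a) z) in Ez.
        now apply fhd_step_back in Ez. }
    destruct Main as (M1 & M2 & M3 & M4 & M5).
    apply (IHr _ Lx' (p ** fr (of_letter a)) p k'); auto. rewrite Ek', length_map. exact EN.
Qed.

Lemma hull_chain y :
  chain (fun p q => hull_step (p^- ** q)) (separating hull_step e1 y) e1 y.
Proof.
  assert (H : exists x, target (ks (e1^- ** y)) (pt (e1^- ** y)) x).
  { destruct (ks (e1^- ** y)) as [|C k]; [eexists; reflexivity|].
    destruct (coset_nonempty I C) as [c Hc]. exists c. now apply mem_hull. }
  destruct H as [x Hx].
  apply (hull_walk y (length (ks (e1^- ** y))) (flen x) e1 e1 (ks (e1^- ** y))); eauto.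
  - now left.
  - exists e1, e1. split; [unfold flen; simpl; lia|]. split; [apply sheet_stab_one|]. rewrite fr_one. group.
  - intros C _. rewrite inv_one. discriminate.
  - intros a z _ _. rewrite inv_one. discriminate.
Qed.
(** ** Cyclically reduced forms *)

Lemma free_conj_cyc_reduced g : g <> e1 -> exists h f : Fr, g = h ** f ** h^- /\ cyc_reduced f.
Proof.
  remember (flen g) as N eqn:EN. revert g EN. induction N as [N IH] using lt_wf_ind. intros g EN Hg.
  destruct (classic (fhd g = fhd (g^-))) as [E|E].
  2:{ exists e1, g. split; [group|]. now split. }
  destruct (fhd g) as [a|] eqn:Ea; [|now apply fhd_None in Ea].
  assert (Hd : forall u, fhd u = Some a -> flen ((of_letter a)^- ** u) = flen u - 1).
  { intros u Hu. unfold flen, fhd in *. rewrite wd_mul, of_letter_inv.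
    destruct (wd u) as [|b w]; [discriminate|]. injection Hu as ->. simpl.
    destruct (decide (a = linv (linv a))) as [_|X]; [lia|now rewrite linvK in X]. }
  set (y := (of_letter a)^- ** g).
  assert (Hy : fhd (y^-) = Some a).
  { unfold y. rewrite inv_mul, inv_inv. unfold fhd. rewrite wd_mul, hd_wmul; auto using linvK, wd_reduced.
    change (1 < flen (g^-)). rewrite flen_inv. apply Nat.nle_gt. intro L.
    unfold flen, fhd in *. rewrite wd_inv in E.
    destruct (wd g) as [|b [|c w]]; simpl in *; [discriminate| |lia].
    injection Ea as ->. injection E as E. now apply (linv_neq a). }
  assert (L : flen (y ** of_letter a) < N).
  { rewrite <- (flen_inv (y ** of_letter a)), inv_mul, Hd, flen_inv by auto.
    unfold y. rewrite (Hd g Ea). assert (flen g <> 0); [|lia]. intro X. apply flen_0 in X. auto. }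
  destruct (IH _ L (y ** of_letter a) eq_refl) as (h & f & Eh & Hf).
  - intro X. apply Hg. replace g with (of_letter a ** (y ** of_letter a) ** (of_letter a)^-) by (unfold y; group).
    rewrite X. group.
  - exists (of_letter a ** h), f. split; auto.
    replace g with (of_letter a ** (y ** of_letter a) ** (of_letter a)^-) by (unfold y; group).
    rewrite Eh. group.
Qed.

Definition even_sheet (x : GG) : Prop := Nat.even (length (ks x)) = true.

Lemma even_mul x y : Nat.even (length (ks (x ** y))) =
  Bool.eqb (Nat.even (length (ks x))) (Nat.even (length (ks y))).
Proof. now rewrite ks_mul, wmul_parity, length_map. Qed.

Lemma conj_cyc_reduced x : even_sheet x -> x <> e1 -> exists h phi, x = h ** phi ** h^- /\
  ((exists f, cyc_reduced f /\ phi = fr f) \/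
   (ks phi <> [] /\ hd_error (ks phi) <> hd_error (ks (phi^-)))).
Proof.
  remember (length (ks x)) as N eqn:EN. revert x EN. induction N as [N IH] using lt_wf_ind.
  intros x EN Ev Hx. red in Ev.
  destruct (ks x) as [|C k] eqn:Ek.
  { assert (Ex : x = fr (pt x)) by now apply gg_eq.
    destruct (free_conj_cyc_reduced (pt x)) as (h & f & E & Hf).
    { intro X. apply Hx. now rewrite Ex, X. }
    exists (fr h), (fr f). split; [|left; eauto]. rewrite Ex, E. now rewrite !fr_mul, fr_inv. }
  destruct (classic (hd_error (ks (x^-)) = Some C)) as [E|E].
  2:{ exists e1, x. split; [group|]. right. rewrite Ek. split; [discriminate|]. simpl. congruence. }
  assert (Hd : forall u, hd_error (ks u) = Some C -> length (ks (tg C ** u)) = length (ks u) - 1).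
  { intros u Hu. rewrite ks_tg_mul. destruct (ks u) as [|B l]; [discriminate|]. injection Hu as ->.
    simpl. unfold same. destruct (decide (C = C)); [lia|tauto]. }
  (* Evenness excludes a single coset, as in the involution [tau], which has no axis. *)
  assert (L2 : 2 <= length (C :: k)) by (destruct k; [discriminate|simpl; lia]).
  set (y := tg C ** x).
  assert (Hy : hd_error (ks (y^-)) = Some C).
  { unfold y. rewrite inv_mul, tg_inv, ks_mul_tg, hd_wmul; auto using ks_reduced, sameK.
    - simpl; auto.
    - rewrite ks_inv_length, Ek. simpl in *. lia. }
  assert (EL : length (ks (y ** tg C)) = N - 2).
  { rewrite <- ks_inv_length, inv_mul, tg_inv, Hd, ks_inv_length by auto.
    unfold y. rewrite (Hd x) by now rewrite Ek. rewrite Ek. lia. }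
  destruct (IH (N - 2) ltac:(lia) (y ** tg C) (eq_sym EL)) as (h & phi & Eh & Hphi).
  - red. rewrite EL. rewrite EN. rewrite <- Ev. destruct k as [|B k]; [simpl in L2; lia|].
    simpl. now rewrite Nat.sub_0_r.
  - intro X. apply Hx. replace x with (tg C ** (y ** tg C) ** tg C).
    + rewrite X, gmulg1. apply tg_tg.
    + unfold y. rewrite !mul_assoc, tg_tg, gmulg1, <- mul_assoc, tg_tg. group.
  - exists (tg C ** h), phi. split; auto.
    replace x with (tg C ** (y ** tg C) ** tg C).
    + rewrite Eh, inv_mul, tg_inv. group.
    + unfold y. rewrite !mul_assoc, tg_tg, gmulg1, <- mul_assoc, tg_tg. group.
Qed.

(** ** The double, as the subgroup of even elements *)

Lemma even_sheet_mul x y : even_sheet x -> even_sheet y -> even_sheet (x ** y).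
Proof. unfold even_sheet. intros E1 E2. now rewrite even_mul, E1, E2. Qed.

Lemma even_sheet_inv x : even_sheet x -> even_sheet (x^-).
Proof. unfold even_sheet. now rewrite ks_inv_length. Qed.

Lemma dbl_eq (x y : {x : GG | even_sheet x}) : proj1_sig x = proj1_sig y -> x = y.
Proof.
  destruct x as [x Hx], y as [y Hy]; simpl. intros <-. f_equal. apply proof_irrelevance.
Qed.

Definition Dbl : Group.
Proof.
  refine {| carrier := {x : GG | even_sheet x};
            gmul x y := exist _ (proj1_sig x ** proj1_sig y) (even_sheet_mul _ _ (proj2_sig x) (proj2_sig y));
            gone := exist _ e1 eq_refl;
            ginv x := exist _ ((proj1_sig x)^-) (even_sheet_inv _ (proj2_sig x)) |};
    intros; apply dbl_eq; simpl; group.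
Defined.

Definition val (x : Dbl) : GG := proj1_sig x.

Lemma val_mul x y : val (x ** y) = val x ** val y.
Proof. reflexivity. Qed.
Lemma val_inv x : val (x^-) = (val x)^-.
Proof. reflexivity. Qed.
Lemma val_even x : even_sheet (val x).
Proof. exact (proj2_sig x). Qed.
Lemma val_inj x y : val x = val y -> x = y.
Proof. apply dbl_eq. Qed.

Lemma val_pow x j : val (zpow Dbl x j) = zpow GG (val x) j.
Proof.
  assert (H : forall n, val (npow Dbl x n) = npow GG (val x) n).
  { induction n as [|n IH]; auto. change (npow Dbl x (S n)) with (x ** npow Dbl x n).
    now rewrite val_mul, IH. }
  destruct j; unfold zpow; auto. now rewrite val_inv, H.
Qed.

Lemma even_tau x : even_sheet (x ** tau) <-> ~ even_sheet x.
Proof.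
  unfold even_sheet. rewrite even_mul. change (Nat.even (length (ks tau))) with false.
  destruct (Nat.even (length (ks x))); simpl; split; intros; congruence.
Qed.

Lemma hat_even x : even_sheet (if decide (even_sheet x) then x else x ** tau).
Proof. destruct (decide (even_sheet x)); auto. now apply even_tau. Qed.

(** [x] and [x ** tau] are at distance 0 and exactly one of them is even; picking that one preserves
    distances. *)
Definition hat (x : GG) : Dbl := exist _ (if decide (even_sheet x) then x else x ** tau) (hat_even x).

Lemma hat_val x : hat (val x) = x.
Proof.
  apply val_inj. simpl. destruct (decide (even_sheet (val x))) as [|N]; auto.
  exfalso. apply N, val_even.
Qed.

Lemma hat_cases x : (even_sheet x /\ val (hat x) = x) \/ (~ even_sheet x /\ val (hat x) = x ** tau).
Proof. unfold hat, val; simpl. destruct (decide (even_sheet x)); auto. Qed.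

Lemma hat_tau x : hat (x ** tau) = hat x.
Proof.
  apply val_inj. destruct (hat_cases x) as [[E1 E2]|[E1 E2]], (hat_cases (x ** tau)) as [[E3 E4]|[E3 E4]];
    rewrite E2, E4; try (rewrite even_tau in E3; tauto); auto.
  unfold tau. rewrite mul_assoc, tg_tg. group.
Qed.

Lemma fr_even f : even_sheet (fr f).
Proof. reflexivity. Qed.

Lemma fr_even_mul x f : even_sheet (x ** fr f) <-> even_sheet x.
Proof. unfold even_sheet. now rewrite ks_mul_fr. Qed.

Lemma primed_even f : even_sheet (tau ** fr f ** tau).
Proof. apply even_tau. rewrite fr_even_mul. discriminate. Qed.

Definition factor (b : bool) (f : Fr) : Dbl :=
  if b then exist _ (fr f) (fr_even f) else exist _ (tau ** fr f ** tau) (primed_even f).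

Lemma val_factor b f : val (factor b f) = if b then fr f else tau ** fr f ** tau.
Proof. now destruct b. Qed.

Lemma tau_tau x : tau ** (tau ** x) = x.
Proof. unfold tau. rewrite <- mul_assoc, tg_tg. group. Qed.

Lemma tau_inv : tau^- = tau.
Proof. apply tg_inv. Qed.

Lemma factor_mul b f h : factor b (f ** h) = factor b f ** factor b h.
Proof.
  apply val_inj. rewrite val_mul, !val_factor, fr_mul. destruct b; auto.
  rewrite !mul_assoc, tau_tau. reflexivity.
Qed.

Lemma factor_inv b f : factor b (f^-) = (factor b f)^-.
Proof.
  apply val_inj. rewrite val_inv, !val_factor, fr_inv. destruct b; auto.
  rewrite !inv_mul, tau_inv. group.
Qed.

Definition basis : list gen := [La; Lb; Lc; Ld].

Definition gens : list Dbl :=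
  map (fun x => factor true (of_letter (x, true))) basis ++
  map (fun x => factor false (of_letter (x, true))) basis.

Lemma in_gens s : In s gens <-> exists b x, s = factor b (of_letter (x, true)).
Proof.
  unfold gens. rewrite in_app_iff, !in_map_iff. split.
  - intros [(x & <- & _)|(x & <- & _)]; eauto.
  - assert (H : forall x, In x basis) by (intros []; simpl; auto).
    intros ([] & x & ->); eauto.
Qed.

Lemma dist_le_snoc x y n b l : dist_le gens x y n -> dist_le gens x (y ** factor b (of_letter l)) (S n).
Proof.
  intros (w & H1 & H2 & H3). destruct l as [x0 s].
  exists (w ++ [(factor b (of_letter (x0, true)), s)]).
  rewrite Forall_app, length_app, walk_app, H3. repeat split; auto.
  - constructor; auto. simpl. apply in_gens. eauto.
  - change (length w + 1 <= S n). lia.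
  - simpl. unfold step; simpl. destruct s; auto. now rewrite <- factor_inv, of_letter_inv.
Qed.

(** A letter read at an even point is a generator of the first factor or its inverse, at an odd
    point one of the second, and toggles disappear. *)
Lemma reach_hat x y n : reach (val x) y n -> dist_le gens x (hat y) n.
Proof.
  intro H. induction H as [|y n l H IH|y n H IH|y n H IH].
  - rewrite hat_val. exists []. simpl. auto.
  - assert (E : exists b, hat (y ** fr (of_letter l)) = hat y ** factor b (of_letter l)).
    { destruct (hat_cases y) as [[E1 E2]|[E1 E2]], (hat_cases (y ** fr (of_letter l))) as [[E3 E4]|[E3 E4]];
        rewrite fr_even_mul in E3; try tauto.
      - exists true. apply val_inj. now rewrite E4, val_mul, E2.
      - exists false. apply val_inj. rewrite E4, val_mul, E2, val_factor.
        rewrite !mul_assoc, tau_tau. reflexivity. }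
    destruct E as [b ->]. now apply dist_le_snoc.
  - now rewrite hat_tau.
  - eapply dist_le_mono; eauto.
Qed.

Lemma reach_factor x b l : reach x (x ** val (factor b (of_letter l))) 1.
Proof.
  rewrite val_factor. destruct b; [apply reach_letter, reach_refl|].
  rewrite !gmulA. apply reach_tau, reach_letter, reach_tau, reach_refl.
Qed.

Lemma dist_le_reach x y n : dist_le gens x y n -> reach (val x) (val y) n.
Proof.
  intros (w & H1 & H2 & <-). apply reach_mono with (length w); auto. clear H2.
  revert x. induction H1 as [|p w Hp H1 IH]; intro x; [apply reach_refl|].
  change (length (p :: w)) with (1 + length w).
  change (walk Dbl x (p :: w)) with (walk Dbl (step Dbl x p) w).
  eapply reach_trans; [|apply IH]. destruct p as [s d]. apply in_gens in Hp.
  destruct Hp as (b & x0 & Es). simpl in Es. subst s. unfold step; simpl. destruct d.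
  - apply (reach_factor (val x) b (x0, true)).
  - rewrite <- factor_inv, of_letter_inv. apply (reach_factor (val x) b (x0, false)).
Qed.

Lemma gens_generate : generates gens.
Proof.
  intro g. destruct (reach_ex (val e1) (val g)) as [n Hn]. apply reach_hat in Hn.
  rewrite hat_val in Hn. destruct Hn as (w & H1 & _ & H2). eauto.
Qed.

Lemma wdist_D x y : wdist Dbl gens x y = D (val x) (val y).
Proof.
  apply Nat.le_antisymm.
  - apply (wdist_le Dbl gens gens_generate).
    pose proof (reach_hat x (val y) _ (D_reach _ _)) as H. now rewrite hat_val in H.
  - apply D_le, dist_le_reach, (wdist_le Dbl gens gens_generate). lia.
Qed.

Lemma in_near_sheet s : In s gens -> near_sheet (val s).
Proof.
  intro H. apply in_gens in H. destruct H as (b & x & ->). rewrite val_factor. unfold near_sheet.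
  destruct b; [simpl; lia|]. rewrite ks_mul_tau. etransitivity; [apply wmul_length|].
  rewrite ks_mul_fr. simpl. lia.
Qed.

Lemma in_hull_step s : In s gens -> hull_step (val s).
Proof.
  intro H. apply in_gens in H. destruct H as (b & x & ->). rewrite val_factor.
  assert (Hs : hull_step (fr (of_letter (x, true)))) by (apply hull_step_fr; unfold flen; simpl; lia).
  destruct b; auto. apply hull_step_stab_r; [apply sheet_stab_tau|].
  apply hull_step_stab_l; auto. apply sheet_stab_tau.
Qed.

Lemma hull_step_hat p q : hull_step (p^- ** q) -> hull_step ((val (hat p))^- ** val (hat q)).
Proof.
  intro H. pose proof sheet_stab_tau as Ht.
  assert (E1 : forall u, u ** (q ** tau) = u ** q ** tau) by (intro; group).
  assert (E2 : (p ** tau)^- ** q = tau ** (p^- ** q)) by (rewrite inv_mul, tau_inv; group).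
  destruct (hat_cases p) as [[_ ->]|[_ ->]], (hat_cases q) as [[_ ->]|[_ ->]];
    rewrite ?E1, ?E2; auto using hull_step_stab_l, hull_step_stab_r.
Qed.

(** The adjustments by [tau] add at most two cosets, and an even number below four is at most
    two. *)
Lemma near_sheet_hat p q : length (ks (p^- ** q)) <= 1 -> near_sheet ((val (hat p))^- ** val (hat q)).
Proof.
  intro H.
  assert (L : forall u v, length (ks (u ** v)) <= length (ks u) + length (ks v)).
  { intros u v. rewrite ks_mul. etransitivity; [apply wmul_length|]. rewrite length_map. lia. }
  assert (B : length (ks ((val (hat p))^- ** val (hat q))) <= 3).
  { destruct (hat_cases p) as [[_ ->]|[_ ->]], (hat_cases q) as [[_ ->]|[_ ->]];
      rewrite ?inv_mul, ?tau_inv, ?mul_assoc; try lia.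
    - pose proof (L (p^- ** q) tau). rewrite mul_assoc in *. simpl (length (ks tau)) in *. lia.
    - pose proof (L tau (p^- ** q)). simpl (length (ks tau)) in *. lia.
    - pose proof (L tau (p^- ** (q ** tau))). pose proof (L (p^- ** q) tau).
      rewrite mul_assoc in *. simpl (length (ks tau)) in *. lia. }
  pose proof (val_even ((hat p)^- ** hat q)) as E. red in E. rewrite val_mul, val_inv in E.
  unfold near_sheet. revert B E. generalize (length (ks ((val (hat p))^- ** val (hat q)))).
  intros [|[|[|[|m]]]] B E; try lia. discriminate.
Qed.

Lemma near_sheet_hat_r z p : near_sheet ((val z)^- ** p) -> near_sheet ((val z)^- ** val (hat p)).
Proof.
  intro H. destruct (hat_cases p) as [[_ E]|[N E]]; rewrite E; auto.
  assert (B : length (ks ((val z)^- ** p)) <= 1).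
  { assert (X : ~ even_sheet ((val z)^- ** p)).
    { intro X. apply N. replace p with (val z ** ((val z)^- ** p)) by group.
      apply even_sheet_mul; auto. apply val_even. }
    unfold near_sheet, even_sheet in *. revert H X. generalize (length (ks ((val z)^- ** p))).
    intros [|[|[|m]]] H X; try lia. exfalso. now apply X. }
  pose proof (near_sheet_hat (val z) p B) as K. rewrite hat_val in K. now rewrite E in K.
Qed.

Definition separating_chain (T : Dbl -> Prop) : Prop := forall y,
  chain (fun p q => T (p^- ** q)) (bottleneck_point Dbl T e1 y) e1 y.

Lemma hat_chain (T : GG -> Prop) (A : GG -> GG -> Prop) :
  (forall p q, A p q -> T ((val (hat p))^- ** val (hat q))) ->
  (forall z p, T ((val z)^- ** p) -> T ((val z)^- ** val (hat p))) ->
  (forall y, chain A (separating T e1 y) e1 y) ->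
  separating_chain (fun t => T (val t)).
Proof.
  intros HA Hr H y. rewrite <- (hat_val y) at 2. rewrite <- (hat_val e1) at 2.
  apply (chain_mono _ A _ _ hat (separating T (val e1) (val y))); [| |apply H].
  - intros p [->|[->|(V & V1 & V2 & V3)]]; rewrite ?hat_val; [now left|right; now left|right; right].
    exists (fun z => V (val z)). repeat split; auto.
    intros z z' Ht Hz Hz'. apply Hr. now apply (V3 _ (val z')).
  - intros p q. apply HA.
Qed.

Lemma near_sheet_chain : separating_chain (fun t => near_sheet (val t)).
Proof.
  apply (hat_chain near_sheet (fun p q => length (ks (p^- ** q)) <= 1));
    auto using near_sheet_hat, near_sheet_hat_r, sheet_chain.
Qed.

Lemma hull_step_chain : separating_chain (fun t => hull_step (val t)).
Proof.
  apply (hat_chain hull_step (fun p q => hull_step (p^- ** q))); auto using hull_step_hat, hull_chain.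
  intros z p H. apply hull_step_hat in H. now rewrite hat_val in H.
Qed.

Theorem axis_of_nontrivial (g : Dbl) : g <> e1 -> exists (n : Dbl -> Z) R J (T : Dbl -> Prop),
  (forall x j, Z.abs (n (zpow Dbl g j ** x) - n x - j) <= R)%Z /\
  (forall x x' m, n x + R <= m <= n x' - R ->
    dz Dbl gens x (zpow Dbl g m) + dz Dbl gens (zpow Dbl g m) x' <= dz Dbl gens x x' + R)%Z /\
  (forall x t, T t -> Z.abs (n (x ** t) - n x) <= J)%Z /\
  (forall s, In s gens -> T s) /\ (forall t, T t -> T (t^-)) /\ separating_chain T.
Proof.
  intro Hg.
  destruct (conj_cyc_reduced (val g)) as (h & phi & E & Hphi).
  { apply val_even. } { intro X. apply Hg. now apply val_inj. }
  assert (H : exists (T : GG -> Prop) n R J, axis_data T phi n R J /\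
    (forall s, In s gens -> T (val s)) /\ (forall t, T t -> T (t^-)) /\ separating_chain (fun t => T (val t))).
  { destruct Hphi as [(f & Hf & ->)|[H1 H2]].
    - destruct (axis_exists f Hf) as (n & Hn & Hb).
      destruct (elliptic_axis f Hf n Hn Hb) as (R & J & H).
      exists hull_step, (index f n), R, J.
      auto using in_hull_step, hull_step_inv, hull_step_chain.
    - destruct (loxodromic_axis phi H1 H2) as (n & R & H).
      exists near_sheet, n, R, 2%Z. repeat split; try apply H; auto using in_near_sheet, near_sheet_chain.
      intros t Ht. unfold near_sheet. now rewrite ks_inv_length. }
  destruct H as (T & n & R & J & (A1 & A2 & A3) & B1 & B2 & B3).
  (* [c] is the distance from [g^m] to [h phi^m], the corresponding point on the translate by [h] of
     the axis of [phi]. *)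
  set (c := Z.of_nat (D e1 (h^-))).
  exists (fun x => n (h^- ** val x)), (R + 2 * c)%Z, J, (fun t => T (val t)).
  split; [|split; [|split; [|split; [|split]]]]; auto.
  - intros x j. rewrite val_mul, val_pow, E, zpow_conj.
    replace (h^- ** (h ** zpow GG phi j ** h^- ** val x)) with (zpow GG phi j ** (h^- ** val x)) by group.
    specialize (A1 (h^- ** val x) j). lia.
  - intros x x' m Hm. unfold dz. rewrite !wdist_D, val_pow, E, zpow_conj.
    rewrite <- (D_left (h^-) (val x)), <- (D_left (h^-) _ (val x')), <- (D_left (h^-) (val x) (val x')).
    replace (h^- ** (h ** zpow GG phi m ** h^-)) with (zpow GG phi m ** h^-) by group.
    specialize (A2 (h^- ** val x) (h^- ** val x') m ltac:(lia)).
    set (u := h^- ** val x) in *. set (v := h^- ** val x') in *.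
    pose proof (D_tri u (zpow GG phi m) (zpow GG phi m ** h^-)).
    pose proof (D_tri (zpow GG phi m ** h^-) (zpow GG phi m) v).
    rewrite (D_sym (zpow GG phi m ** h^-) (zpow GG phi m)) in *.
    assert (X : D (zpow GG phi m) (zpow GG phi m ** h^-) = D e1 (h^-)).
    { rewrite <- (D_left (zpow GG phi m) e1). now rewrite gmulg1. }
    rewrite X in *. lia.
  - intros x t Ht. rewrite val_mul, gmulA. now apply A3.
  - intros t Ht. rewrite val_inv. auto.
Qed.

Theorem dbl_infinite_order (g : Dbl) : g <> e1 -> infinite_order Dbl g.
Proof.
  intros Hg k Hk E. destruct (axis_of_nontrivial g Hg) as (n & R & J & T & A1 & _).
  rewrite <- zpow_of_nat in E.
  pose proof (axis_infinite Dbl gens g n R J A1 (Z.of_nat k) E). lia.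
Qed.

Theorem dbl_contracting (g : Dbl) : g <> e1 -> strongly_contracting gens (cyclic_sub g).
Proof.
  intro Hg. destruct (axis_of_nontrivial g Hg) as (n & R & J & T & A1 & A2 & A3 & A4 & A5 & A6).
  exact (axis_contracting Dbl gens gens_generate g n R J T A1 A2 A3 A4 A5).
Qed.

Theorem dbl_HEC : HEC Dbl.
Proof.
  intros g Hinf.
  assert (Hg : g <> e1).
  { intros ->. apply (Hinf 1); [lia|]. simpl. group. }
  destruct (axis_of_nontrivial g Hg) as (n & R & J & T & A1 & A2 & A3 & A4 & A5 & A6).
  rewrite (elem_closure_commensurator Dbl gens gens_generate g n R J A1 A2).
  split.
  - exact (commensurator_virtually_cyclic Dbl gens gens_generate g n R J A1 A2).
  - exact (commensurator_hyp_embedded Dbl gens gens_generate g n R J T A1 A2 A3 A4 A5 A6).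
Qed.

End Extended.

(** * Distinguishing the doubles up to quasi-isometry *)

Arguments ks {I} : simpl never.
Arguments pt {I} : simpl never.
Arguments val {I} : simpl never.
Arguments wd : simpl never.
Arguments factor {I} : simpl never.
Arguments fr {I}.
Arguments tau {I}.

(** Words in the generators of the double, independently of the set of rungs; the boolean tells the factor. *)
Definition tword : Type := list (bool * letter).

Fixpoint eval (I : nat -> Prop) (w : tword) : Dbl I :=
  match w with
  | [] => e1
  | p :: w' => factor (fst p) (of_letter (snd p)) ** eval I w'
  end.

Definition tinv (w : tword) : tword := rev (map (fun p => (fst p, linv (snd p))) w).

Lemma eval_app I w1 w2 : eval I (w1 ++ w2) = eval I w1 ** eval I w2.
Proof. induction w1 as [|p w1 IH]; simpl; [group|]. rewrite IH. group. Qed.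

Lemma eval_tinv I w : eval I (tinv w) = (eval I w)^-.
Proof.
  induction w as [|p w IH]; [unfold tinv; simpl; group|]. unfold tinv in *. simpl.
  rewrite eval_app, IH, inv_mul. simpl. rewrite gmulg1. f_equal.
  now rewrite <- factor_inv, of_letter_inv.
Qed.

Lemma tinv_length w : length (tinv w) = length w.
Proof. unfold tinv. now rewrite length_rev, length_map. Qed.

Lemma wdist_tword I x y n : wdist (Dbl I) (gens I) x y <= n <->
  exists w, length w <= n /\ x ** eval I w = y.
Proof.
  rewrite <- (wdist_le (Dbl I) (gens I) (gens_generate I)). split.
  - intros (w & H1 & H2 & H3).
    enough (H : exists w', length w' = length w /\ x ** eval I w' = y).
    { destruct H as (w' & E & E'). exists w'. split; auto. lia. }
    clear H2 n. revert x H3. induction H1 as [|p w Hp H1 IH]; intros x H3.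
    + exists []. simpl in *. rewrite gmulg1. auto.
    + destruct (IH _ H3) as (w' & E & E'). destruct p as [s d]. apply in_gens in Hp.
      destruct Hp as (b & x0 & Es). simpl in Es. subst s.
      exists ((b, (x0, d)) :: w'). split; [exact (f_equal S E)|]. rewrite <- E'. simpl.
      unfold step; simpl. rewrite gmulA. f_equal. f_equal. destruct d; auto.
      now rewrite <- factor_inv, of_letter_inv.
  - intros (w & L & E). apply (wdist_le (Dbl I) (gens I) (gens_generate I)).
    rewrite <- E. clear E. transitivity (length w); auto. clear L n.
    revert x. induction w as [|[b l] w IH]; intro x; simpl.
    + rewrite gmulg1, wdist_refl; auto. apply gens_generate.
    + rewrite gmulA. specialize (IH (x ** factor b (of_letter l))).
      pose proof (wdist_tri (Dbl I) (gens I) (gens_generate I) x (x ** factor b (of_letter l))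
        (x ** factor b (of_letter l) ** eval I w)).
      assert (wdist (Dbl I) (gens I) x (x ** factor b (of_letter l)) <= 1); [|lia].
      apply (wdist_le (Dbl I) (gens I) (gens_generate I)). apply dist_le_snoc.
      exists []. simpl. auto.
Qed.

(** ** Short relations only involve short rungs *)

Section Parallel.
Variable I : nat -> Prop.
Variable n : nat.
Local Notation J := (below I n).

(** Two points follow the same word in both groups, and the cosets crossed are represented by points
    visited at most [i] steps ago. *)
Definition parallel (i : nat) (x : GG I) (y : GG J) : Prop :=
  pt x = pt y /\ exists r, ks x = map (coset I) r /\ ks y = map (coset J) r /\
    forall g, In g r -> fd g (pt x) <= i.

Lemma coset_below g h : fd g h <= 2 * ell n -> (coset I g = coset I h <-> coset J g = coset J h).
Proof.
  intro L.
  assert (H : forall K, coset K g = coset K h <-> ladder_group K (g^- ** h)).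
  { intro K. rewrite <- (mem_ladder K (coset K g) g h (mem_coset_self K g)). split.
    - intros ->. apply mem_coset_self.
    - apply mem_coset_eq. }
  rewrite !H. unfold ladder_group. split.
  - intro R. apply rd_below; auto. unfold fd, flen in L. lia.
  - apply rd_mono. now intros m [Hm _].
Qed.

Lemma wmul_last K (k : list (coset_space K)) B C : reduced (same K) (k ++ [B]) ->
  wmul (same K) (k ++ [B]) [C] = if decide (B = C) then k else k ++ [B; C].
Proof.
  intro R. destruct (decide (B = C)) as [->|N].
  - destruct (wmul_snoc K (k ++ [C]) C R) as [(k' & E1 & E2)|E2].
    + rewrite E2. now apply app_inj_tail in E1.
    + exfalso. pose proof (reduced_wmul _ (same K) (k ++ [C]) [C] (conj Logic.I Logic.I)) as R2.
      rewrite E2, <- app_assoc in R2. simpl in R2. apply reduced_junction in R2. now apply R2.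
  - destruct (wmul_snoc K (k ++ [B]) C R) as [(k' & E1 & E2)|E2].
    + apply app_inj_tail in E1. destruct E1 as [_ E1]. contradiction.
    + rewrite E2, <- app_assoc. reflexivity.
Qed.

Lemma parallel_tau i x y : i <= 2 * ell n -> parallel i x y -> parallel i (x ** tau) (y ** tau).
Proof.
  intros Hi (E & r & Ex & Ey & Hr). unfold tau.
  split; [now rewrite !pt_mul_tg|]. rewrite !pt_mul_tg.
  change (tg I (coset I e1)) with (@tau I). change (tg J (coset J e1)) with (@tau J).
  rewrite !ks_mul_tau. pose proof (ks_reduced I x) as Rx. pose proof (ks_reduced J y) as Ry.
  destruct r as [|g r _] using rev_ind.
  - rewrite Ex, Ey. exists [pt x]. simpl. rewrite E. repeat split; auto.
    intros g [<-|[]]. rewrite fd_refl. lia.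
  - rewrite Ex, Ey, !map_app in *. simpl in *. rewrite !wmul_last by auto.
    assert (Hg : fd g (pt x) <= i) by (apply Hr, in_or_app; simpl; auto).
    pose proof (coset_below g (pt x) ltac:(lia)) as C. rewrite <- E.
    destruct (decide (coset I g = coset I (pt x))), (decide (coset J g = coset J (pt x))); try tauto.
    + exists r. repeat split; auto. intros h Hh. apply Hr, in_or_app. auto.
    + exists (r ++ [g; pt x]). rewrite !map_app. repeat split; auto.
      intros h Hh. apply in_app_or in Hh. destruct Hh as [Hh|[<-|[<-|[]]]]; auto.
      * apply Hr, in_or_app. auto.
      * rewrite fd_refl. lia.
Qed.

Lemma parallel_letter i x y l : parallel i x y ->
  parallel (S i) (x ** fr (of_letter l)) (y ** fr (of_letter l)).
Proof.
  intros (E & r & Ex & Ey & Hr). split; [rewrite !pt_mul; now rewrite E|].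
  exists r. rewrite !ks_mul_fr. repeat split; auto. intros g Hg. rewrite pt_mul.
  pose proof (fd_tri g (pt x) (pt x ** of_letter l)) as T.
  assert (E1 : fd (pt x) (pt x ** of_letter l) = 1).
  { rewrite <- (gmulg1 Fr (pt x)) at 1. now rewrite fd_left, fd_one. }
  specialize (Hr g Hg). change (pt (fr (of_letter l))) with (of_letter l). lia.
Qed.

Lemma parallel_eval w i x y : parallel i x y -> i + length w <= 2 * ell n ->
  parallel (i + length w) (x ** val (eval I w)) (y ** val (eval J w)).
Proof.
  revert i x y. induction w as [|[b l] w IH]; intros i x y H L; simpl length in *.
  - change (val (eval I [])) with (gone (GG I)). change (val (eval J [])) with (gone (GG J)).
    now rewrite !gmulg1, Nat.add_0_r.
  - simpl eval. rewrite !val_mul, !gmulA, !val_factor.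
    replace (i + S (length w)) with (S i + length w) by lia.
    apply IH; [|lia]. destruct b.
    + now apply parallel_letter.
    + rewrite !gmulA. apply parallel_tau; [lia|]. apply parallel_letter.
      apply parallel_tau; [lia|]. exact H.
Qed.

Lemma eval_below w : length w <= 2 * ell n -> eval I w = e1 -> eval J w = e1.
Proof.
  intros L E.
  assert (H : parallel 0 e1 e1).
  { split; auto. exists []. repeat split; auto. easy. }
  apply (parallel_eval w) in H; [|lia]. rewrite !gmul1g, E in H.
  destruct H as (E1 & r & E2 & E3 & _). change (ks (val (gone (Dbl I)))) with (@nil (coset_space I)) in E2.
  destruct r; [|discriminate]. apply val_inj. apply gg_eq; [exact E3|]. now rewrite <- E1.
Qed.

End Parallel.

(** ** Local cocycles *)

(** The holonomy of a cocycle around a loop is invariant under homotopies across triangles of diameter at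
    most [s]. *)
Definition cocycle (G : Group) (S : list G) (s : nat) (P : Group) (delta : G -> G -> P) : Prop :=
  forall x y z, wdist G S x y <= s -> wdist G S y z <= s -> wdist G S x z <= s ->
    delta x y ** delta y z = delta x z.

Fixpoint hol {I : nat -> Prop} {P : Group} (delta : Dbl I -> Dbl I -> P) (x : Dbl I) (w : tword) : P :=
  match w with
  | [] => e1
  | p :: w' => delta x (x ** factor (fst p) (of_letter (snd p))) **
               hol delta (x ** factor (fst p) (of_letter (snd p))) w'
  end.

Fixpoint letters_prod (z : list letter) : Fr :=
  match z with [] => e1 | l :: z' => of_letter l ** letters_prod z' end.

Lemma letters_prod_app z1 z2 : letters_prod (z1 ++ z2) = letters_prod z1 ** letters_prod z2.
Proof. induction z1 as [|l z1 IH]; simpl; [group|]. rewrite IH. group. Qed.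

Lemma wd_letters_prod z : reduced linv z -> wd (letters_prod z) = z.
Proof.
  induction z as [|l z IH]; intro R; auto. simpl. rewrite wd_mul, IH by (now apply reduced_tail in R).
  now apply push_cons.
Qed.

Lemma letters_prod_wd f : letters_prod (wd f) = f.
Proof. apply wd_eq, wd_letters_prod, wd_reduced. Qed.

Definition in_factor (b : bool) (z : list letter) : tword := map (pair b) z.

Lemma factor_one I b : factor b e1 = e1 :> Dbl I.
Proof.
  apply (mul_left_inj (Dbl I) (factor b e1)). rewrite <- factor_mul. group.
Qed.

Lemma eval_in_factor I b z : eval I (in_factor b z) = factor b (letters_prod z).
Proof.
  induction z as [|l z IH]; simpl; [now rewrite factor_one|].
  now rewrite IH, factor_mul.
Qed.

Lemma factor_inj I b f h : factor b f = factor b h :> Dbl I -> f = h.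
Proof.
  intro E. assert (E2 : pt (val (@factor I b f)) = pt (val (@factor I b h))) by now rewrite E.
  rewrite !val_factor in E2. destruct b; [exact E2|]. unfold tau in E2.
  now rewrite !pt_mul_tg, !pt_tg_mul in E2.
Qed.

Lemma coset_one I u : ladder_group I u <-> coset I u = coset I e1.
Proof.
  pose proof (mem_ladder I (coset I e1) e1 u (mem_coset_self I e1)) as M.
  rewrite inv_one, gmul1g in M. rewrite <- M. split.
  - intro H. symmetry. now apply mem_coset_eq.
  - intros <-. apply mem_coset_self.
Qed.

(** Conjugation by [tau] turns [fr u] into [fr u] preceded by the cosets of the identity and of [u],
    which cancel exactly when [u] lies in the ladder group. *)
Lemma factor_ladder I u : ladder_group I u <-> factor true u = factor false u :> Dbl I.
Proof.
  assert (T : tau ** fr u ** tau = tau ** tg I (coset I u) ** fr u :> GG I).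
  { unfold tau at 2. rewrite mul_assoc, fr_tg, act_coset, gmulg1. group. }
  split.
  - intro H. apply val_inj. rewrite !val_factor, T. apply coset_one in H. rewrite H.
    change (tg I (coset I e1)) with (@tau I). rewrite mul_assoc. symmetry. apply tau_tau.
  - intro E. apply coset_one. apply (f_equal val) in E. rewrite !val_factor, T in E.
    apply (f_equal ks) in E. unfold tau in E. rewrite !ks_mul_fr, ks_tg_mul in E.
    change (ks (fr u)) with (@nil (coset_space I)) in E.
    change (ks (tg I (coset I u))) with [coset I u] in E. simpl in E.
    destruct (decide (coset I u = same I (coset I e1))) as [|N]; auto. discriminate.
Qed.

(** The word along the line from 0 to [q]. Downwards, the edge number [i] joins [-i] to [-i - 1],
    and this lower end gives the label. *)
Definition line (q : Z) : Fr :=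
  letters_prod (match q with
    | Z0 => []
    | Zpos p => map (fun i => (sigma (Z.of_nat i), true)) (seq 0 (Pos.to_nat p))
    | Zneg p => map (fun i => (sigma (- Z.of_nat i - 1), false)) (seq 0 (Pos.to_nat p))
    end).

Lemma line_nonneg k : line (Z.of_nat k) =
  letters_prod (map (fun i => (sigma (Z.of_nat i), true)) (seq 0 k)).
Proof. destruct k; auto. change (Z.of_nat (S k)) with (Zpos (Pos.of_succ_nat k)). unfold line.
  now rewrite SuccNat2Pos.id_succ. Qed.

Lemma line_nonpos k : line (- Z.of_nat k) =
  letters_prod (map (fun i => (sigma (- Z.of_nat i - 1), false)) (seq 0 k)).
Proof. destruct k; auto. change (- Z.of_nat (S k))%Z with (Zneg (Pos.of_succ_nat k)). unfold line.
  now rewrite SuccNat2Pos.id_succ. Qed.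

Lemma of_letter_false a : of_letter (a, false) = (of_letter (a, true))^-.
Proof. symmetry. apply of_letter_inv. Qed.

Lemma line_succ q : line (q + 1) = line q ** of_letter (sigma q, true).
Proof.
  destruct (Z_le_gt_dec 0 q).
  - replace q with (Z.of_nat (Z.to_nat q)) by lia. set (k := Z.to_nat q).
    replace (Z.of_nat k + 1)%Z with (Z.of_nat (S k)) by lia.
    rewrite !line_nonneg, seq_S, map_app, letters_prod_app. simpl. group.
  - set (k := Z.to_nat (- q - 1)). replace q with (- Z.of_nat (S k))%Z by lia.
    replace (- Z.of_nat (S k) + 1)%Z with (- Z.of_nat k)%Z by lia.
    rewrite !line_nonpos, seq_S, map_app, letters_prod_app. simpl (letters_prod (map _ [_])).
    cbv beta. change (0 + k) with k. replace (- Z.of_nat k - 1)%Z with (- Z.of_nat (S k))%Z by lia.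
    rewrite of_letter_false. group.
Qed.

Lemma line_length q : flen (line q) <= Z.to_nat (Z.abs q).
Proof.
  assert (H : forall z, flen (letters_prod z) <= length z).
  { induction z as [|l z IH]; simpl; [unfold flen; simpl; lia|].
    pose proof (flen_mul (of_letter l) (letters_prod z)).
    change (flen (of_letter l)) with 1 in *. lia. }
  destruct q as [|p|p]; unfold line; (etransitivity; [apply H|]); simpl; rewrite ?length_map, ?length_seq; lia.
Qed.

Lemma edge_line I q : edge I q (sigma q, true) (q + 1).
Proof. right. auto. Qed.

Lemma rd_step I v u v' f l : rd I v (wd f) u -> edge I u l v' -> rd I v (wd (f ** of_letter l)) v'.
Proof. intros H E. apply (rd_mul I v u v'); auto. simpl. eauto. Qed.

Lemma rd_line I q : rd I 0 (wd (line q)) q.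
Proof.
  revert q. apply Z.peano_ind.
  - reflexivity.
  - intros q H. unfold Z.succ. rewrite line_succ. eapply rd_step; eauto. apply edge_line.
  - intros q H. replace (line (Z.pred q)) with (line q ** of_letter (linv (sigma (Z.pred q), true))).
    + eapply rd_step; eauto. apply edge_inv. pose proof (edge_line I (Z.pred q)) as E.
      now replace (Z.pred q + 1)%Z with q in E by lia.
    + pose proof (line_succ (Z.pred q)) as E. replace (Z.pred q + 1)%Z with q in E by lia.
      rewrite E, <- of_letter_inv. group.
Qed.

(** * Holonomy around relations with short rungs *)

Section Holonomy.
Variable K : nat -> Prop.
Variable P : Group.
Variable s : nat.
Hypothesis s_pos : 1 <= s.
Variable delta : Dbl K -> Dbl K -> P.
Hypothesis delta_cocycle : cocycle (Dbl K) (gens K) s P delta.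
Local Notation d := (wdist (Dbl K) (gens K)).
Local Notation hol := (hol delta).

Lemma cocycle_refl x : delta x x = e1.
Proof.
  assert (L : d x x <= s) by (rewrite wdist_refl; [lia|apply gens_generate]).
  apply (mul_left_inj P (delta x x)). rewrite (delta_cocycle x x x L L L). group.
Qed.

Lemma cocycle_inv x y : d x y <= s -> delta x y ** delta y x = e1.
Proof.
  intro L. rewrite <- (cocycle_refl x). apply delta_cocycle; auto.
  - rewrite wdist_sym; auto. apply gens_generate.
  - rewrite wdist_refl; [lia|apply gens_generate].
Qed.

Lemma hol_app x w1 w2 : hol x (w1 ++ w2) = hol x w1 ** hol (x ** eval K w1) w2.
Proof.
  revert x. induction w1 as [|p w1 IH]; intro x; simpl; [group|]. rewrite IH. group.
Qed.

Lemma hol_short x w : length w <= s -> hol x w = delta x (x ** eval K w).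
Proof.
  revert x. induction w as [|p w IH]; intros x L; simpl in *.
  - now rewrite gmulg1, cocycle_refl.
  - rewrite IH by lia. rewrite mul_assoc. apply delta_cocycle; apply wdist_tword.
    + exists [p]. simpl. rewrite gmulg1. split; auto.
    + exists w. split; [lia|]. group.
    + exists (p :: w). simpl. split; [lia|]. reflexivity.
Qed.

Definition fhol (b : bool) (x : Dbl K) (f : Fr) : P := hol x (in_factor b (wd f)).

(** Going along an edge and back contributes nothing, so the holonomy of a word in one factor
    depends only on the element it represents. *)
Lemma hol_push b x l z : hol x (in_factor b (push linv l z)) = hol x (in_factor b (l :: z)).
Proof.
  destruct z as [|l' z]; auto. simpl push. destruct (decide (l' = linv l)) as [->|]; auto.
  simpl. rewrite <- (of_letter_inv l), factor_inv.
  rewrite mul_assoc, gmulgV, gmulg1, <- mul_assoc, cocycle_inv; [now rewrite gmul1g|].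
  etransitivity; [|exact s_pos]. apply wdist_tword. exists [(b, l)]. simpl. rewrite gmulg1. auto.
Qed.

Lemma hol_free b x z : hol x (in_factor b z) = fhol b x (letters_prod z).
Proof.
  revert x. induction z as [|l z IH]; intro x; auto.
  unfold fhol in *. simpl letters_prod. rewrite wd_mul.
  change (wmul linv (wd (of_letter l)) (wd (letters_prod z))) with (push linv l (wd (letters_prod z))).
  rewrite hol_push. simpl. f_equal. apply IH.
Qed.

Lemma fhol_mul b x f h : fhol b x (f ** h) = fhol b x f ** fhol b (x ** factor b f) h.
Proof.
  rewrite <- (letters_prod_wd f), <- (letters_prod_wd h) at 1. rewrite <- letters_prod_app, <- hol_free.
  unfold in_factor. rewrite map_app, hol_app. unfold fhol, in_factor. f_equal. f_equal.
  change (map (pair b) (wd f)) with (in_factor b (wd f)). now rewrite eval_in_factor, letters_prod_wd.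
Qed.

Lemma fhol_one b x : fhol b x e1 = e1.
Proof. reflexivity. Qed.

Lemma fhol_short b x f : flen f <= s -> fhol b x f = delta x (x ** factor b f).
Proof.
  intro L. unfold fhol. rewrite hol_short; [now rewrite eval_in_factor, letters_prod_wd|].
  unfold in_factor. now rewrite length_map.
Qed.

Variable J' : nat -> Prop.
Hypothesis J'_sub : forall m, J' m -> K m.
Hypothesis J'_short : forall m, J' m -> 2 * ell m + 1 <= s.

(** Such loops, along the line to an edge, across it and back, generate the ladder group. Over an
    edge of the line the loop is trivial; over a rung of [J'] it has length at most
    [2 ell m + 1 <= s], so both copies are evaluated by [delta] on the same pair of points. *)
Lemma fhol_edge x v l u : edge J' v l u ->
  fhol true x (line v ** of_letter l ** (line u)^-) = fhol false x (line v ** of_letter l ** (line u)^-).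
Proof.
  intro E. destruct l as [a b].
  assert (E' : edge K v (a, b) u) by (pose proof (rd_mono J' K v [(a, b)] u J'_sub (ex_intro _ u (conj E eq_refl))) as (? & ? & <-); auto).
  destruct E as [(E1 & E2 & m & Hm & E3)|(E1 & E2)]; simpl in *.
  - assert (L : flen (line v ** of_letter (a, b) ** (line u)^-) <= s).
    { specialize (J'_short m Hm).
      pose proof (flen_mul (line v ** of_letter (a, b)) ((line u)^-)).
      pose proof (flen_mul (line v) (of_letter (a, b))). rewrite flen_inv in *.
      pose proof (line_length v). pose proof (line_length u).
      change (flen (of_letter (a, b))) with 1 in *. destruct b; lia. }
    rewrite !fhol_short by auto. f_equal. f_equal. apply factor_ladder.
    apply (rd_mul K 0 u); [|apply rd_inv, rd_line].
    eapply rd_step; [apply rd_line|exact E'].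
  - assert (E3 : line v ** of_letter (a, b) ** (line u)^- = e1); [|now rewrite E3].
    destruct b; subst a u.
    + rewrite line_succ. group.
    + replace v with ((v - 1) + 1)%Z at 1 by lia. rewrite line_succ.
      rewrite of_letter_false. group.
Qed.

(** With the line as spanning tree, a reading decomposes into the loops of [fhol_edge]. *)
Lemma fhol_reading z v u x : rd J' v z u ->
  fhol true x (line v ** letters_prod z ** (line u)^-) = fhol false x (line v ** letters_prod z ** (line u)^-).
Proof.
  revert v x. induction z as [|l z IH]; intros v x H.
  - simpl in H. subst. simpl. now rewrite gmulg1, gmulgV.
  - destruct H as (t & E & H). simpl letters_prod.
    replace (line v ** (of_letter l ** letters_prod z) ** (line u)^-)
      with ((line v ** of_letter l ** (line t)^-) ** (line t ** letters_prod z ** (line u)^-)) by group.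
    pose proof (fhol_edge x v l t E) as FE.
    assert (F : ladder_group K (line v ** of_letter l ** (line t)^-)).
    { apply (rd_mul K 0 t); [|apply rd_inv, rd_line].
      eapply rd_step; [apply rd_line|].
      pose proof (rd_mono J' K v [l] t J'_sub (ex_intro _ t (conj E eq_refl))) as (? & ? & <-). auto. }
    apply factor_ladder in F. revert FE F.
    generalize (line v ** of_letter l ** (line t)^-). intros A FE F.
    rewrite (fhol_mul true x A), (fhol_mul false x A), FE, F. now rewrite IH.
Qed.

Lemma fhol_ladder x u : ladder_group J' u -> fhol true x u = fhol false x u.
Proof.
  intro H. pose proof (fhol_reading (wd u) 0 0 x H) as E. change (line 0) with (gone Fr) in E.
  now rewrite letters_prod_wd, inv_one, gmulg1, gmul1g in E.
Qed.

Fixpoint sev (I : nat -> Prop) (y : list (bool * Fr)) : Dbl I :=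
  match y with [] => e1 | p :: y' => factor (fst p) (snd p) ** sev I y' end.

Fixpoint shol (x : Dbl K) (y : list (bool * Fr)) : P :=
  match y with
  | [] => e1
  | p :: y' => fhol (fst p) x (snd p) ** shol (x ** factor (fst p) (snd p)) y'
  end.

Lemma sev_app I y1 y2 : sev I (y1 ++ y2) = sev I y1 ** sev I y2.
Proof.
  induction y1 as [|p y1 IH]; [simpl; group|].
  change (factor (fst p) (snd p) ** sev I (y1 ++ y2) = factor (fst p) (snd p) ** sev I y1 ** sev I y2).
  rewrite IH. group.
Qed.

Lemma shol_app x y1 y2 : shol x (y1 ++ y2) = shol x y1 ** shol (x ** sev K y1) y2.
Proof.
  revert x. induction y1 as [|p y1 IH]; intro x; [simpl; group|].
  change (fhol (fst p) x (snd p) ** shol (x ** factor (fst p) (snd p)) (y1 ++ y2) =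
    fhol (fst p) x (snd p) ** shol (x ** factor (fst p) (snd p)) y1 **
    shol (x ** (factor (fst p) (snd p) ** sev K y1)) y2).
  rewrite IH. group.
Qed.

Definition equivalent (y y' : list (bool * Fr)) : Prop :=
  sev J' y = sev J' y' /\ sev K y = sev K y' /\ forall x, shol x y = shol x y'.

Lemma equivalent_context a b y y' : equivalent y y' -> equivalent (a ++ y ++ b) (a ++ y' ++ b).
Proof.
  intros (E1 & E2 & E3). split; [|split; [|intro x]].
  - now rewrite !sev_app, E1.
  - now rewrite !sev_app, E2.
  - now rewrite !shol_app, E2, E3.
Qed.

Lemma equivalent_merge b f h : equivalent [(b, f); (b, h)] [(b, f ** h)].
Proof.
  split; [|split; [|intro x]]; simpl; rewrite ?factor_mul, ?fhol_mul; group.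
Qed.

Lemma equivalent_swap b b' f : ladder_group J' f -> equivalent [(b, f)] [(b', f)].
Proof.
  intro H.
  assert (HK : ladder_group K f) by (eapply rd_mono; [exact J'_sub|exact H]).
  pose proof (fhol_ladder) as FL.
  apply factor_ladder in HK. pose proof (proj1 (factor_ladder J' f) H) as HJ.
  split; [|split; [|intro x]]; simpl; destruct b, b'; rewrite ?HJ, ?HK, ?FL; auto.
Qed.

Fixpoint alternating (y : list (bool * Fr)) : Prop :=
  match y with
  | [] => True
  | (b, f) :: y' => ~ ladder_group J' f /\
      match y' with [] => True | (b', _) :: _ => b' <> b end /\ alternating y'
  end.

Lemma not_alternating y : ~ alternating y ->
  (exists a b f h c, y = a ++ [(b, f); (b, h)] ++ c) \/
  (exists a b f c, y = a ++ [(b, f)] ++ c /\ ladder_group J' f).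
Proof.
  induction y as [|[b f] y IH]; intro N; [exfalso; now apply N|].
  destruct (classic (ladder_group J' f)) as [L|L].
  { right. exists [], b, f, y. auto. }
  destruct (classic (alternating y)) as [A|A].
  - destruct y as [|[b' h] y]; [exfalso; apply N; simpl; auto|].
    destruct (bool_dec b' b) as [->|E].
    + left. exists [], b, f, h, y. auto.
    + exfalso. apply N. split; auto.
  - destruct (IH A) as [(a & b' & f' & h & c & ->)|(a & b' & f' & c & -> & H)].
    + left. exists ((b, f) :: a), b', f', h, c. auto.
    + right. exists ((b, f) :: a), b', f', c. auto.
Qed.

(** Normal form theorem for the amalgam: the sheets crossed do not cancel. *)
Lemma alternating_sheets y : alternating y ->
  match y with
  | [] => True
  | (false, f) :: _ => hd_error (ks (val (sev J' y))) = Some (coset J' e1)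
  | (true, f) :: [] => ks (val (sev J' y)) = []
  | (true, f) :: _ => hd_error (ks (val (sev J' y))) = Some (coset J' f)
  end.
Proof.
  induction y as [|[b f] y IH]; auto. intros (N & Hb & A). specialize (IH A).
  simpl sev. rewrite val_mul, val_factor. destruct b.
  - rewrite ks_fr_mul. destruct y as [|[b' h] y]; [reflexivity|].
    destruct b'; [congruence|]. destruct (ks (val (sev J' ((false, h) :: y)))) as [|C k]; [discriminate|].
    injection IH as ->. cbn [map hd_error]. now rewrite act_coset, gmulg1.
  - assert (E : hd_error (ks (val (sev J' y))) <> Some (coset J' e1)).
    { destruct y as [|[b' h] y]; [discriminate|]. destruct b'; [|congruence].
      destruct y as [|p y]; [rewrite IH; discriminate|]. rewrite IH. intro E.
      assert (E' : coset J' h = coset J' e1) by congruence.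
      destruct A as (Nh & _). apply Nh. now apply coset_one. }
    rewrite !mul_assoc. unfold tau at 1. rewrite ks_tg_mul, ks_fr_mul. unfold tau. rewrite ks_tg_mul.
    assert (E2 : push (same J') (coset J' e1) (ks (val (sev J' y))) = coset J' e1 :: ks (val (sev J' y))).
    { destruct (ks (val (sev J' y))) as [|C k]; auto. simpl. unfold same.
      destruct (decide (C = coset J' e1)) as [->|]; auto. exfalso. now apply E. }
    rewrite E2. simpl map. rewrite act_coset, gmulg1. simpl. unfold same.
    destruct (decide (coset J' f = coset J' e1)) as [X|]; auto.
    exfalso. apply N. now apply coset_one.
Qed.

Lemma alternating_nontrivial y : y <> [] -> alternating y -> sev J' y <> e1.
Proof.
  intros Ny A E. pose proof (alternating_sheets y A) as H.
  destruct y as [|[b f] y]; auto. rewrite E in H. change (ks (val (gone (Dbl J')))) with (@nil (coset_space J')) in H.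
  destruct b; [|discriminate]. destruct y; [|discriminate].
  simpl in E. rewrite gmulg1 in E. rewrite <- (factor_one J' true) in E. apply factor_inj in E. subst.
  destruct A as [A _]. apply A. reflexivity.
Qed.

(** A non-empty product that is trivial in the double with rungs [J'] cannot alternate: two
    neighbours from one factor merge, or a syllable in the ladder group changes its factor and then
    merges. Both moves preserve the holonomy and shorten the product. *)
Lemma shol_trivial y x : sev J' y = e1 -> shol x y = e1.
Proof.
  remember (length y) as N eqn:EN. revert y EN x. induction N as [N IH] using lt_wf_ind. intros y EN x E.
  destruct y as [|[b f] [|q y]]; [reflexivity| |].
  { simpl in *. rewrite gmulg1 in E. rewrite <- (factor_one J' b) in E. apply factor_inj in E. subst f.
    rewrite fhol_one. group. }
  assert (R : exists y', length y' < N /\ equivalent ((b, f) :: q :: y) y').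
  { destruct (classic (alternating ((b, f) :: q :: y))) as [A|A].
    { exfalso. revert E. apply alternating_nontrivial; auto. discriminate. }
    destruct (not_alternating _ A) as [(a & b' & f' & h & c & Ey)|(a & b' & f' & c & Ey & H)]; rewrite Ey in *.
    - exists (a ++ [(b', f' ** h)] ++ c). split; [|apply equivalent_context, equivalent_merge].
      rewrite EN, !length_app. simpl. lia.
    - destruct c as [|[b2 h] c].
      + destruct a as [|[b2 h] a _] using rev_ind; [discriminate|].
        exists (a ++ [(b2, h ** f')]). split.
        * rewrite EN, !length_app. simpl. lia.
        * pose proof (equivalent_context (a ++ [(b2, h)]) [] _ _ (equivalent_swap b' b2 f' H)) as (F1 & F2 & F3).
          pose proof (equivalent_context a [] _ _ (equivalent_merge b2 h f')) as (G1 & G2 & G3).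
          rewrite !app_nil_r, <- !app_assoc in *. simpl in *.
          split; [congruence|]. split; [congruence|]. intro. now rewrite F3.
      + exists (a ++ [(b2, f' ** h)] ++ c). split.
        * rewrite EN, !length_app. simpl. lia.
        * pose proof (equivalent_context a ((b2, h) :: c) _ _ (equivalent_swap b' b2 f' H)) as (F1 & F2 & F3).
          pose proof (equivalent_context a c _ _ (equivalent_merge b2 f' h)) as (G1 & G2 & G3).
          simpl in *. split; [congruence|]. split; [congruence|]. intro. now rewrite F3. }
  destruct R as (y' & L & E1 & _ & E3). rewrite E3. apply (IH (length y')); auto. congruence.
Qed.

Lemma hol_trivial w x : eval J' w = e1 -> hol x w = e1.
Proof.
  set (y := map (fun p => (fst p, of_letter (snd p))) w).
  assert (E1 : sev J' y = eval J' w).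
  { unfold y. clear. induction w as [|[b l] w IH]; [reflexivity|].
    change (factor b (of_letter l) ** sev J' (map (fun p => (fst p, of_letter (snd p))) w) =
      factor b (of_letter l) ** eval J' w). now rewrite IH. }
  assert (E2 : forall x, shol x y = hol x w).
  { unfold y. clear - s_pos delta_cocycle. induction w as [|[b l] w IH]; intro x; auto.
    change (fhol b x (of_letter l) ** shol (x ** factor b (of_letter l)) (map (fun p => (fst p, of_letter (snd p))) w) =
      delta x (x ** factor b (of_letter l)) ** hol (x ** factor b (of_letter l)) w).
    rewrite IH. f_equal. apply fhol_short. exact s_pos. }
  intro E. rewrite <- E2. apply shol_trivial. congruence.
Qed.

End Holonomy.

(** A path of length at most [s] in the double with rungs [I] lifts to the double that only has the rungs
    of [I] below [n]; the lift is well defined on pairs of points when [s] is short compared to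
    [ell n]. *)
Section ShortLift.
Variable I : nat -> Prop.
Variables n s : nat.
Hypothesis s_short : 3 * s <= 2 * ell n.
Local Notation J := (below I n).

Definition lift (x y : Dbl I) : Dbl J :=
  eval J (epsilon (inhabits []) (fun w => length w <= s /\ x ** eval I w = y)).

Lemma lift_eval x w : length w <= s -> lift x (x ** eval I w) = eval J w.
Proof.
  intro L. unfold lift.
  destruct (epsilon_spec (inhabits []) (fun v => length v <= s /\ x ** eval I v = x ** eval I w))
    as [L0 E0]; [now exists w|].
  set (v := epsilon _ _) in *. apply mul_left_inj in E0.
  apply (mul_right_inj (Dbl J) ((eval J w)^-)). rewrite gmulgV, <- eval_tinv, <- eval_app.
  apply eval_below; [rewrite length_app, tinv_length; lia|].
  rewrite eval_app, eval_tinv, E0. group.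
Qed.

(** The three sides of a triangle form a relation of length at most [3 s], short enough for
    [eval_below]. *)
Lemma lift_cocycle : cocycle (Dbl I) (gens I) s (Dbl J) lift.
Proof.
  intros x y z H1 H2 H3. apply wdist_tword in H1, H2, H3.
  destruct H1 as (w1 & L1 & <-), H2 as (w2 & L2 & <-), H3 as (w3 & L3 & E3).
  rewrite <- E3 at 2. rewrite !lift_eval by auto.
  rewrite mul_assoc in E3. apply mul_left_inj in E3.
  apply (mul_right_inj (Dbl J) ((eval J w3)^-)). rewrite gmulgV, <- eval_tinv, <- !eval_app.
  apply eval_below; [rewrite !length_app, tinv_length; lia|].
  rewrite !eval_app, eval_tinv, E3. group.
Qed.

Lemma hol_lift x w : 1 <= s -> hol lift x w = eval J w.
Proof.
  intro Hs. revert x. induction w as [|[b l] w IH]; intro x; auto. simpl. rewrite IH. f_equal.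
  pose proof (lift_eval x [(b, l)] Hs) as E. simpl in E. now rewrite !gmulg1 in E.
Qed.

End ShortLift.

(** * The loop of a single rung and its transport by a quasi-isometry *)

Definition rung (n : nat) : Fr :=
  line (Z.of_nat (ell n)) ** of_letter (Ld, true) ** (line (- Z.of_nat (ell n)))^-.

Definition rung_relation (n : nat) : tword :=
  in_factor true (wd (rung n)) ++ in_factor false (wd ((rung n)^-)).

Lemma rung_length n : flen (rung n) <= 2 * ell n + 1.
Proof.
  unfold rung. pose proof (flen_mul (line (Z.of_nat (ell n)) ** of_letter (Ld, true)) ((line (- Z.of_nat (ell n)))^-)).
  pose proof (flen_mul (line (Z.of_nat (ell n))) (of_letter (Ld, true))). rewrite flen_inv in *.
  pose proof (line_length (Z.of_nat (ell n))). pose proof (line_length (- Z.of_nat (ell n))).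
  change (flen (of_letter (Ld, true))) with 1 in *. lia.
Qed.

Lemma rung_relation_length n : length (rung_relation n) <= 2 * (2 * ell n + 1).
Proof.
  unfold rung_relation, in_factor. rewrite length_app, !length_map.
  pose proof (rung_length n) as L. pose proof (flen_inv (rung n)). unfold flen in *. lia.
Qed.

Lemma eval_rung_relation I n :
  eval I (rung_relation n) = factor true (rung n) ** (factor false (rung n))^-.
Proof.
  unfold rung_relation. now rewrite eval_app, !eval_in_factor, !letters_prod_wd, factor_inv.
Qed.

Lemma rung_relation_trivial I n : eval I (rung_relation n) = e1 <-> I n.
Proof.
  rewrite eval_rung_relation. split.
  - intro E.
    assert (E' : factor true (rung n) = factor false (rung n) :> Dbl I).
    { rewrite <- (gmulg1 _ (factor true (rung n))), <- (gmulVg _ (factor false (rung n))), gmulA, E. group. }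
    apply factor_ladder in E'. red in E'.
    set (a := line (Z.of_nat (ell n))) in *. set (b := line (- Z.of_nat (ell n))) in *.
    assert (R : rd I (Z.of_nat (ell n)) (wd (of_letter (Ld, true))) (- Z.of_nat (ell n))).
    { replace (of_letter (Ld, true)) with (a^- ** (rung n ** b)) by (unfold rung; fold a b; group).
      apply (rd_mul I _ 0); [apply rd_inv, rd_line|]. apply (rd_mul I _ 0); auto. apply rd_line. }
    destruct R as (u & R & _). apply edge_rung in R; auto. destruct R as (m & Hm & E1 & _).
    unfold sgn in E1. cbn [snd] in E1. assert (X : ell n = ell m) by lia. apply ell_inj in X. now subst.
  - intro Hn. assert (E : factor true (rung n) = factor false (rung n) :> Dbl I); [|rewrite E; group].
    apply factor_ladder. apply (rd_mul I 0 (- Z.of_nat (ell n))); [|apply rd_inv, rd_line].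
    eapply rd_step; [apply rd_line|]. left. repeat split; auto. now exists n.
Qed.

Section Transport.
Variables I J : nat -> Prop.
Variable n : nat.
Hypothesis n_in : I n.
Hypothesis n_notin : ~ J n.
Local Notation dI := (wdist (Dbl I) (gens I)).
Local Notation dJ := (wdist (Dbl J) (gens J)).
Variable f : Dbl I -> Dbl J.
Variables lam c : nat.
Hypothesis f_upper : forall x y, dJ (f x) (f y) <= lam * dI x y + c.
Hypothesis f_lower : forall x y, dI x y <= lam * dJ (f x) (f y) + c.
Hypothesis f_onto : forall z, exists x, dJ (f x) z <= c.
Let c2 := lam * c + c.
Let B := lam + c.
Variables s s' : nat.
(** [s] is the scale on the side of [J]: it fills the rungs below [n] and covers the image of an
    edge. [s'] is the scale on the side of [I] where triangles of size [s] land, still short for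
    rung [n]. By [loop_short] the image of the rung relation is too short to involve rungs beyond
    [n]. *)
Hypothesis s_rungs : forall m, m < n -> 2 * ell m + 1 <= s.
Hypothesis s_B : B <= s.
Hypothesis s_s' : lam * (s + 2 * c) + c <= s'.
Hypothesis s'_c2 : 2 * c2 + 1 <= s'.
Hypothesis s'_n : 3 * s' <= 2 * ell n.
Hypothesis loop_short : B * (2 * (2 * ell n + 1)) <= 2 * ell (S n).

(** The lift cocycle detects the relation of rung [n] at scale [s'].  Transported by a quasi-isometry to
    a double without rung [n] it becomes a cocycle at a scale [s] at which every short loop bounds. *)
Lemma no_transport : False.
Proof.
  pose proof (gens_generate I) as GI. pose proof (gens_generate J) as GJ.
  apply choice in f_onto. destruct f_onto as [g Hg].
  set (delta := lift I n s').
  assert (Hd : cocycle (Dbl I) (gens I) s' (Dbl (below I n)) delta) by now apply lift_cocycle.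
  assert (s'_pos : 1 <= s') by lia.
  assert (Hgl : forall z z', dI (g z) (g z') <= lam * (dJ z z' + 2 * c) + c).
  { intros z z'. etransitivity; [apply f_lower|].
    pose proof (wdist_tri _ _ GJ (f (g z)) z (f (g z'))). pose proof (wdist_tri _ _ GJ z z' (f (g z'))).
    pose proof (Hg z). pose proof (Hg z'). rewrite (wdist_sym _ _ GJ z' (f (g z'))) in *. nia. }
  assert (Hgf : forall x, dI (g (f x)) x <= c2).
  { intro x. etransitivity; [apply f_lower|]. pose proof (Hg (f x)). unfold c2. nia. }
  set (delta' := fun z z' => delta (g z) (g z')).
  assert (s_pos : 1 <= s).
  { destruct n as [|m] eqn:En; [|specialize (s_rungs m); lia]. simpl in s'_n. lia. }
  assert (Hd' : cocycle (Dbl J) (gens J) s (Dbl (below I n)) delta').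
  { intros x y z H1 H2 H3. unfold delta'. apply Hd; (etransitivity; [apply Hgl|]); nia. }
  assert (Hdisp : forall x, dI x x <= s') by (intro; rewrite wdist_refl by auto; lia).
  assert (Hin : forall x, delta (g (f x)) x ** delta x (g (f x)) = e1).
  { intro x. apply (cocycle_inv I _ s' s'_pos delta Hd). pose proof (Hgf x). lia. }
  assert (Hin' : forall x, delta x (g (f x)) ** delta (g (f x)) x = e1).
  { intro x. apply (cocycle_inv I _ s' s'_pos delta Hd). rewrite wdist_sym by auto. pose proof (Hgf x). lia. }
  (* [W] follows the image of [w] under [f]. Squares with sides of the form [delta (g (f x)) x]
     compare the holonomies edge by edge, so on loops they agree up to conjugation. *)
  assert (Main : forall w x, exists W, f x ** eval J W = f (x ** eval I w) /\ length W <= B * length w /\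
    hol delta' (f x) W =
      delta (g (f x)) x ** hol delta x w ** delta (x ** eval I w) (g (f (x ** eval I w)))).
  { induction w as [|[b l] w IH]; intro x.
    - exists []. simpl. rewrite !gmulg1, Hin. repeat split. lia.
    - set (y := x ** factor b (of_letter l)).
      assert (Lxy : dI x y <= 1).
      { apply wdist_tword. exists [(b, l)]. simpl. now rewrite gmulg1. }
      assert (LB : dJ (f x) (f y) <= B).
      { etransitivity; [apply f_upper|]. unfold B. nia. }
      pose proof LB as LW. apply wdist_tword in LW. destruct LW as (W1 & L1 & E1).
      destruct (IH y) as (W2 & E2 & L2 & H2). exists (W1 ++ W2).
      assert (Ey : x ** eval I ((b, l) :: w) = y ** eval I w) by (simpl; unfold y; group).
      rewrite Ey. split; [|split].
      + rewrite eval_app, gmulA, E1. exact E2.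
      + rewrite length_app. simpl length. nia.
      + rewrite hol_app, E1, H2.
        rewrite (hol_short J _ s s_pos delta' Hd' (f x) W1) by lia. rewrite E1.
        simpl hol. fold y. unfold delta'.
        assert (Sq : delta (g (f x)) (g (f y)) = delta (g (f x)) x ** delta x y ** delta y (g (f y))).
        { pose proof (Hgf x). pose proof (Hgf y). pose proof (Hgl (f x) (f y)).
          pose proof (wdist_tri _ _ GI (g (f x)) x y).
          rewrite (Hd (g (f x)) x y) by lia. symmetry. apply Hd; [lia| |nia].
          rewrite wdist_sym by auto. lia. }
        rewrite Sq. rewrite !mul_assoc. do 2 f_equal.
        rewrite <- (mul_assoc _ (delta y (g (f y)))), Hin'. group. }
  destruct (Main (rung_relation n) e1) as (W & E1 & L & H).
  assert (Er : eval I (rung_relation n) = e1) by now apply rung_relation_trivial.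
  rewrite Er, gmulg1 in E1, H.
  assert (EW : eval J W = e1).
  { apply (mul_left_inj _ (f e1)). now rewrite E1, gmulg1. }
  assert (LW : length W <= 2 * ell (S n)).
  { pose proof (rung_relation_length n). etransitivity; [exact L|]. nia. }
  apply (eval_below J (S n) W LW) in EW.
  rewrite (hol_trivial J _ s s_pos delta' Hd' (below J (S n))) in H.
  - assert (E : hol delta e1 (rung_relation n) = e1).
    { apply (mul_left_inj _ (delta (g (f e1)) e1)), (mul_right_inj _ (delta e1 (g (f e1)))).
      rewrite <- H, gmulg1. symmetry. apply Hin. }
    unfold delta in E. rewrite hol_lift in E by auto.
    apply rung_relation_trivial in E. destruct E as [_ E]. lia.
  - now intros m [Hm _].
  - intros m [Hm Lm]. apply s_rungs.
    assert (m <> n) by (intros ->; contradiction). lia.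
  - exact EW.
Qed.

End Transport.

Lemma doubles_not_quasi_isometric (I J : nat -> Prop) :
  (forall N, exists n, N <= n /\ I n /\ ~ J n) -> ~ quasi_isometric (gens I) (gens J).
Proof.
  intros HN (f & lam & c & H1 & H2).
  pose proof (gens_generate I) as GI. pose proof (gens_generate J) as GJ.
  set (B := lam + c).
  destruct (HN (S (S (10 * (lam * (3 + B + 2 * c) + c + 2 * (lam * c + c) + B + 2))))) as (n & Ln & In & Jn).
  destruct n as [|k]; [lia|]. destruct k as [|m]; [lia|].
  (* [e] is the largest rung length below index [n = m + 2]. The scale [s'] will be [A e], with [A]
     determined by [lam] and [c], while [ell n = (m + 4) e] outgrows it for large [n]. *)
  set (e := ell (S m)). assert (He : 1 <= e) by apply ell_pos.
  set (s := 2 * e + 1 + B).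
  assert (E1 : ell (S (S m)) = (m + 4) * e) by (unfold e; simpl; nia).
  assert (E2 : ell (S (S (S m))) = (m + 5) * ((m + 4) * e)) by (rewrite <- E1; simpl; nia).
  set (A := lam * (3 + B + 2 * c) + c + 2 * (lam * c + c) + B + 2) in *.
  assert (HAe : A <= A * e) by (rewrite <- (Nat.mul_1_r A) at 1; apply Nat.mul_le_mono_l; lia).
  assert (Hs : lam * (s + 2 * c) + c <= A * e).
  { assert (T : s + 2 * c <= (3 + B + 2 * c) * e).
    { assert (B * 1 <= B * e) by (apply Nat.mul_le_mono_l; lia).
      assert (c * 1 <= c * e) by (apply Nat.mul_le_mono_l; lia). unfold s. lia. }
    apply (Nat.mul_le_mono_l _ _ lam) in T.
    assert (T2 : (lam * (3 + B + 2 * c) + c) * e <= A * e)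
      by (apply Nat.mul_le_mono_r; unfold A; lia).
    assert (c * 1 <= c * e) by (apply Nat.mul_le_mono_l; lia). lia. }
  assert (HA : 3 * (A * e) <= 2 * ell (S (S m))).
  { assert (T : 3 * A * e <= 2 * (m + 4) * e) by (apply Nat.mul_le_mono_r; lia). lia. }
  assert (HB : B * (2 * (2 * ell (S (S m)) + 1)) <= 2 * ell (S (S (S m)))).
  { replace (ell (S (S (S m)))) with ((m + 5) * ell (S (S m))) by lia.
    set (X := ell (S (S m))). pose proof (ell_pos (S (S m)) : 1 <= X).
    assert (B * 1 <= B * X) by (apply Nat.mul_le_mono_l; lia).
    assert (3 * B * X <= (m + 5) * X) by (apply Nat.mul_le_mono_r; unfold A in Ln; lia). lia. }
  apply (no_transport I J (S (S m)) In Jn f lam c) with (s := s) (s' := A * e).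
  - intros x y. exact (proj1 (H1 x y _ _ (proj2 (dist_wdist _ _ GI x y _) eq_refl) (proj2 (dist_wdist _ _ GJ (f x) (f y) _) eq_refl))).
  - intros x y. exact (proj2 (H1 x y _ _ (proj2 (dist_wdist _ _ GI x y _) eq_refl) (proj2 (dist_wdist _ _ GJ (f x) (f y) _) eq_refl))).
  - intro z. destruct (H2 z) as [x Hx]. exists x. now apply (wdist_le _ _ GJ).
  - intros j Hj. assert (ell j <= e); [|unfold s; lia].
    destruct (Nat.eq_dec j (S m)) as [->|]; auto. pose proof (ell_lt j (S m) ltac:(lia)). unfold e. lia.
  - unfold s. lia.
  - exact Hs.
  - transitivity A; [unfold A; lia|exact HAe].
  - exact HA.
  - exact HB.
Qed.

(** The first [m] digits of [i] in binary behind a leading 1, so that the code also determines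
    [m]. *)
Fixpoint prefix_code (i : nat -> bool) (m : nat) : nat :=
  match m with O => 1 | S m' => 2 * prefix_code i m' + Nat.b2n (i m') end.

Lemma prefix_code_ge i m : m < prefix_code i m.
Proof. induction m as [|m IH]; simpl; lia. Qed.

Lemma prefix_code_inj i j m m' : prefix_code i m = prefix_code j m' ->
  m = m' /\ forall k, k < m -> i k = j k.
Proof.
  revert m'. induction m as [|m IH]; intros [|m'] E; simpl in E.
  - split; auto. lia.
  - pose proof (prefix_code_ge j m'). lia.
  - pose proof (prefix_code_ge i m). lia.
  - assert (E1 : prefix_code i m = prefix_code j m') by (destruct (i m), (j m'); simpl in E; lia).
    destruct (IH m' E1) as [<- H]. split; auto. intros k Hk.
    destruct (Nat.eq_dec k m) as [->|]; [|apply H; lia].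
    rewrite E1 in E. destruct (i m), (j m); simpl in E; auto; lia.
Qed.

Definition rungs (i : nat -> bool) (n : nat) : Prop := exists m, n = prefix_code i m.

(** Codes of prefixes that reach beyond the first difference are never shared, so the sets of two
    distinct sequences have only finitely many codes in common. *)
Lemma rungs_differ i j : (exists n, i n <> j n) -> forall N, exists n, N <= n /\ rungs i n /\ ~ rungs j n.
Proof.
  intros [k Hk] N. exists (prefix_code i (N + S k)). split; [|split].
  - pose proof (prefix_code_ge i (N + S k)). lia.
  - now exists (N + S k).
  - intros [m E]. apply Hk. apply (prefix_code_inj _ _ _ _ E). lia.
Qed.

Theorem theorem6p1 :
  exists (Gs : (nat -> bool) -> Group) (Ss : forall i, list (carrier (Gs i))),
    (forall i, generates (Ss i)) /\
    (forall i, torsion_free (Gs i)) /\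
    (forall i j, (exists n, i n <> j n) -> ~ quasi_isometric (Ss i) (Ss j)) /\
    (forall i (g : Gs i), g <> gone (Gs i) ->
        strongly_contracting (Ss i) (cyclic_sub g)) /\
    (forall i, HEC (Gs i)).
Proof.
  exists (fun i => Dbl (rungs i)), (fun i => gens (rungs i)).
  split; [|split; [|split; [|split]]].
  - intro i. apply gens_generate.
  - intros i g. apply dbl_infinite_order.
  - intros i j H. apply doubles_not_quasi_isometric. now apply rungs_differ.
  - intro i. apply dbl_contracting.
  - intro i. apply dbl_HEC.
Qed.
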